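(* For each $N$ let $a_1,\dots,a_N\in\mathbb{C}$ satisfy $\sum_{n=1}^N|a_n|^2=1$, and let $\lambda=\lambda_N$ satisfy $N^{\frac14+\frac1{10}}\lessapprox \lambda\le N^{\frac12}$. Then $$\Big|\Big\{x\in[0,1]:\ \sup_{t}\Big|\sum_{n=1}^Na_n e(nx+n^2t)\Big|\ge \lambda\Big\}\Big|\lessapprox \frac{N}{\lambda^4},$$ where the supremum is over $t\in\mathbb{R}$ (equivalently $t\in[0,1]$). The implicit constants in the conclusion depend only on $\epsilon$ and on the implicit constants in the hypothesis $N^{\frac14+\frac1{10}}\lessapprox\lambda$ (not on $N$, $\lambda$ or the coefficients $a_n$).
   Context: $e(z)=e^{2\pi i z}$; $|E|$ denotes the Lebesgue measure of a set $E\subset[0,1]$. $N$ is a positive integer (the main scale parameter). For quantities $A=A_N$, $B=B_N$, $A\lessapprox B$ means: for every $\epsilon>0$ there is a constant $C_\epsilon$, independent of $N$, with $A\le C_\epsilon N^\epsilon B$. *)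

(* Defs.v *)
From HB Require Import structures.
From mathcomp Require Import all_boot all_order all_algebra.
From mathcomp Require Import complex.
From mathcomp Require Import all_classical all_reals all_analysis.

Set Implicit Arguments.
Unset Strict Implicit.
Unset Printing Implicit Defensive.

Import Order.TTheory GRing.Theory Num.Theory.
Import numFieldNormedType.Exports.

Local Open Scope classical_set_scope.
Local Open Scope ring_scope.

(* e(x) = e^{2 pi i x}, for real x, by Euler's formula. *)
Definition e (R : realType) (x : R) : R[i] :=
  (cos (2 * pi * x) +i* sin (2 * pi * x))%C.

(* The norm `|z| of z : R[i] is R[i]-valued; normc is the same norm in R. *)
Definition cabs (R : realType) (z : R[i]) : R := ComplexField.Normc.normc z.

Definition expsum (R : realType) (N : nat) (a : nat -> R[i]) (x t : R) : R[i] :=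
  \sum_(1 <= n < N.+1) a n * e (n%:R * x + n%:R ^+ 2 * t).

Definition maxexpsum (R : realType) (N : nat) (a : nat -> R[i]) (x : R) : \bar R :=
  ereal_sup [set (cabs (expsum N a x t))%:E | t in [set: R]].

Definition levelset (R : realType) (N : nat) (a : nat -> R[i]) (lam : R) : set R :=
  [set x | 0 <= x <= 1 /\ (lam%:E <= maxexpsum N a x)%E].

(* A_N is bounded by B_N up to N^eps losses, with C eps as the implicit
   constant C_eps.  The constants are explicit so that one can say what they
   depend on. *)
Definition lessapprox (R : realType) (C : R -> R) (A B : nat -> \bar R) : Prop :=
  forall eps : R, 0 < eps ->
    0 < C eps /\
    forall N : nat, (0 < N)%N -> (A N <= (C eps * N%:R `^ eps)%:E * B N)%E.

(* Main.v *)
Require Import Defs.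
From mathcomp Require Import all_boot all_order all_algebra.
From mathcomp Require Import complex.
From mathcomp Require Import all_classical all_reals all_analysis.
From mathcomp Require Import ring lra zify.

(** Pick one point [(x, t)] with [|f(x, t)|] at least about [lam] over each interval
    [[j/N, (j+1)/N)] that meets the level set. By duality, the sums of the Weyl kernel
    [|K(x - x', t - t')|] over [A * A] are bounded below for every subset [A] of these
    points, and Weyl differencing shows that [K] is large only if [2 (t - t')] and
    [2 (x - x')] are close to fractions [b/q] and [a/q] with a common small denominator.
    After dyadic pigeonholing this is a dense graph whose edges carry labels [(q, a, b)].
    For a path [x - z - y], let [D] be the reduced denominator of the difference of the
    two [t]-fractions and [F] the common denominator of both differences. For a popular
    pair [(x, y)] the number of such [z] is bounded by counting Farey fractions. For an
    edge [(x, z)] the number of such [y] is bounded by direct counting and, a second time,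
    by duality applied to the [y] themselves, whose mutual differences lie near a lattice.
    The three bounds are incompatible with more than [N^eps N^2 / lam^4] points once
    [lam^20 >= N^7], that is, [lam >= N^(1/4 + 1/10)]. *)

Import Order.TTheory GRing.Theory Num.Theory.
Import numFieldNormedType.Exports.

Set Implicit Arguments.
Unset Strict Implicit.
Unset Printing Implicit Defensive.

Local Open Scope ring_scope.

(** Why the threshold is [N^7]: let [mu = lam^2 / 8], let [kap >= mu] be the dyadic size of the
    kernel on the edges, drop powers of [S], and suppose that there are [n > N^2 / mu^2] points. The
    labels then satisfy [Q W = N^2 / kap^2], with [Q] the size of [q] and [W / N] the error in x. A
    popular pair has at most [W Q^2 / F] common neighbours, times two Farey factors
    [1 + D^2 W / N^2] and [1 + F^2 W / (N D)]. If both are trivial this forces [F < Q], against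
    [F > Q] from direct counting. If only the second is large it forces [F / D > kap^2 / N]; direct
    counting does not see [D], and a bound that improves when [D] is much smaller than [F] is
    needed. Duality gives one: neighbours [y] of [z] with equal path parameters have t-differences
    near multiples of one fraction [1 / m] with [m] at most of order [Q D / F], so the labels
    between them divide [m]. Its main term yields [(F / D)^3 < N^2 Q / kap^2], hence [kap^10 < N^7].
    With both factors large, [D] and [F] at most of order [Q^2] lead to the same inequality. *)

Ltac nonneg := match goal with
  | H : is_true (0 <= ?x) |- is_true (0 <= ?x) => exact H
  | H : is_true (0 < ?x) |- is_true (0 <= ?x) => exact (ltW H)
  | |- is_true (0 <= `|_|) => exact: normr_ge0
  | |- is_true (0 <= _ *+ _) => first [exact: ler0n | apply: mulrn_wge0; nonneg]
  | |- is_true (0 <= _ * _) => apply: mulr_ge0; nonneg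
  | |- is_true (0 <= _ + _) => apply: addr_ge0; nonneg
  | |- is_true (0 <= _^-1) => rewrite invr_ge0; nonneg
  | |- is_true (0 <= _ ^+ _) => apply: exprn_ge0; nonneg
  | |- _ => by []
  end.
Ltac positive := match goal with
  | H : is_true (0 < ?x) |- is_true (0 < ?x) => exact H
  | |- is_true (0 < _ * _) => apply: mulr_gt0; positive
  | |- is_true (0 < _ + _) => apply: addr_gt0; positive
  | |- is_true (0 < _^-1) => rewrite invr_gt0; positive
  | |- is_true (0 < _ ^+ _) => apply: exprn_gt0; positive
  | |- _ => by []
  end.

(** * Counting by fibres; spacing of fractions and residues *)

(** The key type is only an [eqType] (integers, pairs), so the number of values of [f] is measured
    by arbitrary duplicate-free lists of attained values, the form in which the spacing bounds below
    deliver it. Every neighbour count is a chain of uses of this lemma, one per parameter. *)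
Lemma card_le_fibers (R : realType) (I : finType) (K : eqType) (A : {set I})
    (f : I -> K) (m n : R) :
  0 <= n ->
  (forall s : seq K, uniq s ->
     (forall k, k \in s -> exists2 i, i \in A & f i = k) -> (size s)%:R <= m) ->
  (forall i, i \in A -> #|[set j in A | f j == f i]|%:R <= n) ->
  #|A|%:R <= m * n.
Proof.
move=> n0 keys fib.
pose s := undup [seq f i | i <- enum A].
have sA k : k \in s -> exists2 i, i \in A & f i = k.
  by rewrite mem_undup => /mapP[j]; rewrite mem_enum => jA ->; exists j.
have -> : #|A| = (\sum_(k <- s) #|[set j in A | f j == k]|)%N.
  rewrite -sum1_card.
  under [RHS]eq_bigr do rewrite -sum1_card.
  under [RHS]eq_bigr => k _.
    under eq_bigl do rewrite inE.
    rewrite big_mkcondr.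
    over.
  rewrite exchange_big /=; apply: eq_bigr => i iA.
  rewrite -big_mkcond /= sum1_count.
  have -> : count (fun k => f i == k) s = count_mem (f i) s.
    by apply: eq_count => k /=; rewrite eq_sym.
  rewrite count_uniq_mem ?undup_uniq // mem_undup map_f ?mem_enum //.
rewrite natr_sum.
apply: (@le_trans _ _ (\sum_(k <- s) n)).
  rewrite big_seq [leRHS]big_seq; apply: ler_sum => k /sA[i iA <-]; exact: fib.
rewrite big_const_seq count_predT iter_addr_0 -mulr_natl ler_wpM2r //.
by apply: keys => //; exact: undup_uniq.
Qed.

(** The window of length [2 l] is cut into cells of length [d]; spacing makes the cell index [h]
    injective. *)
Lemma spaced_size (R : realType) (K : eqType) (s : seq K) (g : K -> R) (c l d : R) :
  0 < d -> 0 <= l -> uniq s ->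
  {in s &, forall x y, x != y -> d <= `|g x - g y|} ->
  (forall x, x \in s -> `|g x - c| <= l) ->
  (size s)%:R <= 2 * l / d + 1.
Proof.
move=> d0 l0 us sp near.
pose h x := Num.truncn ((g x - (c - l)) / d).
have hge x : x \in s -> 0 <= (g x - (c - l)) / d.
  by move=> /near; rewrite ler_norml => /andP[? ?]; apply: divr_ge0; lra.
have hinj : {in s &, injective h}.
  move=> x y xs ys hxy; apply/eqP; apply/negPn/negP => /(sp x y xs ys).
  have /andP[a1 a2] := truncn_itv (hge x xs).
  have /andP[b1 b2] := truncn_itv (hge y ys).
  move: a1 a2 b1 b2; rewrite -/(h x) -/(h y) hxy => a1 a2 b1 b2.
  have e z : g z = (g z - (c - l)) / d * d + (c - l).
    by rewrite divfK ?subrK // gt_eqF.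
  set u := (g x - (c - l)) / d in a1 a2; set v := (g y - (c - l)) / d in b1 b2.
  have -> : g x - g y = (u - v) * d by rewrite (e x) (e y) -/u -/v; ring.
  rewrite normrM (gtr0_norm d0) -{1}[d]mul1r ler_pM2r // => H.
  have: `|u - v| < 1.
    by rewrite ltr_norml; move: a1 a2 b1 b2; rewrite -addn1 natrD => *; lra.
  by rewrite ltNge H.
have /(_ (iota 0 (Num.truncn (2 * l / d)).+1)) sz := uniq_leq_size (s1 := map h s) _.
have L0 : 0 <= 2 * l / d by rewrite !mulr_ge0 ?invr_ge0 // ltW.
have := sz _; rewrite map_inj_in_uniq // size_map size_iota => /(_ us) {}sz.
have /andP[t1 t2] := truncn_itv L0.
apply: (@le_trans _ _ (Num.truncn (2 * l / d)).+1%:R); last first.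
  by rewrite -addn1 natrD lerD2r.
rewrite ler_nat; apply: sz => k /mapP[x xs ->]; rewrite mem_iota /= add0n ltnS.
apply: le_truncn; rewrite ler_pM2r ?invr_gt0 //.
by move: (near x xs); rewrite ler_norml => /andP[? ?]; lra.
Qed.

Lemma ge1_intr_norm (R : realType) (z : int) : z != 0 -> 1 <= `|z%:~R : R|.
Proof.
move=> z0; rewrite -intr_norm -[1]/(1%:~R) ler_int.
by rewrite -gtz0_ge1 normr_gt0.
Qed.

Lemma reduced_fraction_inj (b b' : int) (q q' : nat) :
  coprime `|b|%N q -> coprime `|b'|%N q' -> (0 < q)%N -> (0 < q')%N ->
  b * q'%:Z = b' * q%:Z -> (b, q) = (b', q').
Proof.
move=> c c' q0 q0' E.
have En : (`|b| * q' = `|b'| * q)%N by move/(congr1 absz): E; rewrite !abszM.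
have qq' : q = q'.
  apply/eqP; rewrite eqn_dvd; apply/andP; split.
    by rewrite -(@Gauss_dvdr q `|b|) 1?coprime_sym // En dvdn_mull.
  by rewrite -(@Gauss_dvdr q' `|b'|) 1?coprime_sym // -En dvdn_mull.
rewrite -qq'; congr pair; move: E; rewrite -qq'; apply: mulIf.
by rewrite -lt0n in q0 *; case: (q) q0.
Qed.

Lemma frac_dist (R : realType) (b b' : int) (q q' : nat) :
  (0 < q)%N -> (0 < q')%N -> b * q'%:Z != b' * q%:Z ->
  1 / (q%:R * q'%:R) <= `|b%:~R / q%:R - b'%:~R / q'%:R : R|.
Proof.
move=> q0 q0' ne.
have q1 : 0 < q%:R :> R by rewrite ltr0n.
have q1' : 0 < q'%:R :> R by rewrite ltr0n.
have -> : b%:~R / q%:R - b'%:~R / q'%:R = (b * q' - b' * q)%:~R / (q%:R * q'%:R) :> R.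
  by rewrite intrB !intrM; field; rewrite !gt_eqF.
rewrite normrM normfV (gtr0_norm (mulr_gt0 q1 q1')).
by rewrite ler_pM2r ?invr_gt0 ?mulr_gt0 // ge1_intr_norm // subr_eq0.
Qed.

(** Distinct reduced fractions with denominators at most [M] are at least [1 / M^2] apart. *)
Lemma farey_size (R : realType) (s : seq (int * nat)) (th l M : R) :
  0 <= l -> 0 < M -> uniq s ->
  (forall p, p \in s -> [/\ (0 < p.2)%N, p.2%:R <= M, coprime `|p.1|%N p.2 &
                         `|th - p.1%:~R / p.2%:R| <= l]) ->
  (size s)%:R <= 2 * l * M ^+ 2 + 1.
Proof.
move=> l0 M0 us H.
have -> : M ^+ 2 = (1 / M ^+ 2)^-1 by rewrite div1r invrK.
apply: (@spaced_size R _ s (fun p => p.1%:~R / p.2%:R) th l) => //.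
- by rewrite div1r invr_gt0 exprn_gt0.
- move=> [b q] [b' q'] /H /= [q0 qM c _] /H /= [q0' qM' c' _] ne.
  apply: le_trans (@frac_dist R b b' q q' q0 q0' _); last first.
    apply: contra ne => /eqP E; apply/eqP; exact: reduced_fraction_inj.
  rewrite !div1r lef_pV2 ?posrE ?exprn_gt0 ?mulr_gt0 ?ltr0n //.
  by rewrite expr2 ler_pM.
- by move=> p /H[_ _ _]; rewrite distrC.
Qed.

Lemma residue_size (R : realType) (s : seq int) (u : nat) (M : R) :
  (0 < u)%N -> 0 <= M -> uniq s ->
  {in s &, forall a b, (u%:Z %| a - b)%Z} ->
  (forall a, a \in s -> `|a%:~R| <= M) ->
  (size s)%:R <= 2 * M / u%:R + 1.
Proof.
move=> u0 M0 us H near.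
apply: (@spaced_size R _ s intr 0) => // [|a b /H h /h ab ne|a /near]; last by rewrite subr0.
  by rewrite ltr0n.
have /dvdzP[k E] := ab; rewrite -intrB E intrM normrM -{1}[u%:R]mul1r.
rewrite -pmulrn (ger0_norm (ler0n R u)) ler_pM2r ?ltr0n // ge1_intr_norm //.
by apply: contraNneq ne => k0; rewrite -subr_eq0 E k0 mul0r.
Qed.

(* [bdiff = v b - u b'] and [adiff = v a - u a'] are the numerators of
   [b / q - b' / q'] and [a / q - a' / q'] over the denominator [g u v].
   [pD] is the reduced denominator of the first, [pF] the least common denominator
   of both. *)
Record path_data := PathData {
  pgcd : nat; pu : nat; pv : nat; pc : nat; pk : nat; pB : int; pA : int }.

Definition pD (p : path_data) : nat := (pu p * pv p * (pgcd p %/ pc p))%N.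
Definition pF (p : path_data) : nat := (pu p * pv p * (pgcd p %/ pk p))%N.

(** [c] is the cancellation in the difference of the t-fractions, and [k], which equals
    [gcd(g u v, bdiff, adiff)], is the cancellation common to both differences. Only [b] will be
    known to be coprime to [q], so the x-fractions are handled through the common denominator. *)
Definition path_of (q : nat) (a b : int) (q' : nat) (a' b' : int) : path_data :=
  let g := gcdn q q' in let u := (q %/ g)%N in let v := (q' %/ g)%N in
  let bdiff := b * v%:Z - b' * u%:Z in let adiff := a * v%:Z - a' * u%:Z in
  let c := gcdn `|bdiff|%N (g * u * v) in
  let k := gcdn c `|adiff|%N in
  PathData g u v c k (bdiff %/ c%:Z)%Z (adiff %/ k%:Z)%Z.

Record path_spec (q : nat) (a b : int) (q' : nat) (a' b' : int) (p : path_data) : Prop :=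
  PathSpec {
    pathg0 : (0 < pgcd p)%N; pathu0 : (0 < pu p)%N; pathv0 : (0 < pv p)%N;
    pathc0 : (0 < pc p)%N; pathk0 : (0 < pk p)%N;
    pathq : q = (pgcd p * pu p)%N; pathq' : q' = (pgcd p * pv p)%N;
    pathuv : coprime (pu p) (pv p);
    pathcu : coprime (pc p) (pu p); pathcv : coprime (pc p) (pv p);
    pathcg : (pc p %| pgcd p)%N; pathkc : (pk p %| pc p)%N;
    pathB : b * (pv p)%:Z - b' * (pu p)%:Z = pB p * (pc p)%:Z;
    pathA : a * (pv p)%:Z - a' * (pu p)%:Z = pA p * (pk p)%:Z;
    pathBD : coprime `|pB p|%N (pD p);
    pathAk : coprime `|pA p|%N (pc p %/ pk p) }.

Lemma coprime_quotients (m n : nat) : (0 < gcdn m n)%N ->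
  coprime (m %/ gcdn m n) (n %/ gcdn m n).
Proof.
move=> g0.
by rewrite /coprime -(eqn_pmul2r g0) muln_gcdl !divnK ?dvdn_gcdl ?dvdn_gcdr // mul1n.
Qed.

(** Modulo a common divisor of [c] and [u] the numerator reduces to [b v], and both factors are
    coprime to [u]. This confines the cancellation in a difference of reduced fractions to the gcd
    of their denominators. *)
Lemma coprime_bdiff (c u v : nat) (b b' : int) :
  (c %| `|(b * v%:Z - b' * u%:Z)%R|)%N -> coprime u v -> coprime `|b|%N u ->
  coprime c u.
Proof.
move=> h cuv cbu; set d := gcdn c u; rewrite /coprime -/d.
have du : (d %| u)%N by exact: dvdn_gcdr.
have : (d%:Z %| b * v%:Z)%Z.
  have -> : b * v%:Z = (b * v%:Z - b' * u%:Z) + b' * u%:Z by rewrite subrK.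
  apply: rpredD; last by rewrite dvdz_mull.
  by rewrite /dvdz /=; apply: dvdn_trans h; exact: dvdn_gcdl.
rewrite dvdzE abszM !absz_nat Gauss_dvdr; last first.
  by rewrite coprime_sym; apply: coprime_dvdr du cbu.
move=> dv; have : (d %| gcdn u v)%N by rewrite dvdn_gcd du dv.
by rewrite (eqP cuv) dvdn1.
Qed.

Lemma absz_divz_dvd (m : int) (d : nat) : (0 < d)%N -> (d %| `|m|)%N ->
  `|(m %/ d%:Z)%Z|%N = (`|m| %/ d)%N.
Proof.
move=> d0 dm; have /divzK E : (d%:Z %| m)%Z by rewrite /dvdz.
by rewrite -[in RHS]E abszM absz_nat mulnK.
Qed.

Lemma path_ofP (q : nat) (a b : int) (q' : nat) (a' b' : int) :
  (0 < q)%N -> (0 < q')%N -> coprime `|b|%N q -> coprime `|b'|%N q' ->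
  path_spec q a b q' a' b' (path_of q a b q' a' b').
Proof.
move=> q0 q0' cb cb'.
rewrite /path_of; set g := gcdn q q'; set u := (q %/ g)%N; set v := (q' %/ g)%N.
set bd := b * _ - _; set ad := a * _ - _.
set c := gcdn _ (g * u * v); set k := gcdn c _.
have g0 : (0 < g)%N by rewrite gcdn_gt0 q0.
have qE : q = (g * u)%N by rewrite mulnC divnK // dvdn_gcdl.
have qE' : q' = (g * v)%N by rewrite mulnC divnK // dvdn_gcdr.
have u0 : (0 < u)%N by move: q0; rewrite qE muln_gt0 => /andP[].
have v0 : (0 < v)%N by move: q0'; rewrite qE' muln_gt0 => /andP[].
have m0 : (0 < g * u * v)%N by rewrite !muln_gt0 g0 u0.
have c0 : (0 < c)%N by rewrite gcdn_gt0 m0 orbT.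
have k0 : (0 < k)%N by rewrite gcdn_gt0 c0.
have cuv : coprime u v by exact: coprime_quotients.
have cu : coprime c u.
  apply: (@coprime_bdiff c u v b b') => //; first exact: dvdn_gcdl.
  by apply: coprime_dvdr cb; rewrite qE dvdn_mull.
have cv : coprime c v.
  apply: (@coprime_bdiff c v u b' b); rewrite 1?coprime_sym //.
    by rewrite distnC; exact: dvdn_gcdl.
  by rewrite coprime_sym; apply: coprime_dvdr cb'; rewrite qE' dvdn_mull.
have cg : (c %| g)%N.
  by rewrite -(Gauss_dvdl _ cu) -(Gauss_dvdl _ cv) dvdn_gcdr.
have kc : (k %| c)%N by exact: dvdn_gcdl.
split => //=.
- by rewrite divzK // dvdzE; exact: dvdn_gcdl.
- by rewrite divzK // dvdzE; exact: dvdn_gcdr.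
- have -> : pD (PathData g u v c k (bd %/ c)%Z (ad %/ k)%Z) = (g * u * v %/ c)%N.
    by rewrite /pD /= muln_divA // mulnC mulnA.
  rewrite absz_divz_dvd ?dvdn_gcdl //.
  exact: coprime_quotients.
- rewrite absz_divz_dvd ?dvdn_gcdr // coprime_sym.
  exact: coprime_quotients.
Qed.

(** * Paths of length two in a dense graph *)

(** Cauchy-Schwarz against the constant function, as nonnegativity of the variance. With [d] the
    degree it bounds the number of paths of length two from below. *)
Lemma sum_sqr_ge (R : realType) (I : finType) (d : I -> R) :
  (\sum_z d z) ^+ 2 <= #|I|%:R * \sum_z d z ^+ 2.
Proof.
have [I0|I0] := posnP #|I|.
  rewrite big1 ?expr0n ?I0 ?mul0r // => z _; exfalso.
  by move: (fintype0 z); rewrite I0.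
have n0 : 0 < #|I|%:R :> R by rewrite ltr0n.
set n := #|I|%:R in n0 *; set e := \sum_z d z.
have : 0 <= \sum_z (d z - e / n) ^+ 2 by apply: sumr_ge0 => z _; exact: sqr_ge0.
under eq_bigr => z _ do rewrite sqrrB.
rewrite big_split sumrB /= sumr_const -[X in _ + X]mulr_natl -/n.
have -> : \sum_z d z * (e / n) *+ 2 = e * (e / n) * 2.
  by rewrite sumrMnl -mulr_suml mulr_natr.
set s := \sum_z d z ^+ 2; rewrite (_ : _ + _ = s - e ^+ 2 / n); last by field; rewrite gt_eqF.
by rewrite subr_ge0 ler_pdivrMr // mulrC.
Qed.

(* The popularity argument: some type class [k] and some edge [(x, z)] support many
   [y] for which the pair [(x, y)] has itself many common neighbours of type [k]. *)
Lemma rich_edge (R : realType) (I K : finType) (E : rel I) (tau : I -> I -> I -> K) (e n s : R) :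
  e = \sum_x \sum_z (E x z)%:R -> n = #|I|%:R -> s = #|K|%:R -> 0 < e -> 0 < n -> 0 < s ->
  exists k x z, E x z /\ e / (4 * n * s) <=
    #|[set y | [&& E x z, E y z, tau x z y == k &
      e ^+ 2 / (2 * n ^+ 3 * s) <= #|[set w | [&& E x w, E y w & tau x w y == k]]|%:R]]|%:R.
Proof.
move=> he hn hs e0 n0 s0.
pose cn k x y : {set I} := [set w | [&& E x w, E y w & tau x w y == k]].
pose rich k x y := e ^+ 2 / (2 * n ^+ 3 * s) <= #|cn k x y|%:R.
pose Y k x z : {set I} := [set y | [&& E x z, E y z, tau x z y == k & rich k x y]].
have [[k [x [z [xz h]]]]|no] := pselect (exists k x z, E x z /\ e / (4 * n * s) <= #|Y k x z|%:R).
  by exists k, x, z.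
exfalso; have small k x z : E x z -> #|Y k x z|%:R <= e / (4 * n * s).
  by move=> xz; rewrite leNgt; apply/negP => h; apply: no; exists k, x, z; split => //; exact: ltW.
have cs : e ^+ 2 <= n * \sum_z (\sum_x (E x z)%:R) ^+ 2.
  by rewrite he exchange_big hn; exact: sum_sqr_ge.
have paths : \sum_z (\sum_x (E x z)%:R) ^+ 2 = \sum_k \sum_x \sum_y #|cn k x y|%:R :> R.
  transitivity (\sum_z \sum_x \sum_y \sum_k ([&& E x z, E y z & tau x z y == k])%:R : R).
    apply: eq_bigr => z _; rewrite expr2 big_distrlr /=; apply: eq_bigr => x _.
    apply: eq_bigr => y _; rewrite (bigD1 (tau x z y)) //= eqxx andbT.
    rewrite big1 ?addr0 => [|k /negbTE nk]; last by rewrite eq_sym nk !andbF.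
    by case: (E x z); case: (E y z); rewrite ?mulr1 ?mulr0.
  rewrite exchange_big /= [RHS]exchange_big /=; apply: eq_bigr => x _.
  rewrite exchange_big /= [RHS]exchange_big /=; apply: eq_bigr => y _.
  rewrite exchange_big /=; apply: eq_bigr => k _.
  by rewrite -sum1_card natr_sum [RHS]big_mkcond /=; apply: eq_bigr => w _; rewrite inE; case: ifP.
have thr0 : 0 <= e ^+ 2 / (2 * n ^+ 3 * s).
  by rewrite divr_ge0 ?exprn_ge0 ?mulr_ge0 ?exprn_ge0 // ltW.
(* Poor pairs contribute at most [n^2] times the threshold; rich ones are recounted along the edges
   [(x, z)], each carrying few [y] by [small]. After summation over the types and multiplication by
   [n], the two parts are [e^2 / 4] and [e^2 / 2], short of the required [e^2]. *)
have each k : \sum_x \sum_y #|cn k x y|%:R <= e * (e / (4 * n * s)) + n ^+ 2 * (e ^+ 2 / (2 * n ^+ 3 * s)).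
  apply: (@le_trans _ _ (\sum_x \sum_y ((rich k x y)%:R * #|cn k x y|%:R + e ^+ 2 / (2 * n ^+ 3 * s)))).
    apply: ler_sum => x _; apply: ler_sum => y _.
    case: (boolP (rich k x y)) => [_|]; first by rewrite mul1r lerDl.
    by rewrite /rich -ltNge mul0r add0r => /ltW.
  under eq_bigr => x _ do rewrite big_split /= sumr_const.
  rewrite big_split /= sumr_const; apply: lerD; last first.
    by rewrite -mulrnA -[leLHS]mulr_natl natrM -hn expr2.
  have -> : \sum_x \sum_y (rich k x y)%:R * #|cn k x y|%:R = \sum_x \sum_z (E x z)%:R * #|Y k x z|%:R :> R.
    apply: eq_bigr => x _.
    transitivity (\sum_y \sum_z ([&& E x z, E y z, tau x z y == k & rich k x y])%:R : R).
      apply: eq_bigr => y _; rewrite -sum1_card natr_sum mulr_sumr [LHS]big_mkcond /=.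
      apply: eq_bigr => w _; rewrite inE.
      by case: (E x w); case: (E y w); case: (tau x w y == k); case: (rich k x y); rewrite /= ?mulr1.
    rewrite exchange_big /=; apply: eq_bigr => z _.
    rewrite -sum1_card natr_sum mulr_sumr [RHS]big_mkcond /=; apply: eq_bigr => y _.
    by rewrite inE; case: (E x z) => //=; case: ifP; rewrite ?mulr1.
  rewrite {1}he mulr_suml; apply: ler_sum => x _; rewrite mulr_suml; apply: ler_sum => z _.
  by case: (boolP (E x z)) => [xz|_]; rewrite ?mul0r // !mul1r small.
have total : \sum_k \sum_x \sum_y #|cn k x y|%:R <= s * (e * (e / (4 * n * s)) + n ^+ 2 * (e ^+ 2 / (2 * n ^+ 3 * s))) :> R.
  apply: le_trans (ler_sum _ (fun k _ => each k)) _.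
  by rewrite sumr_const -[leLHS]mulr_natl -hs.
move: cs; rewrite paths => cs.
have := le_trans cs (ler_wpM2l (ltW n0) total).
rewrite [leRHS](_ : _ = 3 / 4 * e ^+ 2); last by field; rewrite !gt_eqF.
have e20 : 0 < e ^+ 2 by rewrite exprn_gt0.
lra.
Qed.

Lemma nat_seq_size (R : realType) (s : seq nat) (M : R) :
  0 <= M -> uniq s -> (forall k, k \in s -> (0 < k)%N /\ k%:R <= M) ->
  (size s)%:R <= M.
Proof.
move=> M0 us H; have /andP[t1 _] := truncn_itv M0; apply: le_trans t1.
rewrite ler_nat -[leqRHS](size_iota 1); apply: uniq_leq_size => // k /H[k0 kM].
by rewrite mem_iota k0 add1n ltnS; have := le_truncn kM; rewrite natrK.
Qed.

(** * Counting neighbours in the graph *)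

Section Counting.

(* [S] absorbs all losses [N^eps]: divisor functions, logarithms and constants. *)
Variables (R : realType) (I : finType) (X T : I -> R).
Variables (q : I -> I -> nat) (a b : I -> I -> int) (E : rel I) (N Q W S : R).
Hypotheses (N1 : 1 <= N) (Q1 : 1 <= Q) (W1 : 1 <= W) (S1 : 1 <= S) (QWN : Q * W <= N).
(** [T] and [X] will be twice the coordinates of the points, as differencing a quadratic phase
    produces [2 t]. A single [W] measures both errors because each coordinate is taken at its
    natural scale, [1 / N^2] for t and [1 / N] for x. *)
Hypothesis hE : forall i j, E i j ->
  [/\ Q <= (q i j)%:R < 2 * Q, coprime `|b i j|%N (q i j),
      `|T i - T j - (b i j)%:~R / (q i j)%:R| <= W / N ^+ 2 &
      `|X i - X j - (a i j)%:~R / (q i j)%:R| <= W / N].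
Hypothesis divisors_bound :
  forall m : nat, (0 < m)%N -> m%:R <= 4 * Q ^+ 2 -> (size (divisors m))%:R <= S.
Hypothesis X_bound : forall i j, `|X i - X j| <= 2.
Hypothesis X_sep : forall c l : R, 0 <= l -> #|[set j | `|X j - c| <= l]|%:R <= N * l + 2.

Ltac base := move: N1 Q1 W1 S1 QWN => *.

Definition pth (x z y : I) := path_of (q x z) (a x z) (b x z) (q y z) (a y z) (b y z).

Definition typed (D0 F0 : R) (x z y : I) : bool :=
  [&& E x z, E y z, D0 <= (pD (pth x z y))%:R < 2 * D0 & F0 <= (pF (pth x z y))%:R < 2 * F0].

Lemma q_gt0 i j : E i j -> (0 < q i j)%N.
Proof. by move=> /hE[/andP[h _] _ _ _]; rewrite -(ltr0n R); base; lra. Qed.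

Lemma pthP x z y : E x z -> E y z ->
  path_spec (q x z) (a x z) (b x z) (q y z) (a y z) (b y z) (pth x z y).
Proof. by move=> h h'; apply: path_ofP; [exact: q_gt0|exact: q_gt0|by case: (hE h)|by case: (hE h')]. Qed.

Lemma WN_le1 : W / N <= 1.
Proof. by base; rewrite ler_pdivrMr ?mul1r; nra. Qed.

(** The 3 is the bound 2 for [|X i - X j|] plus the error [W / N <= 1]. *)
Lemma a_bound i j : E i j -> `|(a i j)%:~R : R| <= 3 * (q i j)%:R.
Proof.
move=> h; have q0 : 0 < (q i j)%:R :> R by rewrite ltr0n q_gt0.
have [_ _ _ hX] := hE h; have := X_bound i j; have := WN_le1 => w1 b2.
have : `|(a i j)%:~R / (q i j)%:R| <= 3 :> R.
  move: hX b2; rewrite !ler_norml => /andP[? ?] /andP[? ?].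
  by apply/andP; split; lra.
by rewrite normrM normfV (gtr0_norm q0) ler_pdivrMr.
Qed.

(** An interval of length about [W / N] holds about [W] points; the boundary term 2 of [X_sep] is
    absorbed by [1 <= W]. *)
Lemma X_interval (A : {set I}) (c : R) (m : R) : 0 < m ->
  (forall j, j \in A -> `|X j - c| <= m * W / N) -> #|A|%:R <= (m + 2) * W.
Proof.
move=> m0 h; base; have N0 : 0 < N by lra.
have /subset_leq_card : A \subset [set j | `|X j - c| <= m * W / N].
  by apply/fintype.subsetP => j /h; rewrite inE.
rewrite -(ler_nat R) => /le_trans; apply.
have l0 : 0 <= m * W / N by rewrite !mulr_ge0 ?invr_ge0; lra.
apply: le_trans (@X_sep c _ l0) _.
have -> : N * (m * W / N) = m * W by field; rewrite gt_eqF.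
by nra.
Qed.

(** A parameter that divides a known number costs only the factor [S]. *)
Lemma card_divisor_fibers (A : {set I}) (f : I -> nat) (m : nat) (n : R) :
  0 <= n -> (0 < m)%N -> m%:R <= 4 * Q ^+ 2 -> (forall i, i \in A -> (f i %| m)%N) ->
  (forall i, i \in A -> #|[set j in A | f j == f i]|%:R <= n) -> #|A|%:R <= S * n.
Proof.
move=> n0 m0 mQ fm; apply: card_le_fibers => // s us hs.
apply: le_trans (divisors_bound m0 mQ); rewrite ler_nat; apply: uniq_leq_size => // k.
by move=> /hs[j /fm jm <-]; rewrite -dvdn_divisors.
Qed.

(** [v] is invertible modulo [u], so the relation determines the first numerator modulo [u]. *)
Lemma dvd_path_numerators (u v k : nat) (a1 a1' a2 a2' A0 : int) :
  coprime u v -> a1 * v%:Z - a1' * u%:Z = A0 * k%:Z -> a2 * v%:Z - a2' * u%:Z = A0 * k%:Z ->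
  (u%:Z %| a1 - a2)%Z.
Proof.
move=> cuv h1 h2; have : (u%:Z %| (a1 - a2) * v%:Z)%Z.
  apply/dvdzP; exists (a1' - a2').
  have : a1 * v%:Z - a1' * u%:Z = a2 * v%:Z - a2' * u%:Z by rewrite h1 h2.
  lia.
by rewrite Gauss_dvdzl // coprimezE.
Qed.

(** The free parameters are [k], at most [2 Q / (f max(u, v))] because both [q] are below [2 Q];
    then [a x z], in one class modulo [u] and of size at most [3 k f u], so at most [7 k f] values;
    then [z] itself, confined by [X] to an interval with at most [3 W] points. As
    [max(u, v)^2 >= u v], the product is at most [84 Q^2 W / (f u v)]. *)
Lemma common_neighbours_fixed_ratio (x y : I) (A : {set I}) (u v f : nat) (A0 : int) :
  (0 < u)%N -> (0 < v)%N -> (0 < f)%N ->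
  (forall z, z \in A -> [/\ E x z, E y z, pu (pth x z y) = u, pv (pth x z y) = v &
     (pgcd (pth x z y) = pk (pth x z y) * f)%N /\ pA (pth x z y) = A0]) ->
  #|A|%:R <= 2 ^+ 7 * Q ^+ 2 * W / (f%:R * u%:R * v%:R).
Proof.
move=> u0 v0 f0 hA; base.
have u1 : 1 <= u%:R :> R by rewrite ler1n.
have v1 : 1 <= v%:R :> R by rewrite ler1n.
have f1 : 1 <= f%:R :> R by rewrite ler1n.
pose mx : R := Num.max u%:R v%:R.
have mxu : u%:R <= mx by rewrite /mx le_max lexx.
have mxv : v%:R <= mx by rewrite /mx le_max lexx orbT.
have mx0 : 0 < mx by lra.
have gb z : z \in A -> (pgcd (pth x z y))%:R <= 2 * Q / mx.
  move=> /hA[xz yz eu ev _]; have [_ _ _ _ _ q1 q2 _ _ _ _ _ _ _ _ _] := pthP xz yz.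
  have [/andP[_ b1] _ _ _] := hE xz; have [/andP[_ b2] _ _ _] := hE yz.
  rewrite ler_pdivlMr // /mx maxEle; case: ifP => _; apply: ltW.
    by rewrite -natrM -ev -q2.
  by rewrite -natrM -eu -q1.
apply: (@le_trans _ _ (84 * Q ^+ 2 * W / (f%:R * u%:R * v%:R))); last first.
  have ? : 0 <= W by lra.
  have ? : 0 <= Q by lra.
  by do 3!(apply: ler_wpM2r; first by nonneg); rewrite -natrX ler_nat.
have -> : 84 * Q ^+ 2 * W / (f%:R * u%:R * v%:R) =
   (2 * Q / (mx * f%:R)) * ((14 * Q / mx) * (3 * W)) * (mx ^+ 2 / (u%:R * v%:R)).
  by field; rewrite !gt_eqF //; lra.
apply: le_trans (_ : (2 * Q / (mx * f%:R)) * ((14 * Q / mx) * (3 * W)) <= _); last first.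
  rewrite ler_peMr //; first by rewrite !mulr_ge0 ?invr_ge0 ?mulr_ge0 //; lra.
  by rewrite ler_pdivlMr ?mul1r ?expr2 ?ler_pM ?mulr_gt0 //; lra.
apply: (@card_le_fibers _ _ _ A (fun z => pk (pth x z y))).
- by rewrite !mulr_ge0 ?invr_ge0 //; lra.
- move=> s us hs; apply: nat_seq_size => //.
    by rewrite !mulr_ge0 ?invr_ge0 ?mulr_ge0 //; lra.
  move=> k /hs[z zA <-]; have [xz yz _ _ [eg _]] := hA z zA.
  split; first exact: (pathk0 (pthP xz yz)).
  move: (gb z zA); rewrite eg natrM !ler_pdivlMr ?mulr_gt0 //; last by lra.
  by rewrite mulrCA mulrC.
move=> z0 z0A; set A1 := [set j in A | _].
have hA1 z : z \in A1 -> z \in A /\ pk (pth x z y) = pk (pth x z0 y).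
  by rewrite inE => /andP[? /eqP].
set k := pk (pth x z0 y) in hA1.
have {}hA1 z : z \in A1 -> [/\ E x z, E y z, q x z = (k * f * u)%N &
     (a x z) * v%:Z - (a y z) * u%:Z = A0 * k%:Z /\ coprime u v].
  move=> /hA1[zA ek]; have [xz yz eu ev [eg eA]] := hA z zA.
  have sp := pthP xz yz; split => //; first by rewrite (pathq sp) eg ek eu.
  by move: (pathA sp) (pathuv sp); rewrite eu ev ek eA.
have [xz0 yz0 eu0 ev0 [eg0 _]] := hA z0 z0A.
have kf0 : (0 < k * f)%N by move: (pathg0 (pthP xz0 yz0)); rewrite eg0.
have kfQ : (k * f)%:R <= 2 * Q / mx by move: (gb z0 z0A); rewrite eg0.
apply: (@card_le_fibers _ _ _ A1 (fun z => a x z)); first lra.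
- move=> s us hs.
  have M0 : 0 <= 3 * (k * f * u)%:R :> R by rewrite mulr_ge0.
  apply: (@le_trans _ _ (2 * (3 * (k * f * u)%:R) / u%:R + 1)).
    apply: residue_size => // [a1 a2 /hs[z1 /hA1[_ _ _ [e1 cuv]] <-] /hs[z2 /hA1[_ _ _ [e2 _]] <-]|a1].
      exact: dvd_path_numerators e1 e2.
    by move=> /hs[z /hA1[xz _ <- _] <-]; exact: a_bound.
  have k1 : 1 <= (k * f)%:R :> R by rewrite ler1n.
  rewrite natrM (_ : _ / _ = 6 * (k * f)%:R); last by field; rewrite gt_eqF //; lra.
  apply: (@le_trans _ _ (7 * (k * f)%:R)); first lra.
  by apply: (@le_trans _ _ (7 * (2 * Q / mx))); [lra|rewrite le_eqVlt; apply/orP; left; apply/eqP; ring].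
move=> z1 z1A1; rewrite (_ : 3 * W = (1 + 2) * W); last by ring.
apply: (@X_interval _ (X x - (a x z1)%:~R / (k * f * u)%:R) 1) => // z.
rewrite inE => /andP[/hA1[xz _ <- _] /eqP <-].
have [_ _ _] := hE xz; rewrite mul1r.
by rewrite (distrC (X z)) addrAC.
Qed.

Lemma path_ratioB (x z y : I) : E x z -> E y z -> let p := pth x z y in
  (b x z)%:~R / (q x z)%:R - (b y z)%:~R / (q y z)%:R = (pB p)%:~R / (pD p)%:R :> R.
Proof.
move=> xz yz p; have sp := pthP xz yz; rewrite -/p in sp.
have /dvdnP[g1 eg] := pathcg sp.
have eB : (b x z)%:~R * (pv p)%:R - (b y z)%:~R * (pu p)%:R = (pB p)%:~R * (pc p)%:R :> R.
  by have := congr1 (fun n : int => n%:~R : R) (pathB sp); rewrite intrB !intrM.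
have g0 : (pc p)%:R != 0 :> R by rewrite pnatr_eq0 -lt0n (pathc0 sp).
have u0 : (pu p)%:R != 0 :> R by rewrite pnatr_eq0 -lt0n (pathu0 sp).
have v0 : (pv p)%:R != 0 :> R by rewrite pnatr_eq0 -lt0n (pathv0 sp).
have g10 : g1%:R != 0 :> R.
  by rewrite pnatr_eq0 -lt0n; move: (pathg0 sp); rewrite eg muln_gt0 => /andP[].
rewrite (pathq sp) (pathq' sp) /pD eg mulnK ?(pathc0 sp) // !natrM.
have -> : (pB p)%:~R = ((b x z)%:~R * (pv p)%:R - (b y z)%:~R * (pu p)%:R) / (pc p)%:R :> R.
  by rewrite eB mulfK.
field.
by rewrite g0 u0 v0 g10.
Qed.

Lemma path_ratioA (x z y : I) : E x z -> E y z -> let p := pth x z y in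
  (a x z)%:~R / (q x z)%:R - (a y z)%:~R / (q y z)%:R = (pA p)%:~R / (pF p)%:R :> R.
Proof.
move=> xz yz p; have sp := pthP xz yz; rewrite -/p in sp.
have /dvdnP[g1 eg] := dvdn_trans (pathkc sp) (pathcg sp).
have eB : (a x z)%:~R * (pv p)%:R - (a y z)%:~R * (pu p)%:R = (pA p)%:~R * (pk p)%:R :> R.
  by have := congr1 (fun n : int => n%:~R : R) (pathA sp); rewrite intrB !intrM.
have g0 : (pk p)%:R != 0 :> R by rewrite pnatr_eq0 -lt0n (pathk0 sp).
have u0 : (pu p)%:R != 0 :> R by rewrite pnatr_eq0 -lt0n (pathu0 sp).
have v0 : (pv p)%:R != 0 :> R by rewrite pnatr_eq0 -lt0n (pathv0 sp).
have g10 : g1%:R != 0 :> R.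
  by rewrite pnatr_eq0 -lt0n; move: (pathg0 sp); rewrite eg muln_gt0 => /andP[].
rewrite (pathq sp) (pathq' sp) /pF eg mulnK ?(pathk0 sp) // !natrM.
have -> : (pA p)%:~R = ((a x z)%:~R * (pv p)%:R - (a y z)%:~R * (pu p)%:R) / (pk p)%:R :> R.
  by rewrite eB mulfK.
field.
by rewrite g0 u0 v0 g10.
Qed.

Lemma pF_pD (x z y : I) : E x z -> E y z -> let p := pth x z y in
  pF p = (pD p * (pc p %/ pk p))%N.
Proof.
move=> xz yz p; have sp := pthP xz yz; rewrite -/p in sp.
have /dvdnP[g1 eg] := pathcg sp; have /dvdnP[c1 ec] := pathkc sp.
rewrite /pF /pD eg mulnK ?(pathc0 sp) // ec mulnA !mulnK ?(pathk0 sp) //.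
by rewrite mulnA.
Qed.

Lemma pD_gt0 (x z y : I) : E x z -> E y z -> (0 < pD (pth x z y))%N.
Proof.
move=> xz yz; have sp := pthP xz yz.
rewrite /pD !muln_gt0 (pathu0 sp) (pathv0 sp) divn_gt0 ?(pathc0 sp) //.
exact: dvdn_leq (pathg0 sp) (pathcg sp).
Qed.

Lemma pF_gt0 (x z y : I) : E x z -> E y z -> (0 < pF (pth x z y))%N.
Proof.
move=> xz yz; have sp := pthP xz yz.
rewrite /pF !muln_gt0 (pathu0 sp) (pathv0 sp) divn_gt0 ?(pathk0 sp) //.
exact: dvdn_leq (pathg0 sp) (dvdn_trans (pathkc sp) (pathcg sp)).
Qed.

Lemma pD_le_pF (x z y : I) : E x z -> E y z -> (pD (pth x z y) <= pF (pth x z y))%N.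
Proof.
move=> xz yz; have := pF_gt0 xz yz; rewrite (pF_pD xz yz) muln_gt0 => /andP[_].
exact: leq_pmulr.
Qed.

Lemma pF_le (x z y : I) : E x z -> E y z -> (pF (pth x z y))%:R <= 4 * Q ^+ 2.
Proof.
move=> xz yz; have sp := pthP xz yz.
have [/andP[q1 b1] _ _ _] := hE xz; have [/andP[q2 b2] _ _ _] := hE yz.
have : (pF (pth x z y) <= q x z * q y z)%N.
  rewrite (pathq sp) (pathq' sp) /pF mulnACA mulnC leq_mul2r; apply/orP; right.
  by apply: leq_trans (leq_div _ _) _; rewrite leq_pmulr ?(pathg0 sp).
rewrite -(ler_nat R) natrM => /le_trans; apply; base.
rewrite (_ : 4 * Q ^+ 2 = (2 * Q) * (2 * Q)); last by ring.
by apply: ler_pM => //; lra.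
Qed.

(** [T x - T y] leaves few choices for [pB / pD], counted as Farey fractions. Once [D] is known,
    [D (X x - X y)] is near the reduced fraction [pA / (c / k)], whose denominator [F / D] is only
    of order [F0 / D0]: this produces [F0^2 W / (N D0)] in place of [F0^2 W / N]. Then [u] and [v]
    divide [D], and the count with fixed ratio applies. *)
Lemma common_neighbours (x y : I) (D0 F0 : R) : 1 <= D0 -> 1 <= F0 ->
  #|[set z | typed D0 F0 x z y]|%:R <=
    2 ^+ 16 * S ^+ 2 * W * (Q ^+ 2 / F0) * (D0 ^+ 2 * W / N ^+ 2 + 1) *
      (F0 ^+ 2 * W / (N * D0) + 1).
Proof.
move=> D1 F1; set A := [set z | _]; base.
have N0 : 0 < N by lra.
have Q0 : 0 < Q by lra.
have D00 : 0 < D0 by lra.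
have F00 : 0 < F0 by lra.
have W0 : 0 <= W by lra.
have S0 : 0 <= S by lra.
set mB := D0 ^+ 2 * W / N ^+ 2; set mA := F0 ^+ 2 * W / (N * D0).
have mB0 : 0 <= mB by rewrite /mB; nonneg.
have mA0 : 0 <= mA by rewrite /mA; nonneg.
have inner0 : 0 <= 2 ^+ 7 * (Q ^+ 2 / F0) * W by nonneg.
rewrite (_ : _ * _ = (2 ^+ 4 * (mB + 1)) * ((2 ^+ 5 * (mA + 1)) * (S * (S * (2 ^+ 7 * (Q ^+ 2 / F0) * W))))); last by ring.
have hA z : z \in A -> [/\ E x z, E y z, D0 <= (pD (pth x z y))%:R < 2 * D0 &
   F0 <= (pF (pth x z y))%:R < 2 * F0] by rewrite inE => /and4P.
apply: (@card_le_fibers _ _ _ A (fun z => (pB (pth x z y), pD (pth x z y)))).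
- by nonneg.
- move=> s us hs.
  have l0 : 0 <= 2 * W / N ^+ 2 by nonneg.
  have M0 : 0 < 2 * D0 by lra.
  apply: le_trans (@farey_size _ s (T x - T y) (2 * W / N ^+ 2) (2 * D0) l0 M0 us _) _.
    move=> p /hs[z /hA[xz yz /andP[_ hD] _] <-] /=; split.
    + exact: pD_gt0.
    + exact: ltW.
    + exact: pathBD (pthP xz yz).
    + rewrite -path_ratioB //.
      have [_ _ + _] := hE xz; have [_ _ + _] := hE yz; rewrite !ler_norml => /andP[? ?] /andP[? ?].
      by apply/andP; split; lra.
  rewrite (_ : 2 * _ * _ = 2 ^+ 4 * mB); last by rewrite /mB; field; rewrite gt_eqF.
  by rewrite mulrDr mulr1 lerD2l -natrX ler1n.
move=> z0 z0A; set A1 := [set j in A | _]; set D := pD (pth x z0 y).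
have hA1 z : z \in A1 -> z \in A /\ pD (pth x z y) = D.
  by rewrite inE xpair_eqE => /andP[? /andP[_ /eqP ->]].
have [xz0 yz0 /andP[D0D DD0] _] := hA _ z0A; rewrite -/D in D0D DD0.
have Dgt0 : (0 < D)%N by exact: pD_gt0.
have DR0 : 0 < D%:R :> R by rewrite ltr0n.
have DQ : D%:R <= 4 * Q ^+ 2.
  by apply: le_trans (pF_le xz0 yz0); rewrite ler_nat pD_le_pF.
apply: (@card_le_fibers _ _ _ A1 (fun z => (pA (pth x z y), (pc (pth x z y) %/ pk (pth x z y))%N))).
- by nonneg.
- move=> s us hs.
  have l0 : 0 <= 4 * D0 * W / N by nonneg.
  have M0 : 0 < 2 * F0 / D0 by positive.
  apply: le_trans (@farey_size _ s (D%:R * (X x - X y)) (4 * D0 * W / N) (2 * F0 / D0) l0 M0 us _) _.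
    move=> p /hs[z /hA1[/hA[xz yz _ /andP[_ hF]] eD] <-] /=.
    have eF : pF (pth x z y) = (D * (pc (pth x z y) %/ pk (pth x z y)))%N.
      by rewrite -eD; exact: pF_pD.
    have m0 : (0 < pc (pth x z y) %/ pk (pth x z y))%N.
      by move: (pF_gt0 xz yz); rewrite eF muln_gt0 => /andP[].
    have mR0 : (pc (pth x z y) %/ pk (pth x z y))%:R != 0 :> R by rewrite pnatr_eq0 -lt0n.
    split => //.
    + rewrite ler_pdivlMr //; apply: ltW; apply: le_lt_trans hF.
      by rewrite eF natrM mulrC ler_wpM2r.
    + exact: pathAk (pthP xz yz).
    + rewrite (_ : _ - _ = D%:R * (X x - X y - (pA (pth x z y))%:~R / (pF (pth x z y))%:R)); last first.
        by rewrite eF natrM; field; rewrite mR0 gt_eqF.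
      rewrite -path_ratioA // normrM gtr0_norm //.
      rewrite (_ : 4 * D0 * W / N = (2 * D0) * (2 * (W / N))); last by ring.
      apply: ler_pM => //; first exact: ltW.
      have [_ _ _] := hE xz; have [_ _ _] := hE yz; rewrite !ler_norml => /andP[? ?] /andP[? ?].
      by apply/andP; split; lra.
  rewrite (_ : 2 * _ * _ = 2 ^+ 5 * mA); last by rewrite /mA; field; rewrite !gt_eqF.
  by rewrite mulrDr mulr1 lerD2l -natrX ler1n.
move=> z1 z1A1; set A2 := [set j in A1 | _].
pose m := (pc (pth x z1 y) %/ pk (pth x z1 y))%N; pose A0 := pA (pth x z1 y).
have hA2 z : z \in A2 -> [/\ E x z, E y z, pD (pth x z y) = D, pF (pth x z y) = (D * m)%N &
    pA (pth x z y) = A0 /\ F0 <= (D * m)%:R].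
  rewrite inE xpair_eqE => /andP[/hA1[/hA[xz yz _ /andP[hF _]] eD] /andP[/eqP -> /eqP e2]].
  have eF : pF (pth x z y) = (D * m)%N by rewrite -eD /m -e2; exact: pF_pD.
  by split => //; split => //; rewrite -eF.
have n1 : 0 <= S * (2 ^+ 7 * (Q ^+ 2 / F0) * W) by nonneg.
apply: (card_divisor_fibers (f := fun z => pu (pth x z y)) n1 Dgt0 DQ).
  by move=> z /hA2[_ _ <- _ _]; rewrite /pD -mulnA dvdn_mulr.
move=> z2 z2A2; set A3 := [set j in A2 | _].
apply: (card_divisor_fibers (f := fun z => pv (pth x z y)) inner0 Dgt0 DQ).
  by move=> z; rewrite inE => /andP[/hA2[_ _ <- _ _] _]; rewrite /pD mulnAC dvdn_mull.
move=> z3 z3A3; set A4 := [set j in A3 | _].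
(* [f] is [g / k], because [D m = F = u v (g / k)]; hence [g = k f] on this fibre. *)
pose u := pu (pth x z3 y); pose v := pv (pth x z3 y); pose f := (D * m %/ (u * v))%N.
have [z3A2 eu3] : z3 \in A2 /\ pu (pth x z3 y) = pu (pth x z2 y).
  by move: z3A3; rewrite inE => /andP[? /eqP].
have [xz3 yz3 eD3 eF3 [eA3 hF]] := hA2 _ z3A2.
have u0 : (0 < u)%N := pathu0 (pthP xz3 yz3).
have v0 : (0 < v)%N := pathv0 (pthP xz3 yz3).
have uv0 : (0 < u * v)%N by rewrite muln_gt0 u0.
have fuv : (u * v * f = D * m)%N.
  by rewrite mulnC divnK // -eF3 /pF -/u -/v dvdn_mulr.
have f0 : (0 < f)%N.
  by move: (pF_gt0 xz3 yz3); rewrite eF3 -fuv muln_gt0 => /andP[].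
apply: le_trans (@common_neighbours_fixed_ratio x y A4 u v f A0 u0 v0 f0 _) _.
  move=> z; rewrite inE => /andP[]; rewrite inE => /andP[/hA2[xz yz _ eF [eA _]] /eqP eu] /eqP ev.
  have sp := pthP xz yz; split => //; first by rewrite eu -eu3.
  split => //; apply/eqP; rewrite mulnC -(eqn_pmul2l uv0) mulnA fuv.
  have kg := dvdn_trans (pathkc sp) (pathcg sp).
  rewrite -{1}(divnK kg) mulnA eqn_pmul2r ?(pathk0 sp) // -eF /pF ev eu -eu3.
  exact: eqxx.
have uvf0 : 0 < f%:R * u%:R * v%:R :> R by rewrite !mulr_gt0 ?ltr0n.
rewrite (_ : f%:R * u%:R * v%:R = (D * m)%:R); last by rewrite -fuv !natrM; ring.
rewrite (_ : 2 ^+ 7 * (Q ^+ 2 / F0) * W = 2 ^+ 7 * Q ^+ 2 * W / F0); last by ring.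
apply: ler_wpM2l; first by nonneg.
by rewrite lef_pV2 ?posrE //; apply: lt_le_trans hF.
Qed.

(** Here [q x z = g u] is known, so [g] and [k] cost only divisor factors. Then [v <= 2 u], because
    both [q] lie in one dyadic range; [a y z] is determined modulo [k], which divides [c] and so is
    coprime to [u]; and [X] confines [y]. With [f = g / k], the product of [2 u], [7 f v] and [3 W]
    is controlled by [u v f = F < 2 F0]. *)
Lemma typed_neighbours (x z : I) (D0 F0 : R) : 1 <= F0 ->
  #|[set y | typed D0 F0 x z y]|%:R <= 2 ^+ 7 * S ^+ 2 * F0 * W.
Proof.
move=> F1; set A := [set y | _]; base.
have N0 : 0 < N by lra.
have Q0 : 0 < Q by lra.
have F00 : 0 < F0 by lra.
have W0 : 0 <= W by lra.
have S0 : 0 <= S by lra.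
have hA y : y \in A -> [/\ E x z, E y z & (pF (pth x z y))%:R < 2 * F0].
  by rewrite inE => /and4P[? ? _ /andP[_ ?]].
have [->|[y0 /hA[xz _ _]]] := set_0Vmem A; first by rewrite cards0 mulr0n; nonneg.
have q0 := q_gt0 xz; have [/andP[qQ qQ2] _ _ _] := hE xz.
have qS : (q x z)%:R <= 4 * Q ^+ 2 by rewrite expr2; nra.
apply: (@le_trans _ _ (S * (S * (84 * F0 * W)))); last first.
  rewrite (_ : 2 ^+ 7 * S ^+ 2 * F0 * W = S * (S * (2 ^+ 7 * F0 * W))); last by ring.
  do 2!(apply: ler_wpM2l; first by nonneg); do 2!(apply: ler_wpM2r; first by nonneg).
  by rewrite -natrX ler_nat.
have n1 : 0 <= 84 * F0 * W by nonneg.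
have n2 : 0 <= S * (84 * F0 * W) by nonneg.
apply: (card_divisor_fibers (f := fun y => pgcd (pth x z y)) n2 q0 qS).
  by move=> y /hA[_ yz _]; rewrite [X in (_ %| X)%N](pathq (pthP xz yz)) dvdn_mulr.
move=> y1 y1A; set A1 := [set j in A | _].
apply: (card_divisor_fibers (f := fun y => pk (pth x z y)) n1 q0 qS).
  move=> y; rewrite inE => /andP[/hA[_ yz _] _]; have sp := pthP xz yz.
  rewrite [X in (_ %| X)%N](pathq sp) dvdn_mulr //.
  exact: dvdn_trans (pathkc sp) (pathcg sp).
move=> y2; rewrite inE => /andP[y2A /eqP eg2]; set A2 := [set j in A1 | _].
have [_ yz2 _] := hA _ y2A; have sp2 := pthP xz yz2.
pose g := pgcd (pth x z y2); pose u := pu (pth x z y2); pose k := pk (pth x z y2).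
have u0 : (0 < u)%N := pathu0 sp2.
have g0 : (0 < g)%N := pathg0 sp2.
have k0 : (0 < k)%N := pathk0 sp2.
have kg : (k %| g)%N := dvdn_trans (pathkc sp2) (pathcg sp2).
have hA2 y : y \in A2 -> let p := pth x z y in
    [/\ E y z, (pF p)%:R < 2 * F0, pgcd p = g, pk p = k & pu p = u].
  rewrite !inE => /andP[/andP[yA /eqP eg] /eqP ek].
  have [_ yz hF] : [/\ E x z, E y z & (pF (pth x z y))%:R < 2 * F0] by apply: hA; rewrite inE.
  have sp := pthP xz yz; split => //; first by rewrite eg -eg2.
  apply/eqP; rewrite -(eqn_pmul2l g0) -[in X in (_ == X)%N](pathq sp2).
  by rewrite [X in (_ == X)%N](pathq sp) eg -eg2.
have uR : 0 < u%:R :> R by rewrite ltr0n.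
rewrite (_ : 84 * F0 * W = (2 * u%:R) * ((14 * F0 / u%:R) * (3 * W))); last first.
  by field; rewrite gt_eqF.
apply: (@card_le_fibers _ _ _ A2 (fun y => pv (pth x z y))); first by nonneg.
  move=> s us hs; apply: nat_seq_size => //.
  move=> v /hs[y /hA2[yz _ eg _ eu] <-]; have sp := pthP xz yz.
  split; first exact: pathv0 sp.
  have gR : 0 < g%:R :> R by rewrite ltr0n.
  have e1 : (q y z)%:R = g%:R * (pv (pth x z y))%:R :> R by rewrite (pathq' sp) eg natrM.
  have e2 : (q x z)%:R = g%:R * u%:R :> R by rewrite (pathq sp) eg eu natrM.
  by have [/andP[_ h] _ _ _] := hE yz; rewrite -(ler_pM2l gR) -e1; lra.
move=> y3 /hA2[yz3 hF3 eg3 ek3 eu3]; set A3 := [set j in A2 | _].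
pose v := pv (pth x z y3); pose f := (g %/ k)%N.
have fk : (f * k = g)%N by rewrite divnK.
have f0 : (0 < f)%N by move: g0; rewrite -fk muln_gt0 => /andP[].
have v0 : (0 < v)%N := pathv0 (pthP xz yz3).
have fvu : (f * v)%:R <= 2 * F0 / u%:R :> R.
  rewrite ler_pdivlMr // -natrM; apply: ltW; apply: le_lt_trans hF3.
  by rewrite /pF eg3 ek3 eu3 -/v -/f ler_nat mulnC mulnA mulnAC.
have hA3 y : y \in A3 -> [/\ E y z, q y z = (f * k * v)%N, coprime k u &
    (a x z) * v%:Z - (a y z) * u%:Z = pA (pth x z y) * k%:Z].
  rewrite inE => /andP[/hA2[yz _ eg ek eu] /eqP ev]; have sp := pthP xz yz.
  split => //; first by rewrite (pathq' sp) eg ev fk.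
    by rewrite -ek -eu; apply: coprime_dvdl (pathkc sp) (pathcu sp).
  by have := pathA sp; rewrite eu ev ek.
apply: (@card_le_fibers _ _ _ A3 (fun y => a y z)); first lra.
  move=> s us hs.
  have M0 : 0 <= 3 * (f * k * v)%:R :> R by nonneg.
  apply: (@le_trans _ _ (2 * (3 * (f * k * v)%:R) / k%:R + 1)).
    apply: residue_size => // [a1 a2|a1].
      move=> /hs[w1 /hA3[_ _ cku e1] <-] /hs[w2 /hA3[_ _ _ e2] <-].
      have : (k%:Z %| (a w1 z - a w2 z) * u%:Z)%Z.
        by apply/dvdzP; exists (pA (pth x z w2) - pA (pth x z w1)); rewrite [RHS]mulrBl -e1 -e2; ring.
      by rewrite Gauss_dvdzl // coprimezE.
    by move=> /hs[y /hA3[yz <- _ _] <-]; exact: a_bound.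
  have kR : 0 < k%:R :> R by rewrite ltr0n.
  rewrite (_ : _ / _ = 6 * (f * v)%:R); last by rewrite !natrM; field; rewrite gt_eqF.
  have fv1 : 1 <= (f * v)%:R :> R by rewrite ler1n muln_gt0 f0.
  rewrite (_ : 14 * F0 / u%:R = 7 * (2 * F0 / u%:R)); last by ring.
  lra.
move=> y4 y4A; rewrite (_ : 3 * W = (1 + 2) * W); last by ring.
apply: (@X_interval _ (X z + (a y4 z)%:~R / (f * k * v)%:R) 1) => // y.
rewrite inE => /andP[/hA3[yz <- _ _] /eqP <-].
by have [_ _ _] := hE yz; rewrite mul1r opprD addrA.
Qed.

(** * A second neighbour count, by duality *)

(** Two fractions closer than [1 / (q0 d)] are equal, and a reduced denominator divides every other
    one. *)
Lemma dvdn_denominator (b0 n : int) (q0 d : nat) :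
  (0 < q0)%N -> (0 < d)%N -> coprime `|b0|%N q0 ->
  `|b0%:~R / q0%:R - n%:~R / d%:R : R| < 1 / (q0%:R * d%:R) -> (q0 %| d)%N.
Proof.
move=> q0_gt0 d_gt0 cb; have [h _|/frac_dist h] := eqVneq (b0 * d%:Z) (n * q0%:Z); last first.
  by rewrite ltNge h.
have : (q0 %| `|(b0 * d%:Z)%R|)%N by rewrite h abszM absz_nat dvdn_mull.
by rewrite abszM absz_nat Gauss_dvdr // coprime_sym.
Qed.

Variables (kk : I -> I -> R) (mu : R).
Hypotheses (mu0 : 0 < mu) (muQW : 8 * (S * Q * W) < mu ^+ 2) (muN : S * N <= mu ^+ 2).
Hypothesis weyl : forall i j, mu <= kk i j ->
  [/\ (0 < q i j)%N /\ coprime `|b i j|%N (q i j), (q i j)%:R * kk i j ^+ 2 <= S * N ^+ 2,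
      `|(q i j)%:R * (T i - T j) - (b i j)%:~R| * kk i j ^+ 2 <= S &
      `|(q i j)%:R * (X i - X j) - (a i j)%:~R| * kk i j ^+ 2 <= S * N].

Ltac base2 := base; move: mu0 muQW muN => *.

(** For [j] in [A] the t-fractions of [(i, z)] and [(j, z)] differ by a multiple of [1 / (G v)],
    since [c] cancels. The Weyl fraction of [(i, j)] approximates the same difference, so the two
    coincide and [q i j] divides [G v]. Hence [q i j] costs a divisor factor and is at most
    [Z^2]. *)
Lemma close_pairs_card (A B : {set I}) (i z : I) (c G v : nat) (kap Z : R) :
  i \in A -> B \subset A -> 0 <= Z -> (G * v)%:R <= Z ^+ 2 ->
  (forall j, j \in A -> E j z /\ q j z = (G * c * v)%N) ->
  (forall j, j \in A -> (c%:Z %| b i z - b j z)%Z) ->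
  mu <= kap -> (forall j, j \in B -> kap <= kk i j) ->
  #|B|%:R <= S * (189 * (S * N * Z / kap) * W + 84 * (S * Q * W * N / kap ^+ 2)).
Proof.
move=> iA BA Z0 GvZ hA hc kl hB; base2.
have N0 : 0 < N by lra.
have Q0 : 0 < Q by lra.
have W0 : 0 <= W by lra.
have S0 : 0 <= S by lra.
have k0 : 0 < kap by lra.
have kk2 : mu ^+ 2 <= kap ^+ 2 by rewrite !expr2; nra.
have [iz eqi] := hA i iA.
have [/andP[_ hq2] _ _ _] := hE iz.
have := q_gt0 iz; rewrite eqi => Gcv0.
have [Gv0 c0] : (0 < G * v)%N /\ (0 < c)%N.
  by move: Gcv0; rewrite !muln_gt0 => /andP[/andP[-> ->] ->].
have GvQ : (G * v)%:R <= 2 * Q.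
  by apply: ltW; apply: le_lt_trans hq2; rewrite eqi ler_nat mulnAC leq_pmulr.
have wB j : j \in B -> [/\ (0 < q i j)%N /\ coprime `|b i j|%N (q i j),
   (q i j)%:R * kap ^+ 2 <= S * N ^+ 2,
   `|(q i j)%:R * (T i - T j) - (b i j)%:~R| * kap ^+ 2 <= S &
   `|(q i j)%:R * (X i - X j) - (a i j)%:~R| * kap ^+ 2 <= S * N].
  move=> jB; have kij := hB j jB; have [h1 h2 h3 h4] := weyl (le_trans kl kij).
  have sq : kap ^+ 2 <= kk i j ^+ 2 by rewrite !expr2; nra.
  by split => //; [apply: le_trans h2|apply: le_trans h3|apply: le_trans h4]; apply: ler_wpM2l.
have k20 : 0 < kap ^+ 2 by positive.
have dv j : j \in B -> (q i j %| G * v)%N.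
  move=> jB; have [[qp cb] hq hT _] := wB j jB.
  have jA : j \in A by exact: (fintype.subsetP BA).
  have [jz eqj] := hA j jA.
  have /dvdzP[n en] := hc j jA.
  have qR : 0 < (q i j)%:R :> R by rewrite ltr0n.
  have GvR : 0 < (G * v)%:R :> R by rewrite ltr0n.
  have cR : 0 < c%:R :> R by rewrite ltr0n.
  apply: (@dvdn_denominator (b i j) n) => //.
  have [_ _ hTi _] := hE iz; have [_ _ hTj _] := hE jz.
  have e1 : n%:~R / (G * v)%:R = (b i z)%:~R / (q i z)%:R - (b j z)%:~R / (q j z)%:R :> R.
    have -> : n%:~R = ((b i z)%:~R - (b j z)%:~R) / c%:R :> R.
      by rewrite -intrB en intrM -pmulrn mulfK // gt_eqF.
    rewrite eqi eqj !natrM; have := GvR; rewrite natrM pmulr_lgt0; last first.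
      by rewrite ltr0n; move: Gv0; rewrite muln_gt0 => /andP[].
    move=> G1; field; rewrite !gt_eqF //.
    by rewrite ltr0n; move: Gv0; rewrite muln_gt0 => /andP[].
  have e2 : `|(b i j)%:~R / (q i j)%:R - (T i - T j)| <= S / ((q i j)%:R * kap ^+ 2) :> R.
    rewrite ler_pdivlMr; last by positive.
    rewrite mulrA -[X in _ * X * _](gtr0_norm qR) -normrM mulrBl divfK ?gt_eqF //.
    by rewrite distrC [_ * (q i j)%:R]mulrC.
  have e3 : `|(b i j)%:~R / (q i j)%:R - n%:~R / (G * v)%:R| <= S / ((q i j)%:R * kap ^+ 2) + 2 * (W / N ^+ 2) :> R.
    rewrite e1; move: hTi hTj e2; rewrite !ler_norml => /andP[? ?] /andP[? ?] /andP[? ?].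
    by apply/andP; split; lra.
  apply: (le_lt_trans e3).
  (* Multiplied by [q i j] and [G v], the error is at most [(2 S Q + 4 S Q W) / kap^2], which [muQW]
     keeps below 1. *)
  rewrite ltr_pdivlMr; last by positive.
  rewrite [X in X < 1](_ : _ = (S * (G * v)%:R + 2 * W * (G * v)%:R * ((q i j)%:R * kap ^+ 2 / N ^+ 2)) / kap ^+ 2); last first.
    by field; rewrite !gt_eqF.
  rewrite ltr_pdivrMr // mul1r.
  have h1 : (q i j)%:R * kap ^+ 2 / N ^+ 2 <= S by rewrite ler_pdivrMr //; positive.
  have SQW : 8 * (S * Q * W) < kap ^+ 2 by exact: lt_le_trans kk2.
  have SQ : S * Q <= S * Q * W by rewrite ler_peMr //; nonneg.
  have h2 : S * (G * v)%:R <= S * (2 * Q) by apply: ler_wpM2l.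
  have h3 : 2 * W * (G * v)%:R * ((q i j)%:R * kap ^+ 2 / N ^+ 2) <= 2 * W * (2 * Q) * S.
    by apply: ler_pM => //; [nonneg|nonneg|apply: ler_wpM2l => //; nonneg].
  have [S00 W00] : 0 < S /\ 0 < W by split; apply: lt_le_trans ltr01 _.
  have SQW0 : 0 < S * Q * W by positive.
  lra.
have n0 : 0 <= 189 * (S * N * Z / kap) * W + 84 * (S * Q * W * N / kap ^+ 2) by nonneg.
have GvQ2 : (G * v)%:R <= 4 * Q ^+ 2 by rewrite expr2; nra.
apply: (card_divisor_fibers (f := q i) n0 Gv0 GvQ2) => // j0 j0B.
set B1 := [set j in B | _]; pose q0 := q i j0.
have [[q0_gt0 _] hq0 _ _] := wB _ j0B; rewrite -/q0 in q0_gt0 hq0.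
have qR : 0 < q0%:R :> R by rewrite ltr0n.
have q1 : 1 <= q0%:R :> R by rewrite ler1n.
have hB1 j : j \in B1 -> [/\ j \in A, q i j = q0 &
    `|X i - X j - (a i j)%:~R / q0%:R| <= S * N / (q0%:R * kap ^+ 2)].
  rewrite inE => /andP[jB /eqP eq0]; have [_ _ _] := wB _ jB; rewrite eq0 -/q0 => hX.
  split => //; first exact: (fintype.subsetP BA).
  rewrite ler_pdivlMr; last by positive.
  rewrite mulrA -[X in _ * X * _](gtr0_norm qR) -normrM mulrBl divfK ?gt_eqF //.
  by rewrite [_ * q0%:R]mulrC.
set del := S * N / (q0%:R * kap ^+ 2) in hB1.
have del0 : 0 <= del by rewrite /del; nonneg.
(* Geometric mean of two bounds for [q0]: [q0 <= G v <= Z^2] by divisibility, and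
   [q0 kap^2 <= S N^2] from the kernel. *)
have qZ : q0%:R * kap <= S * N * Z.
  have q0Z : q0%:R <= Z ^+ 2.
    apply: le_trans GvZ; rewrite ler_nat; exact: dvdn_leq Gv0 (dv _ j0B).
  rewrite -(@ler_pXn2r _ 2) // ?nnegrE; try by nonneg.
  rewrite [X in X <= _](_ : _ = q0%:R * (q0%:R * kap ^+ 2)); last by ring.
  rewrite (_ : (S * N * Z) ^+ 2 = Z ^+ 2 * (S ^+ 2 * N ^+ 2)); last by ring.
  apply: ler_pM => //; try by nonneg.
  apply: (le_trans hq0); apply: ler_wpM2r; first by nonneg.
  by rewrite expr2 ler_peMr.
(* At most [7 q0] values of [a i j], bounded by [3 q0]; for each of them at most [9 + 4 Q del]
   values of [a j z], integers in a window of radius [q i z (del + 2 W / N)]; then at most [3 W]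
   points [j]. *)
apply: (@le_trans _ _ ((7 * q0%:R) * ((9 + 4 * Q * del) * (3 * W)))); last first.
  rewrite [X in X <= _](_ : _ = 189 * q0%:R * W + 84 * (q0%:R * del * Q * W)); last by ring.
  apply: lerD.
    apply: ler_wpM2r => //; apply: ler_wpM2l => //.
    by rewrite ler_pdivlMr.
  rewrite le_eqVlt; apply/orP; left; apply/eqP; rewrite /del; field.
  by rewrite !gt_eqF.
apply: (@card_le_fibers _ _ _ B1 (fun j => a i j)); first by nonneg.
  move=> s us hs; have M0 : 0 <= 3 * q0%:R :> R by nonneg.
  apply: (@le_trans _ _ (2 * (3 * q0%:R) / 1%:R + 1)); last by lra.
  apply: residue_size => // a1 /hs[j /hB1[jA _ hX] <-].
  have d1 : del * q0%:R <= 1.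
    rewrite [X in X <= _](_ : _ = S * N / kap ^+ 2); last by rewrite /del; field; rewrite !gt_eqF.
    by rewrite ler_pdivrMr // mul1r; lra.
  have d2 : del <= 1 by nra.
  have : `|(a i j)%:~R / q0%:R : R| <= 3.
    move: hX (X_bound i j); rewrite !ler_norml => /andP[? ?] /andP[? ?].
    by apply/andP; split; lra.
  by rewrite normrM normfV (gtr0_norm qR) ler_pdivrMr.
move=> j1 _; set B2 := [set j in B1 | _]; pose a0 := a i j1.
have hB2 j : j \in B2 -> [/\ j \in A & `|X i - X j - a0%:~R / q0%:R| <= del].
  by rewrite inE => /andP[/hB1[jA _ h] /eqP eqa]; rewrite /a0 -eqa.
have q'0 : 0 < (q i z)%:R :> R by rewrite ltr0n eqi.
have WN := WN_le1.
apply: (@card_le_fibers _ _ _ B2 (fun j => a j z)); first by nonneg.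
  move=> s us hs; have l0 : 0 <= (q i z)%:R * (del + 2 * (W / N)) by nonneg.
  apply: (@le_trans _ _ (2 * ((q i z)%:R * (del + 2 * (W / N))) / 1 + 1)); last first.
    rewrite divr1; have h1 : (q i z)%:R * (W / N) <= 2.
      have : (q i z)%:R * (W / N) <= 2 * Q * (W / N).
        by apply: ler_wpM2r; [nonneg|exact: ltW].
      move/le_trans; apply; rewrite mulrA ler_pdivrMr //; lra.
    have h2 : (q i z)%:R * del <= 2 * Q * del by apply: ler_wpM2r => //; exact: ltW.
    lra.
  apply: (@spaced_size _ _ s intr ((a i z)%:~R - (q i z)%:R * (a0%:~R / q0%:R))) => //.
    by move=> x y _ _ xy; rewrite -intrB ge1_intr_norm // subr_eq0.
  move=> a1 /hs[j /hB2[jA hX] <-].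
  have [jz eqj] := hA j jA; have [_ _ _ hXj] := hE jz; have [_ _ _ hXi] := hE iz.
  rewrite [X in `|X|](_ : _ = (q i z)%:R * (a0%:~R / q0%:R - ((a i z)%:~R / (q i z)%:R - (a j z)%:~R / (q i z)%:R))); last first.
    by field; rewrite !gt_eqF.
  rewrite normrM (gtr0_norm q'0); apply: ler_wpM2l; first exact: ltW.
  move: hXj hXi hX; rewrite eqj -eqi !ler_norml => /andP[? ?] /andP[? ?] /andP[? ?].
  by apply/andP; split; lra.
move=> j2 _; rewrite (_ : 3 * W = (1 + 2) * W); last by ring.
apply: (@X_interval _ (X z + (a j2 z)%:~R / (q i z)%:R) 1) => // j.
rewrite inE => /andP[/hB2[jA _] /eqP <-].
have [jz eqj] := hA j jA; have [_ _ _] := hE jz.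
by rewrite mul1r opprD addrA eqj -eqi.
Qed.

Lemma dyadic_level (r : R) : 1 <= r ->
  2 ^+ (trunc_log 2 (Num.truncn r)) <= r < 2 ^+ (trunc_log 2 (Num.truncn r)).+1.
Proof.
move=> r1; have r0 : 0 <= r by lra.
have /andP[t1 t2] := truncn_itv r0.
have n0 : (0 < Num.truncn r)%N by rewrite truncn_gt0.
apply/andP; split.
  by apply: le_trans t1; rewrite -natrX ler_nat trunc_logP.
by apply: (lt_le_trans t2); rewrite -natrX ler_nat trunc_log_ltn.
Qed.

Variable L : nat.
Hypothesis kkN : forall i j, kk i j <= N.
Hypotheses (NL : N < mu * 2 ^+ L) (LS : L%:R <= S).
Hypothesis duality :
  forall A : {set I}, 2 * mu * #|A|%:R ^+ 2 <= \sum_(i in A) \sum_(j in A) kk i j.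

(** [close_pairs_card] is summed over the [L <= S] dyadic sizes [kap] of the kernel. Multiplied by
    [2 kap], its first term no longer depends on [kap], and its second is largest at [kap = mu]. *)
Lemma sum_close_pairs (A : {set I}) (i z : I) (c G v : nat) (Z : R) :
  i \in A -> 0 <= Z -> (G * v)%:R <= Z ^+ 2 ->
  (forall j, j \in A -> E j z /\ q j z = (G * c * v)%N) ->
  (forall j, j \in A -> (c%:Z %| b i z - b j z)%Z) ->
  \sum_(j in A | mu <= kk i j) kk i j <= S ^+ 3 * W * N * (378 * Z + 168 * (Q / mu)).
Proof.
move=> iA Z0 GvZ hA hc; base2.
have N0 : 0 < N by lra.
have Q0 : 0 < Q by lra.
have W0 : 0 <= W by lra.
have S0 : 0 <= S by lra.
pose lev j := trunc_log 2 (Num.truncn (kk i j / mu)).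
have hlev j : mu <= kk i j -> mu * 2 ^+ lev j <= kk i j < mu * 2 ^+ (lev j).+1.
  move=> h; have /dyadic_level : 1 <= kk i j / mu by rewrite ler_pdivlMr ?mul1r.
  by rewrite -/(lev j) ler_pdivlMr // ltr_pdivrMr // ![_ * mu]mulrC.
have two_ge1 l : 1 <= 2 ^+ l :> R by rewrite exprn_ege1 // ler1n.
have levL j : mu <= kk i j -> (lev j < L)%N.
  move=> h; have /andP[h1 _] := hlev j h.
  rewrite ltnNge; apply/negP => Ll; have := kkN i j; apply/negP; rewrite -ltNge.
  apply: (lt_le_trans NL); apply: le_trans h1; apply: ler_wpM2l; first exact: ltW.
  by rewrite ler_weXn2l // ler1n.
have -> : \sum_(j in A | mu <= kk i j) kk i j =
    \sum_(l < L) \sum_(j in A | (mu <= kk i j) && (lev j == l)) kk i j.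
  rewrite (exchange_big_dep (fun j => (j \in A) && (mu <= kk i j))) /=; last first.
    by move=> l j _ /and3P[-> ->].
  apply: eq_bigr => j /andP[jA hj].
  rewrite (big_pred1 (Ordinal (levL j hj))) // => l /=.
  by rewrite jA hj /= -val_eqE /= eq_sym.
apply: (@le_trans _ _ (\sum_(l < L) S ^+ 2 * W * N * (378 * Z + 168 * (Q / mu)))); last first.
  rewrite sumr_const card_ord -[leLHS]mulr_natl (_ : S ^+ 3 * W * N * _ = S * (S ^+ 2 * W * N * (378 * Z + 168 * (Q / mu)))); last by ring.
  by apply: ler_wpM2r; [nonneg|exact: LS].
apply: ler_sum => l _; pose kap := mu * 2 ^+ l.
have kap0 : 0 < kap by apply: mulr_gt0 => //; apply: lt_le_trans (two_ge1 l).
have mukap : mu <= kap by rewrite /kap ler_peMr // ltW.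
pose B := [set j in A | (mu <= kk i j) && (lev j == l)].
have hcard : #|B|%:R <= S * (189 * (S * N * Z / kap) * W + 84 * (S * Q * W * N / kap ^+ 2)).
  apply: (@close_pairs_card A B i z c G v) => //.
    by apply/fintype.subsetP => j; rewrite inE => /andP[].
  by move=> j; rewrite inE => /and3P[_ /hlev/andP[h _] /eqP el]; rewrite /kap -el.
apply: (@le_trans _ _ (\sum_(j in B) 2 * kap)).
  rewrite [leLHS](eq_bigl (fun j => j \in B)); last by move=> j; rewrite inE.
  apply: ler_sum => j; rewrite inE => /and3P[_ /hlev/andP[_ h] /eqP el].
  by apply: ltW; move: h; rewrite el exprS mulrCA.
rewrite sumr_const -[leLHS]mulr_natl.
apply: (@le_trans _ _ (S * (189 * (S * N * Z / kap) * W + 84 * (S * Q * W * N / kap ^+ 2)) * (2 * kap))).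
  by apply: ler_wpM2r => //; nonneg.
rewrite [leLHS](_ : _ = S ^+ 2 * W * N * (378 * Z + 168 * (Q / kap))); last first.
  by field; rewrite gt_eqF.
apply: ler_wpM2l; first by nonneg.
rewrite lerD2l; apply: ler_wpM2l => //; apply: ler_wpM2l; first exact: ltW.
by rewrite lef_pV2.
Qed.

(** Pairs with kernel below [mu] contribute at most [mu |A|^2], half of what duality demands, so the
    large values carry the other half. *)
Lemma card_of_duality (A : {set I}) (M : R) : 0 <= M ->
  (forall i, i \in A -> \sum_(j in A | mu <= kk i j) kk i j <= M) -> mu * #|A|%:R <= M.
Proof.
move=> M0 h; have := mu0; move=> muP.
have [->|[i0 i0A]] := set_0Vmem A; first by rewrite cards0 mulr0.
have A0 : 0 < #|A|%:R :> R by rewrite ltr0n; apply/card_gt0P; exists i0.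
have h1 : \sum_(i in A) \sum_(j in A) kk i j <= \sum_(i in A) (M + mu * #|A|%:R).
  apply: ler_sum => i iA; rewrite (bigID (fun j => mu <= kk i j)) /=.
  apply: lerD; first exact: h.
  rewrite mulr_natr -sumr_const [leRHS](bigID (fun j => mu <= kk i j)) /=.
  rewrite -[leLHS]add0r; apply: lerD; first by apply: sumr_ge0 => *; exact: ltW.
  by apply: ler_sum => j /andP[_]; rewrite -ltNge; exact: ltW.
have := le_trans (duality A) h1; rewrite sumr_const -[leRHS]mulr_natr.
rewrite expr2 mulrA ler_pM2r //; lra.
Qed.

(** With the edge [(x, z)] fixed, [g] and [c] divide [q x z], and [v <= 2 u <= 8 Q D0 / F0]. For
    fixed [g], [c], [v] the numerator [b y z] is determined modulo [c], so [sum_close_pairs] bounds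
    the kernel sums over these [y] and duality bounds their number. [Z] stands for the square root
    of [8 Q D0 / F0]. *)
Lemma typed_neighbours_duality (x z : I) (D0 F0 Z : R) : 1 <= D0 -> 1 <= F0 -> 0 <= Z ->
  8 * (Q * D0 / F0) <= Z ^+ 2 ->
  mu * #|[set y | typed D0 F0 x z y]|%:R <=
    2 ^+ 12 * S ^+ 5 * (Q * D0 / F0) * W * N * (Z + Q / mu).
Proof.
move=> D1 F1 Z0 HZ; set A := [set y | _]; base2.
have N0 : 0 < N by lra.
have Q0 : 0 < Q by lra.
have W0 : 0 <= W by lra.
have S0 : 0 <= S by lra.
have D00 : 0 < D0 by lra.
have F00 : 0 < F0 by lra.
pose H := Q * D0 / F0; have H0 : 0 < H by rewrite /H; positive.
pose M := S ^+ 3 * W * N * (378 * Z + 168 * (Q / mu)).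
have M0 : 0 <= M by rewrite /M; nonneg.
have hA y : y \in A -> [/\ E x z, E y z, (pD (pth x z y))%:R < 2 * D0 & F0 <= (pF (pth x z y))%:R].
  by rewrite inE => /and4P[? ? /andP[_ ?] /andP[? _]].
have [->|[y0 /hA[xz _ _ _]]] := set_0Vmem A; first by rewrite cards0 mulr0; nonneg.
have q0 := q_gt0 xz; have [/andP[qQ qQ2] _ _ _] := hE xz.
have qS : (q x z)%:R <= 4 * Q ^+ 2 by rewrite expr2; nra.
have n1 : 0 <= 8 * H * (M / mu) by nonneg.
have n2 : 0 <= S * (8 * H * (M / mu)) by nonneg.
apply: (@le_trans _ _ (mu * (S * (S * (8 * H * (M / mu)))))); last first.
  rewrite (_ : mu * _ = (8 * S ^+ 5 * H * W * N) * (378 * Z + 168 * (Q / mu))); last first.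
    by rewrite /M; field; rewrite gt_eqF.
  rewrite (_ : 2 ^+ 12 * _ * _ * _ * _ * _ = (8 * S ^+ 5 * H * W * N) * (2 ^+ 9 * (Z + Q / mu))); last first.
    by rewrite -/H; ring.
  apply: ler_wpM2l; first by nonneg.
  rewrite mulrDr; apply: lerD; (apply: ler_wpM2r; first by nonneg); by rewrite -natrX ler_nat.
apply: ler_wpM2l; first exact: ltW.
apply: (card_divisor_fibers (f := fun y => pgcd (pth x z y)) n2 q0 qS).
  by move=> y /hA[_ yz _ _]; rewrite [X in (_ %| X)%N](pathq (pthP xz yz)) dvdn_mulr.
move=> y1 y1A; set A1 := [set j in A | _].
apply: (card_divisor_fibers (f := fun y => pc (pth x z y)) n1 q0 qS).
  move=> y; rewrite inE => /andP[/hA[_ yz _ _] _]; have sp := pthP xz yz.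
  by rewrite [X in (_ %| X)%N](pathq sp) dvdn_mulr // (pathcg sp).
move=> y2; rewrite inE => /andP[y2A /eqP eg2]; set A2 := [set j in A1 | _].
have [_ yz2 hD2 hF2] := hA _ y2A; have sp2 := pthP xz yz2.
pose g := pgcd (pth x z y2); pose u := pu (pth x z y2); pose c := pc (pth x z y2).
have u0 : (0 < u)%N := pathu0 sp2.
have g0 : (0 < g)%N := pathg0 sp2.
have c0 : (0 < c)%N := pathc0 sp2.
have cg : (c %| g)%N := pathcg sp2.
pose G := (g %/ c)%N.
have Gc : (G * c = g)%N by rewrite divnK.
have G0 : (0 < G)%N by move: g0; rewrite -Gc muln_gt0 => /andP[].
have hA2 y : y \in A2 -> let p := pth x z y in
    [/\ E y z, pgcd p = g, pc p = c & pu p = u].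
  rewrite !inE => /andP[/andP[yA /eqP eg] /eqP ec].
  have [|_ yz _ _] := hA y; first by rewrite inE.
  have sp := pthP xz yz; split => //; first by rewrite eg -eg2.
  apply/eqP; rewrite -(eqn_pmul2l g0) -[in X in (_ == X)%N](pathq sp2).
  by rewrite [X in (_ == X)%N](pathq sp) eg -eg2.
have uR : 0 < u%:R :> R by rewrite ltr0n.
(* [D / F = G / f] with [f = g / k], and [f u <= g u = q x z < 2 Q]. *)
have GuH : (G * u)%:R <= 4 * H.
  pose k := pk (pth x z y2); pose v2 := pv (pth x z y2); pose f := (g %/ k)%N.
  have [eD eF] : pD (pth x z y2) = (u * v2 * G)%N /\ pF (pth x z y2) = (u * v2 * f)%N by [].
  have v20 : 0 < v2%:R :> R by rewrite ltr0n; exact: pathv0 sp2.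
  have uvR : 0 < (u * v2)%:R :> R by rewrite natrM; positive.
  have GfR : G%:R * F0 <= 2 * D0 * f%:R.
    rewrite -(ler_pM2l uvR); apply: (@le_trans _ _ (G%:R * (u * v2 * f)%:R * (u * v2)%:R)).
      rewrite [leLHS]mulrC; apply: ler_wpM2r; first exact: ltW.
      by apply: ler_wpM2l => //; rewrite -eF.
    rewrite [leLHS](_ : _ = (u * v2)%:R * f%:R * (u * v2 * G)%:R); last by rewrite !natrM; ring.
    rewrite -eD [leRHS](_ : _ = (u * v2)%:R * f%:R * (2 * D0)); last by ring.
    by apply: ler_wpM2l; [nonneg|exact: ltW].
  have fu : f%:R * u%:R <= 2 * Q.
    apply: le_trans (ltW qQ2); rewrite -natrM ler_nat (pathq sp2) -/g -/u leq_mul2r leq_div orbT //.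
  rewrite natrM (_ : 4 * H = 4 * (Q * D0) / F0); last by rewrite /H; ring.
  rewrite ler_pdivlMr // mulrAC.
  apply: (@le_trans _ _ (2 * D0 * f%:R * u%:R)); first by apply: ler_wpM2r.
  by rewrite -mulrA [leRHS](_ : _ = 2 * D0 * (2 * Q)); [apply: ler_wpM2l => //; nonneg|ring].
have uH : u%:R <= 4 * H.
  by apply: le_trans GuH; rewrite ler_nat leq_pmull.
have hv y : y \in A2 -> (pv (pth x z y))%:R <= 2 * u%:R :> R.
  move=> /hA2[yz eg _ eu]; have sp := pthP xz yz.
  have gR : 0 < g%:R :> R by rewrite ltr0n.
  have e1 : (q y z)%:R = g%:R * (pv (pth x z y))%:R :> R by rewrite (pathq' sp) eg natrM.
  have e2 : (q x z)%:R = g%:R * u%:R :> R by rewrite (pathq sp) eg eu natrM.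
  by have [/andP[_ h] _ _ _] := hE yz; rewrite -(ler_pM2l gR) -e1; lra.
apply: (@card_le_fibers _ _ _ A2 (fun y => pv (pth x z y))); first by nonneg.
  move=> s us hs; apply: (@le_trans _ _ (2 * u%:R)); last by lra.
  apply: nat_seq_size => // v /hs[y /[dup] /hv hvy /hA2[yz _ _ _] <-].
  by split => //; exact: pathv0 (pthP xz yz).
move=> y3 /[dup] /hv v2u /hA2[yz3 eg3 ec3 eu3]; set A3 := [set j in A2 | _].
pose v := pv (pth x z y3); rewrite -/v in v2u.
rewrite ler_pdivlMr // mulrC; apply: card_of_duality => // i iA.
have hA3 y : y \in A3 -> [/\ E y z, q y z = (G * c * v)%N, coprime c u &
    b x z * v%:Z - b y z * u%:Z = pB (pth x z y) * c%:Z].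
  rewrite inE => /andP[/hA2[yz eg ec eu] /eqP ev]; have sp := pthP xz yz.
  split => //; first by rewrite (pathq' sp) eg ev Gc.
    by rewrite -ec -eu; exact: pathcu sp.
  by have := pathB sp; rewrite eu ev ec.
apply: (@sum_close_pairs A3 i z c G v Z) => //.
- apply: le_trans HZ; rewrite natrM.
  apply: (@le_trans _ _ (G%:R * (2 * u%:R))); first by apply: ler_wpM2l.
  by move: GuH; rewrite natrM -/H; lra.
- by move=> j /hA3[].
move=> j /hA3[_ _ cu ej]; have [_ _ _ ei] := hA3 i iA.
have : (c%:Z %| (b i z - b j z) * u%:Z)%Z.
  by apply/dvdzP; exists (pB (pth x z j) - pB (pth x z i)); rewrite [RHS]mulrBl -ei -ej; ring.
by rewrite Gauss_dvdzl // coprimezE.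
Qed.

Variable nL : nat.
Hypotheses (QnL : 4 * Q ^+ 2 < 2 ^+ nL) (nLS : nL.+1%:R <= S).

(** The types are the dyadic sizes of [D] and [F], at most [S^2] of them. A rich edge [(x, z)] gives
    the last two bounds through its set of [y], and any single such [y0] gives the first through the
    popular pair [(x, y0)]. *)
Lemma rich_edge_bounds (e n : R) :
  e = \sum_x \sum_z (E x z)%:R -> n = #|I|%:R -> 0 < e -> 0 < n ->
  exists D0 F0 : R, [/\ 1 <= D0, 1 <= F0, D0 <= 2 * F0 & F0 <= 4 * Q ^+ 2] /\
   [/\ e ^+ 2 / (2 * n ^+ 3 * S ^+ 2) <= 2 ^+ 16 * S ^+ 2 * W * (Q ^+ 2 / F0) *
         (D0 ^+ 2 * W / N ^+ 2 + 1) * (F0 ^+ 2 * W / (N * D0) + 1),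
      e / (4 * n * S ^+ 2) <= 2 ^+ 7 * S ^+ 2 * F0 * W &
      forall Z : R, 0 <= Z -> 8 * (Q * D0 / F0) <= Z ^+ 2 ->
       mu * (e / (4 * n * S ^+ 2)) <= 2 ^+ 12 * S ^+ 5 * (Q * D0 / F0) * W * N * (Z + Q / mu)].
Proof.
move=> he hn e0 n0; base2.
have S0 : 0 < S by lra.
(* [inord] would send an exponent out of range to a default class; [lvl] excludes this, since
   [D <= F <= 4 Q^2 < 2 ^+ nL] on actual paths. *)
pose tau x z y : 'I_nL.+1 * 'I_nL.+1 :=
  (inord (trunc_log 2 (pD (pth x z y))), inord (trunc_log 2 (pF (pth x z y)))).
have s0 : 0 < nL.+1%:R ^+ 2 :> R by rewrite exprn_gt0 // ltr0n.
have hs : nL.+1%:R ^+ 2 = #|{: 'I_nL.+1 * 'I_nL.+1}|%:R :> R.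
  by rewrite card_prod !card_ord natrM expr2.
have sS : nL.+1%:R ^+ 2 <= S ^+ 2 by rewrite ler_pXn2r // nnegrE // ltW.
have [[l m] [x [z [xz hY]]]] := rich_edge tau he hn hs e0 n0 s0.
have lvl w (d : nat) : (0 < d)%N -> d%:R <= 4 * Q ^+ 2 -> inord (trunc_log 2 d) == w :> 'I_nL.+1 ->
    (2 ^+ (nat_of_ord w) : R) <= d%:R < 2 * 2 ^+ (nat_of_ord w).
  move=> d0 dQ /eqP <-; rewrite inordK.
    by rewrite -exprS -!natrX ler_nat ltr_nat trunc_logP // trunc_log_ltn.
  rewrite ltnS leqNgt; apply/negP => h.
  have : 2 ^+ nL < 2 ^+ nL :> R; last by rewrite ltxx.
  apply: (@le_lt_trans _ _ d%:R); last exact: le_lt_trans QnL.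
  rewrite -natrX ler_nat; apply: leq_trans (trunc_logP (isT : (1 < 2)%N) d0).
  by rewrite leq_exp2l // ltnW.
have typ x' z' y' : [&& E x' z', E y' z' & tau x' z' y' == (l, m)] -> typed (2 ^+ l) (2 ^+ m) x' z' y'.
  rewrite xpair_eqE => /and4P[h1 h2 hl hm]; rewrite /typed h1 h2 /=.
  have h3 := pD_gt0 h1 h2; have h4 := pF_gt0 h1 h2; have h5 := pF_le h1 h2.
  rewrite !lvl //; apply: le_trans h5; rewrite ler_nat; exact: pD_le_pF.
set Y := [set y | _] in hY.
have e4 : 0 < e / (4 * n * nL.+1%:R ^+ 2) by rewrite divr_gt0 // !mulr_gt0.
have /set0Pn[y0] : Y != finset.set0.
  by apply/negP => /eqP Y0; move: hY; rewrite Y0 cards0 leNgt e4.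
rewrite inE => /and4P[h1 h2 hk hr].
have := typ x z y0; rewrite h1 h2 hk => /(_ isT); rewrite /typed => /and4P[_ _ /andP[d1 d2] /andP[f1 f2]].
have D1 : 1 <= 2 ^+ l :> R by rewrite exprn_ege1 // ler1n.
have F1 : 1 <= 2 ^+ m :> R by rewrite exprn_ege1 // ler1n.
have YT : #|Y|%:R <= #|[set y | typed (2 ^+ l) (2 ^+ m) x z y]|%:R :> R.
  rewrite ler_nat; apply/subset_leq_card/fintype.subsetP => y.
  by rewrite !inE => /and4P[a1 a2 a3 _]; apply: typ; rewrite a1 a2.
have eS : e / (4 * n * S ^+ 2) <= #|[set y | typed (2 ^+ l) (2 ^+ m) x z y]|%:R.
  apply: le_trans YT; apply: le_trans hY; apply: ler_wpM2l; first exact: ltW.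
  rewrite lef_pV2 ?posrE; [|by positive|by positive].
  by apply: ler_wpM2l => //; nonneg.
exists (2 ^+ l), (2 ^+ m); split; first split => //.
- have : (pD (pth x z y0))%:R <= (pF (pth x z y0))%:R :> R by rewrite ler_nat pD_le_pF.
  by move=> h; lra.
- exact: le_trans f1 (pF_le h1 h2).
split.
- apply: le_trans (common_neighbours x y0 D1 F1).
  apply: (@le_trans _ _ #|[set w | [&& E x w, E y0 w & tau x w y0 == (l, m)]]|%:R); last first.
    rewrite ler_nat; apply/subset_leq_card/fintype.subsetP => w.
    by rewrite !inE; exact: typ.
  apply: le_trans hr; apply: ler_wpM2l; first by nonneg.
  rewrite lef_pV2 ?posrE; [|by positive|by positive].
  by apply: ler_wpM2l => //; nonneg.
- exact: le_trans eS (typed_neighbours _ _ _ F1).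
- move=> Z Z0 hZ; apply: le_trans (typed_neighbours_duality x z D1 F1 Z0 hZ).
  by apply: ler_wpM2l => //; exact: ltW.
Qed.

End Counting.

(** * Logarithms and the incompatibility of the three bounds *)

Lemma le_ln_pos (R : realType) (x y : R) : 0 < x -> x <= y -> ln x <= ln y.
Proof. by move=> x0 xy; rewrite ler_ln ?posrE //; apply: lt_le_trans xy. Qed.

Lemma le_ln_add (R : realType) (x y : R) : 0 < x -> 0 < y -> y <= x -> ln (x + y) <= ln 2 + ln x.
Proof. by move=> x0 y0 yx; rewrite -lnM ?posrE //; apply: le_ln_pos; lra. Qed.

Lemma le_sqr_pos (R : realType) (x y : R) : 0 < x -> x <= y -> x ^+ 2 <= y ^+ 2.
Proof. by move=> x0 xy; rewrite lerXn2r // nnegrE; lra. Qed.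

Ltac ln_expand := repeat match goal with
  | |- context [ln (?x ^+ ?n)] => rewrite (@lnXn _ n x); [ | by positive ]
  | |- context [ln (?x * ?y)] =>
      rewrite (@lnM _ x y); [ | by rewrite posrE; positive | by rewrite posrE; positive ]
  | |- context [ln (?x^-1)] => rewrite (@lnV _ x); [ | by rewrite posrE; positive ]
  end.

(** Each letter is the logarithm of the quantity it names, with [c = ln 2] and [s = ln S]. The
    disjunctions record which summand dominates in [Z + Q / mu] and in the two Farey factors, [lA]
    for the t-fractions and [lB] for the x-fractions. The last hypothesis on [n] is the negation of
    the desired count. *)
Lemma exponent_arith (R : realType) (c s N mu kap Q W n e D F lA lB lZQ Z : R) :
  0 <= c -> c *+ 32 <= s -> s *+ 20 <= N -> N *+ 7 <= mu *+ 10 + s *+ 21 -> mu <= kap ->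
  0 <= Q -> 0 <= W -> 0 <= D -> 0 <= F -> Q + W = s + N *+ 2 - kap *+ 2 ->
  mu + n *+ 2 - (c + kap + s *+ 2) <= e -> D <= c + F -> F <= c *+ 2 + Q *+ 2 ->
  e - (c *+ 2 + n + s *+ 2) <= c *+ 7 + s *+ 2 + F + W ->
  s *+ 40 + N *+ 2 - mu *+ 2 <= n ->
  e *+ 2 - (c + n *+ 3 + s *+ 2) <= c *+ 16 + s *+ 2 + W + (Q *+ 2 - F) + lA + lB ->
  Z *+ 2 = c *+ 3 + (Q + D - F) ->
  mu + (e - (c *+ 2 + n + s *+ 2)) <= c *+ 12 + s *+ 5 + (Q + D - F) + W + N + lZQ ->
  lZQ <= c + Z \/ lZQ <= c + (Q - mu) ->
  lA <= c \/ lA <= c + (D *+ 2 + W - N *+ 2) ->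
  lB <= c \/ lB <= c + (F *+ 2 + W - (N + D)) ->
  0 < s -> False.
Proof.
move=> ? ? ? ? ? ? ? ? ? ? ? ? ? ? ? ? ? ? C A B ?; case: A => ?; case: B => ?.
(* The four cases, up to multiples of [s]: both factors trivial, where popularity contradicts direct
   counting; only [lB] large, where each term of the duality bound is contradictory; only [lA]
   large, where [D] and [F] at most [2 Q] would give [kap *+ 6 < N *+ 4]; both large, which would
   give [kap *+ 10 < N *+ 7]. *)
- lra.
- by case: C => ?; lra.
- lra.
- lra.
Qed.

(* All the inequalities are between monomials up to a factor two, so after taking
   logarithms the contradiction is a matter of linear arithmetic. *)
Lemma exponents_incompatible (R : realType) (N S mu kap Q W n e D0 F0 : R) :
  2 ^+ 32 <= S -> S ^+ 20 <= N -> N ^+ 7 <= mu ^+ 10 * S ^+ 21 -> 0 < mu -> mu <= kap ->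
  1 <= Q -> 1 <= W -> Q * W = S * N ^+ 2 / kap ^+ 2 ->
  0 < n -> mu * n ^+ 2 / (2 * kap * S ^+ 2) <= e ->
  1 <= D0 -> 1 <= F0 -> D0 <= 2 * F0 -> F0 <= 2 ^+ 2 * Q ^+ 2 ->
  e ^+ 2 / (2 * n ^+ 3 * S ^+ 2) <= 2 ^+ 16 * S ^+ 2 * W * (Q ^+ 2 / F0) *
     (D0 ^+ 2 * W / N ^+ 2 + 1) * (F0 ^+ 2 * W / (N * D0) + 1) ->
  e / (2 ^+ 2 * n * S ^+ 2) <= 2 ^+ 7 * S ^+ 2 * F0 * W ->
  (forall Z : R, 0 <= Z -> 2 ^+ 3 * (Q * D0 / F0) <= Z ^+ 2 ->
     mu * (e / (2 ^+ 2 * n * S ^+ 2)) <= 2 ^+ 12 * S ^+ 5 * (Q * D0 / F0) * W * N * (Z + Q / mu)) ->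
  n <= S ^+ 40 * N ^+ 2 / mu ^+ 2.
Proof.
move=> S32 SN N7 mu0 muk Q1 W1 QW n0 he D1 F1 DF FQ h4 h5 h6.
have two0 : 0 < 2 :> R by [].
have S0 : 0 < S by apply: lt_le_trans S32; positive.
have N0 : 0 < N by apply: lt_le_trans SN; positive.
have kap0 : 0 < kap by apply: lt_le_trans muk.
have Q0 : 0 < Q by lra.
have W0 : 0 < W by lra.
have D00 : 0 < D0 by lra.
have F00 : 0 < F0 by lra.
have e0 : 0 < e by apply: lt_le_trans he; positive.
rewrite leNgt; apply/negP => hn.
have c0 : 0 <= ln (2 : R) by rewrite ln_ge0 // ler1n.
have cs : ln 2 *+ 32 <= ln S by rewrite -lnXn //; apply: le_ln_pos S32; positive.
have SNl : ln S *+ 20 <= ln N by rewrite -lnXn //; apply: le_ln_pos SN; positive.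
have N7l : ln N *+ 7 <= ln mu *+ 10 + ln S *+ 21.
  by have := le_ln_pos _ N7; ln_expand; apply; positive.
have mukl : ln mu <= ln kap by apply: le_ln_pos.
have Q1l : 0 <= ln Q by rewrite ln_ge0.
have W1l : 0 <= ln W by rewrite ln_ge0.
have D1l : 0 <= ln D0 by rewrite ln_ge0.
have F1l : 0 <= ln F0 by rewrite ln_ge0.
have QWl : ln Q + ln W = ln S + ln N *+ 2 - ln kap *+ 2.
  by have := congr1 (@ln R) QW; ln_expand.
have hel : ln mu + ln n *+ 2 - (ln 2 + ln kap + ln S *+ 2) <= ln e.
  by have := le_ln_pos _ he; ln_expand; apply; positive.
have DFl : ln D0 <= ln 2 + ln F0 by have := le_ln_pos _ DF; ln_expand; apply; positive.
have FQl : ln F0 <= ln 2 *+ 2 + ln Q *+ 2 by have := le_ln_pos _ FQ; ln_expand; apply; positive.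
have h5l : ln e - (ln 2 *+ 2 + ln n + ln S *+ 2) <= ln 2 *+ 7 + ln S *+ 2 + ln F0 + ln W.
  by have := le_ln_pos _ h5; ln_expand; apply; positive.
have hnl : ln S *+ 40 + ln N *+ 2 - ln mu *+ 2 <= ln n.
  by have := le_ln_pos _ (ltW hn); ln_expand; apply; positive.
set A := D0 ^+ 2 * W / N ^+ 2 in h4; set B := F0 ^+ 2 * W / (N * D0) in h4.
have A0 : 0 < A by rewrite /A; positive.
have B0 : 0 < B by rewrite /B; positive.
have lnA : ln A = ln D0 *+ 2 + ln W - ln N *+ 2 by rewrite /A; ln_expand.
have lnB : ln B = ln F0 *+ 2 + ln W - (ln N + ln D0) by rewrite /B; ln_expand.
have A10 : 0 < A + 1 by rewrite addr_gt0.
have B10 : 0 < B + 1 by rewrite addr_gt0.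
have h4l : ln e *+ 2 - (ln 2 + ln n *+ 3 + ln S *+ 2) <= ln 2 *+ 16 + ln S *+ 2 + ln W +
    (ln Q *+ 2 - ln F0) + ln (A + 1) + ln (B + 1).
  by have := le_ln_pos _ h4; ln_expand; apply; positive.
have succ_ln (x : R) : 0 < x -> ln (x + 1) <= ln 2 \/ ln (x + 1) <= ln 2 + ln x.
  move=> x0; have [x1|x1] := leP x 1; [left|right].
    by have := le_ln_add ltr01 x0 x1; rewrite ln1 addr0 addrC.
  exact: le_ln_add (ltW x1).
pose Z := Num.sqrt (2 ^+ 3 * (Q * D0 / F0)).
have Z2 : Z ^+ 2 = 2 ^+ 3 * (Q * D0 / F0) by rewrite sqr_sqrtr //; apply: ltW; positive.
have Z0 : 0 < Z by rewrite sqrtr_gt0; positive.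
have Zl : ln Z *+ 2 = ln 2 *+ 3 + (ln Q + ln D0 - ln F0) by rewrite -lnXn // Z2; ln_expand.
have {}h6 := h6 Z (ltW Z0); rewrite Z2 lexx in h6; have {}h6 := h6 isT.
have Qmu0 : 0 < Q / mu by positive.
have ZQ0 : 0 < Z + Q / mu by positive.
have Qmul : ln (Q / mu) = ln Q - ln mu by ln_expand.
have h6l : ln mu + (ln e - (ln 2 *+ 2 + ln n + ln S *+ 2)) <= ln 2 *+ 12 + ln S *+ 5 +
    (ln Q + ln D0 - ln F0) + ln W + ln N + ln (Z + Q / mu).
  by have := le_ln_pos _ h6; ln_expand; apply; positive.
have ZQ : ln (Z + Q / mu) <= ln 2 + ln Z \/ ln (Z + Q / mu) <= ln 2 + (ln Q - ln mu).
  rewrite -Qmul; have [x1|x1] := leP (Q / mu) Z; [left|right].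
    exact: le_ln_add.
  by rewrite addrC; apply: le_ln_add => //; exact: ltW.
have Al := succ_ln _ A0; have Bl := succ_ln _ B0.
rewrite lnA in Al; rewrite lnB in Bl.
have s0 : 0 < ln S by rewrite ln_gt0 //; apply: lt_le_trans S32; rewrite exprn_egt1 // ltr1n.
exact: (exponent_arith c0 cs SNl N7l mukl Q1l W1l D1l F1l QWl hel DFl FQl h5l hnl h4l Zl h6l
  ZQ Al Bl s0).
Qed.

(** * From kernel bounds to the number of points *)

Lemma sum_pigeonhole (R : realType) (K : finType) (g : K -> R) (t s : R) :
  0 < t -> 0 < s -> #|K|%:R <= s -> t <= \sum_k g k -> exists k, t / (2 * s) <= g k.
Proof.
move=> t0 s0 Ks tg; have [//|no] := pselect (exists k, t / (2 * s) <= g k).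
exfalso; have : \sum_k g k <= t / 2.
  apply: (@le_trans _ _ (\sum_(k : K) t / (2 * s))).
    by apply: ler_sum => k _; rewrite leNgt; apply/negP => h; apply: no; exists k; exact: ltW.
  rewrite sumr_const -[leLHS]mulr_natl (_ : t / 2 = s * (t / (2 * s))); last first.
    by field; rewrite gt_eqF.
  by apply: ler_wpM2r => //; nonneg.
lra.
Qed.

(** [N^7 <= mu^10 S^21] places [mu] near [N^(7/10)], and [S^20 <= N] leaves room: [mu^2] exceeds
    [S N], the level above which Weyl differencing gives information on the kernel. *)
Lemma large_threshold (R : realType) (N S mu : R) :
  2 ^+ 32 <= S -> S ^+ 20 <= N -> N ^+ 7 <= mu ^+ 10 * S ^+ 21 -> 0 < mu ->
  2 ^+ 3 * (S ^+ 2 * N ^+ 2) < mu ^+ 4.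
Proof.
move=> S32 SN N7 mu0.
have two0 : 0 < 2 :> R by [].
have S0 : 0 < S by apply: lt_le_trans S32; positive.
have N0 : 0 < N by apply: lt_le_trans SN; positive.
rewrite ltNge; apply/negP => h.
have c0 : 0 <= ln (2 : R) by rewrite ln_ge0 // ler1n.
have cs : ln 2 *+ 32 <= ln S by rewrite -lnXn //; apply: le_ln_pos S32; positive.
have SNl : ln S *+ 20 <= ln N by rewrite -lnXn //; apply: le_ln_pos SN; positive.
have N7l : ln N *+ 7 <= ln mu *+ 10 + ln S *+ 21.
  by have := le_ln_pos _ N7; ln_expand; apply; positive.
have hl : ln mu *+ 4 <= ln 2 *+ 3 + (ln S *+ 2 + ln N *+ 2).
  by have := le_ln_pos _ h; ln_expand; apply; positive.
have s0 : 0 < ln S by rewrite ln_gt0 //; apply: lt_le_trans S32; rewrite exprn_egt1 // ltr1n.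
by clear - c0 cs SNl N7l hl s0; lra.
Qed.

Lemma large_threshold_sqr (R : realType) (N S mu : R) :
  2 ^+ 32 <= S -> S ^+ 20 <= N -> N ^+ 7 <= mu ^+ 10 * S ^+ 21 -> 0 < mu ->
  2 * (S * N) <= mu ^+ 2.
Proof.
move=> S32 SN N7 mu0; have SNmu := large_threshold S32 SN N7 mu0.
have two0 : 0 < 2 :> R by [].
have S0 : 0 < S by apply: lt_le_trans S32; positive.
have N0 : 0 < N by apply: lt_le_trans SN; positive.
rewrite -(@ler_pXn2r _ 2) ?nnegrE //; [|by nonneg|by nonneg].
rewrite -exprM; apply: le_trans (ltW SNmu); rewrite !exprMn; apply: ler_wpM2r; first by nonneg.
by rewrite ler_weXn2l // ler1n.
Qed.

(** Pigeonholing in the dyadic sizes [kap] of the kernel and [Q] of the label yields an edge set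
    that keeps at least a proportion [1 / S^2] of the kernel mass. The bounds of the counting
    section then apply to it and contradict each other if there are too many points. *)
Lemma large_values_count (R : realType) (I : finType) (X T : I -> R)
    (q : I -> I -> nat) (a b : I -> I -> int) (kk : I -> I -> R) (N S mu : R) (L : nat) :
  2 ^+ 32 <= S -> S ^+ 20 <= N -> N ^+ 7 <= mu ^+ 10 * S ^+ 21 -> 0 < mu ->
  (forall m : nat, (0 < m)%N -> m%:R <= N ^+ 2 -> (size (divisors m))%:R <= S) ->
  (forall i j, `|X i - X j| <= 2) ->
  (forall c l : R, 0 <= l -> #|[set j | `|X j - c| <= l]|%:R <= N * l + 2) ->
  (forall i j, mu <= kk i j ->
    [/\ (0 < q i j)%N /\ coprime `|b i j|%N (q i j), (q i j)%:R * kk i j ^+ 2 <= S * N ^+ 2,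
      `|(q i j)%:R * (T i - T j) - (b i j)%:~R| * kk i j ^+ 2 <= S &
      `|(q i j)%:R * (X i - X j) - (a i j)%:~R| * kk i j ^+ 2 <= S * N]) ->
  (forall i j, kk i j <= N) -> N ^+ 2 < 2 ^+ L -> (2 * L.+1)%:R <= S ->
  (forall A : {set I}, 2 * mu * #|A|%:R ^+ 2 <= \sum_(i in A) \sum_(j in A) kk i j) ->
  #|I|%:R <= S ^+ 40 * N ^+ 2 / mu ^+ 2.
Proof.
move=> S32 SN N7 mu0 hdiv hX hsep weyl kkN N2L LS dual.
have two0 : 0 < 2 :> R by [].
have S0 : 0 < S by apply: lt_le_trans S32; positive.
have S1 : 1 <= S by apply: le_trans S32; rewrite exprn_ege1 // ler1n.
have N1 : 1 <= N by apply: le_trans SN; rewrite exprn_ege1.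
have N0 : 0 < N by lra.
have [n0|n0] := posnP #|I|; first by rewrite n0 mulr0n; nonneg.
have {}n0 : 0 < #|I|%:R :> R by rewrite ltr0n.
have SNmu := large_threshold S32 SN N7 mu0.
have SN2 := large_threshold_sqr S32 SN N7 mu0.
have mu1 : 1 <= mu.
  rewrite -(@ler_pXn2r _ 2) ?nnegrE ?(ltW mu0) // expr1n; apply: le_trans SN2.
  have SN1 : 1 <= S * N by rewrite mulr_ege1.
  lra.
pose Lev := ('I_L.+1 * 'I_L.+1)%type.
have hdyad r : 1 <= r -> r <= N ^+ 2 -> (trunc_log 2 (Num.truncn r) < L.+1)%N.
  move=> r1 rN; have /andP[h _] := dyadic_level r1.
  rewrite ltnS leqNgt; apply/negP => hl.
  have : (2 : R) ^+ L < 2 ^+ L; last by rewrite ltxx.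
  apply: (le_lt_trans _ (le_lt_trans rN N2L)); apply: le_trans h.
  by rewrite ler_weXn2l ?ler1n // ltnW.
have NN2 : N <= N ^+ 2 by rewrite expr2 ler_peMr // ltW.
have hk1 i j : mu <= kk i j -> 1 <= kk i j / mu by move=> h; rewrite ler_pdivlMr ?mul1r.
have hkN i j : mu <= kk i j -> kk i j / mu <= N ^+ 2.
  move=> h; apply: le_trans NN2; apply: le_trans (kkN i j).
  by rewrite ler_pdivrMr // ler_peMr //; lra.
have hq1 i j : mu <= kk i j -> 1 <= (q i j)%:R :> R by move=> /weyl[[h _] _ _ _]; rewrite ler1n.
have hqN i j : mu <= kk i j -> (q i j)%:R <= N ^+ 2.
  move=> h; have [_ h1 _ _] := weyl _ _ h; apply: le_trans NN2.
  have : (q i j)%:R * mu ^+ 2 <= S * N ^+ 2.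
    apply: le_trans h1; apply: ler_wpM2l => //; exact: le_sqr_pos.
  have : (q i j)%:R * (2 * (S * N)) <= (q i j)%:R * mu ^+ 2 by apply: ler_wpM2l.
  move=> h2 h3; have h4 := le_trans h2 h3.
  have SN0 : 0 < S * N by positive.
  rewrite -(ler_pM2l SN0); have : 0 <= (q i j)%:R * (S * N) by nonneg.
  by rewrite expr2 in h4; lra.
pose kl i j := trunc_log 2 (Num.truncn (kk i j / mu)).
pose ql i j := trunc_log 2 (Num.truncn ((q i j)%:R : R)).
pose E (k : Lev) i j := [&& mu <= kk i j, kl i j == k.1 & ql i j == k.2].
(* Discarding the pairs below [mu] costs half of the lower bound [2 mu n^2]. *)
have heavy : mu * #|I|%:R ^+ 2 <= \sum_(k : Lev) \sum_i \sum_(j | E k i j) kk i j.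
  have -> : \sum_(k : Lev) \sum_i \sum_(j | E k i j) kk i j = \sum_i \sum_(j | mu <= kk i j) kk i j.
    rewrite exchange_big /=; apply: eq_bigr => i0 _.
    rewrite (exchange_big_dep (fun j => mu <= kk i0 j)) /=; last by move=> k j _ /and3P[].
    apply: eq_bigr => j hj.
    rewrite (big_pred1 (Ordinal (hdyad _ (hk1 _ _ hj) (hkN _ _ hj)),
                        Ordinal (hdyad _ (hq1 _ _ hj) (hqN _ _ hj)))) // => -[k1 k2] /=.
    by rewrite /E hj /= xpair_eqE -!val_eqE /= eq_sym (eq_sym (ql _ _)).
  have := dual [set: I]; rewrite cardsT.
  have -> : \sum_(i in [set: I]) \sum_(j in [set: I]) kk i j = \sum_i \sum_j kk i j.
    by apply: eq_big => [i|i _]; rewrite ?inE //; apply: eq_bigl => j; rewrite inE.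
  have : \sum_i \sum_j kk i j <= \sum_i (\sum_(j | mu <= kk i j) kk i j + mu * #|I|%:R).
    apply: ler_sum => i0 _; rewrite (bigID (fun j => mu <= kk i0 j)) /= lerD2l.
    rewrite mulr_natr -sumr_const [leRHS](bigID (fun j => mu <= kk i0 j)) /=.
    rewrite -[leLHS]add0r; apply: lerD; first by apply: sumr_ge0 => *; exact: ltW.
    by apply: ler_sum => j; rewrite -ltNge; exact: ltW.
  rewrite big_split /= sumr_const -[X in _ + X]mulr_natr.
  move=> h1 h2; have := le_trans h2 h1; rewrite expr2; lra.
have t0 : 0 < mu * #|I|%:R ^+ 2 by positive.
have s0 : 0 < (S / 2) ^+ 2 by positive.
have LevS : #|{: Lev}|%:R <= (S / 2) ^+ 2.
  rewrite card_prod !card_ord natrM -expr2 ler_pXn2r ?nnegrE //; last by nonneg.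
  by rewrite ler_pdivlMr // -natrM mulnC.
have [[l m] hE] := sum_pigeonhole t0 s0 LevS heavy.
pose kap := mu * 2 ^+ l; pose Q : R := 2 ^+ m.
(* [W] is such that the kernel bounds, divided by [q >= Q], become errors [W / N^2] and [W / N]. *)
pose P := S * N ^+ 2 / kap ^+ 2; pose W := P / Q.
have two_ge1 d : 1 <= 2 ^+ d :> R by rewrite exprn_ege1 // ler1n.
have Q1 : 1 <= Q := two_ge1 m.
have Q0 : 0 < Q by lra.
have mukap : mu <= kap by rewrite /kap ler_peMr // ltW.
have kap0 : 0 < kap by lra.
pose EE := E (l, m).
have hEE i j : EE i j -> [/\ mu <= kk i j, kap <= kk i j < 2 * kap & Q <= (q i j)%:R < 2 * Q].
  move=> /and3P[h /eqP /= e1 /eqP /= e2]; split => //.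
    have := dyadic_level (hk1 _ _ h); rewrite -/(kl i j) e1 exprS.
    by rewrite ler_pdivlMr // ltr_pdivrMr // -mulrA ![_ * mu]mulrC.
  by have := dyadic_level (hq1 _ _ h); rewrite -/(ql i j) e2 exprS.
pose e := \sum_i \sum_j (EE i j)%:R : R.
have he2 : \sum_i \sum_(j | EE i j) kk i j <= 2 * kap * e.
  rewrite /e mulr_sumr; apply: ler_sum => i0 _; rewrite mulr_sumr [leLHS]big_mkcond /=.
  apply: ler_sum => j _; case: (boolP (EE i0 j)) => [/hEE[_ /andP[_ h] _]|_]; last by rewrite mulr0.
  by rewrite mulr1 ltW.
have he : mu * #|I|%:R ^+ 2 / (2 * kap * S ^+ 2) <= e.
  have := le_trans hE he2; rewrite (_ : _ / (2 * (S / 2) ^+ 2) = 2 * kap * (2 * (mu * #|I|%:R ^+ 2 / (2 * kap * S ^+ 2)))); last first.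
    by field; rewrite !gt_eqF.
  rewrite ler_pM2l; last by positive.
  move=> h; apply: le_trans h; rewrite ler_peMl //; last by rewrite ler1n.
  by nonneg.
have e0 : 0 < e by apply: lt_le_trans he; positive.
(* An actual edge is required: its label gives [Q kap^2 <= S N^2], that is [Q <= P], and hence
   [1 <= W]. *)
have [i0 [j0 ij0]] : exists i j, EE i j.
  have [//|no] := pselect (exists i j, EE i j); exfalso; move: e0.
  rewrite /e big1 ?ltxx // => i _; apply: big1 => j _.
  by case: (boolP (EE i j)) => // h; exfalso; apply: no; exists i, j.
have QP : Q <= P.
  have [h /andP[k1 _] /andP[q1 _]] := hEE _ _ ij0; have [_ hq _ _] := weyl _ _ h.
  rewrite /P ler_pdivlMr; last by positive.
  apply: le_trans hq; apply: ler_pM => //; [by nonneg|by nonneg|].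
  exact: le_sqr_pos.
have W1 : 1 <= W by rewrite /W ler_pdivlMr // mul1r.
have W0 : 0 < W by lra.
have QW : Q * W = P by rewrite /W mulrC divfK // gt_eqF.
have mukap2 : mu ^+ 2 <= kap ^+ 2 by exact: le_sqr_pos.
have PN : 2 * P <= N.
  rewrite /P mulrA ler_pdivrMr; last by positive.
  apply: (@le_trans _ _ (N * mu ^+ 2)); last by apply: ler_wpM2l => //; exact: ltW.
  rewrite (_ : 2 * (S * N ^+ 2) = N * (2 * (S * N))); last by ring.
  by apply: ler_wpM2l => //; exact: ltW.
have P0 : 0 < P by lra.
have QN2 : 4 * Q ^+ 2 <= N ^+ 2.
  rewrite (_ : 4 * Q ^+ 2 = (2 * Q) ^+ 2); last by ring.
  by apply: le_sqr_pos; [positive|lra].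
have muQW : 8 * (S * Q * W) < mu ^+ 2.
  rewrite -mulrA QW -(@ltr_pM2r _ (kap ^+ 2)); last by positive.
  apply: (@lt_le_trans _ _ (mu ^+ 2 * mu ^+ 2)); last by apply: ler_wpM2l => //; nonneg.
  rewrite -exprD (_ : 8 * (S * P) * kap ^+ 2 = 2 ^+ 3 * (S ^+ 2 * N ^+ 2)) //.
  by rewrite /P; field; rewrite gt_eqF.
have QWN : Q * W <= N by rewrite QW; lra.
have edge i j : EE i j -> [/\ Q <= (q i j)%:R < 2 * Q, coprime `|b i j|%N (q i j),
      `|T i - T j - (b i j)%:~R / (q i j)%:R| <= W / N ^+ 2 &
      `|X i - X j - (a i j)%:~R / (q i j)%:R| <= W / N].
  move=> /hEE[h /andP[k1 _] /andP[q1 q2]]; have [[qp cb] _ hT hX'] := weyl _ _ h.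
  have qR : 0 < (q i j)%:R :> R by rewrite ltr0n.
  have kk2 : kap ^+ 2 <= kk i j ^+ 2 by exact: le_sqr_pos.
  have k20 : 0 < kap ^+ 2 by positive.
  have scale (Y : I -> R) (c : int) (M : R) : `|(q i j)%:R * (Y i - Y j) - c%:~R| * kk i j ^+ 2 <= M ->
      `|Y i - Y j - c%:~R / (q i j)%:R| <= M / kap ^+ 2 / Q.
    move=> h2; have M0 : 0 <= M by apply: le_trans h2; rewrite mulr_ge0 // sqr_ge0.
    rewrite -(ler_pM2l qR) -[X in X * `|_|](gtr0_norm qR) -normrM mulrBr mulrCA divff ?gt_eqF // mulr1.
    apply: (@le_trans _ _ (M / kap ^+ 2)).
      rewrite ler_pdivlMr //; apply: le_trans h2; exact: ler_wpM2l.
    rewrite mulrCA; apply: ler_peMr; first by nonneg.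
    by rewrite ler_pdivlMr // mul1r.
  split => //; first by apply/andP.
    rewrite (_ : W / N ^+ 2 = S / kap ^+ 2 / Q); first exact: scale.
    by rewrite /W /P; field; rewrite !gt_eqF.
  rewrite (_ : W / N = S * N / kap ^+ 2 / Q); first exact: scale.
  by rewrite /W /P; field; rewrite !gt_eqF.
have LS' : L.+1%:R <= S.
  by apply: le_trans LS; rewrite ler_nat leq_pmull.
have LS'' : L%:R <= S by apply: le_trans LS'; rewrite ler_nat.
have NL : N < mu * 2 ^+ L.
  apply: (@lt_le_trans _ _ (2 ^+ L)); first exact: le_lt_trans N2L.
  by rewrite ler_peMl.
have muN : S * N <= mu ^+ 2.
  by apply: le_trans SN2; rewrite ler_peMl ?ler1n //; nonneg.
have [D0 [F0 [[D1 F1 DF FQ] [h4 h5 h6]]]] :=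
  rich_edge_bounds N1 Q1 W1 S1 QWN edge (fun m m0 hm => hdiv m m0 (le_trans hm QN2)) hX hsep
    mu0 muQW muN weyl kkN NL LS'' dual (le_lt_trans QN2 N2L) LS' erefl erefl e0 n0.
have e4 : 4 = 2 ^+ 2 :> R by rewrite -natrX.
have e8 : 8 = 2 ^+ 3 :> R by rewrite -natrX.
rewrite e4 in FQ h5.
apply: (exponents_incompatible S32 SN N7 mu0 mukap Q1 W1 QW n0 he D1 F1 DF FQ h4 h5).
by move=> Z; rewrite -e8 -e4; exact: h6.
Qed.

(** * Duality and the Weyl kernel *)

Section Exponentials.

Variable R : realType.
Implicit Types (x y th : R) (z w : R[i]).

Lemma cabs_ge0 z : 0 <= cabs z.
Proof. by case: z => a b; exact: sqrtr_ge0. Qed.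

Lemma cabsM z w : cabs (z * w) = cabs z * cabs w.
Proof. exact: ComplexField.Normc.normcM. Qed.

Lemma cabsD z w : cabs (z + w) <= cabs z + cabs w.
Proof. exact: le_normcD. Qed.

Lemma cabsN z : cabs (- z) = cabs z.
Proof. exact: normcN. Qed.

Lemma cabsBC z w : cabs (z - w) = cabs (w - z).
Proof. by rewrite -cabsN opprB. Qed.

Lemma cabs0 : cabs (0 : R[i]) = 0.
Proof. exact: ComplexField.Normc.normc0. Qed.

Lemma cabs1 : cabs (1 : R[i]) = 1.
Proof. exact: ComplexField.Normc.normc1. Qed.

Lemma cabs_sum (J : Type) (r : seq J) (P : pred J) (f : J -> R[i]) :
  cabs (\sum_(j <- r | P j) f j) <= \sum_(j <- r | P j) cabs (f j).
Proof.
elim/big_rec2: _ => [|j u v _ h]; first by rewrite cabs0.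
by apply: le_trans (cabsD _ _) _; rewrite lerD2l.
Qed.

Lemma cabs_sqr z : cabs z ^+ 2 = complex.Re z ^+ 2 + complex.Im z ^+ 2.
Proof. by case: z => a b; rewrite /cabs /= sqr_sqrtr // addr_ge0 // sqr_ge0. Qed.

Lemma eD x y : e (x + y) = e x * e y.
Proof. by rewrite /e mulrDr cosD sinD; apply/eqP; rewrite eq_complex /= addrC; apply/andP; split; apply/eqP; ring. Qed.

Lemma e0 : e 0 = 1 :> R[i].
Proof. by rewrite /e mulr0 cos0 sin0. Qed.

Lemma cabs_e x : cabs (e x) = 1.
Proof.
apply/eqP; rewrite -(@eqrXn2 _ 2) ?cabs_ge0 // cabs_sqr /= cos2Dsin2 expr1n //.
Qed.

Lemma e_nat (n : nat) : e n%:R = 1 :> R[i].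
Proof.
elim: n => [|n IH]; first exact: e0.
rewrite -addn1 natrD eD IH mul1r /e mulr1 mulr_natl.
by rewrite cos2pi sin2pi.
Qed.

Lemma eN x : e (- x) * e x = 1.
Proof. by rewrite -eD addNr e0. Qed.

Lemma e_int (n : int) : e n%:~R = 1 :> R[i].
Proof.
case: n => n; first by rewrite -pmulrn e_nat.
rewrite NegzE mulrNz; have := eN (n.+1)%:R; rewrite e_nat mulr1 => <-.
by rewrite -pmulrn.
Qed.

Lemma e_conj x : (e x)^* = e (- x).
Proof. by rewrite /e mulrN cosN sinN. Qed.

Lemma e_mulrn (n : nat) x : e (n%:R * x) = e x ^+ n.
Proof.
by elim: n => [|n IH]; rewrite ?mul0r ?e0 // -addn1 natrD mulrDl mul1r eD IH addn1 exprSr.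
Qed.

Lemma cabs_1Be_sqr x : cabs (1 - e x) ^+ 2 = 2 - 2 * cos (2 * pi * x).
Proof.
rewrite cabs_sqr /=; have := cos2Dsin2 (2 * pi * x).
set c := cos _; set s := sin _ => h.
by rewrite (_ : _ + _ = 1 - 2 * c + (c ^+ 2 + s ^+ 2)); [rewrite h; ring|ring].
Qed.

Lemma cabs_1BeN x : cabs (1 - e (- x)) = cabs (1 - e x).
Proof.
by apply/eqP; rewrite -(@eqrXn2 _ 2) ?cabs_ge0 // !cabs_1Be_sqr mulrN cosN.
Qed.

Lemma cabs_1Be_ge1 x : 1 / 4 <= `|x| <= 3 / 4 -> 1 <= cabs (1 - e x).
Proof.
wlog x0 : x / 0 <= x.
  move=> H; have [x0|x0] := leP 0 x; first exact: H.
  by rewrite -cabs_1BeN -normrN; apply: H; rewrite oppr_ge0 ltW.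
rewrite ger0_norm // => /andP[x1 x2].
rewrite -(@ler_pXn2r _ 2) ?nnegrE ?cabs_ge0 // expr1n cabs_1Be_sqr.
have pi0 : 0 < pi :> R by exact: pi_gt0.
have : 0 <= cos (2 * pi * x - pi) by apply: cos_ge0_pihalf; apply/andP; split; nra.
have -> : cos (2 * pi * x) = - cos (2 * pi * x - pi) by rewrite -cosDpi subrK.
lra.
Qed.

(* Doubling [x] at most doubles [1 - e x], which reduces the claim to [1/4 <= |x|]. *)
Lemma cabs_1Be_ge x : `|x| <= 3 / 4 -> `|x| <= cabs (1 - e x).
Proof.
have [->|x0] := eqVneq x 0; first by rewrite normr0 cabs_ge0.
have dbl y : cabs (1 - e (2 * y)) <= 2 * cabs (1 - e y).
  have -> : 1 - e (2 * y) = (1 + e y) * (1 - e y) by rewrite e_mulrn; ring.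
  rewrite cabsM ler_wpM2r ?cabs_ge0 //; apply: le_trans (cabsD _ _) _.
  by rewrite cabs1 cabs_e.
have P k y : 1 / 4 <= 2 ^+ k * `|y| -> `|y| <= 3 / 4 -> `|y| <= cabs (1 - e y).
  elim: k y => [|k IH] y h1 h2.
    rewrite expr0 in h1; apply: le_trans (cabs_1Be_ge1 _); first lra.
    by apply/andP; split; lra.
  have [h3|h3] := leP (1 / 4) `|y|.
    by apply: le_trans (cabs_1Be_ge1 _); [lra|apply/andP; split; lra].
  have e2 : `|2 * y| = 2 * `|y| by rewrite normrM ger0_norm.
  have h4 : `|2 * y| <= cabs (1 - e (2 * y)).
    by apply: IH; rewrite e2; [rewrite mulrA -exprSr|lra].
  by have := dbl y; lra.
have x00 : 0 < `|x| by rewrite normr_gt0.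
apply: (P (Num.truncn (`|x|^-1)).+1).
set k := Num.truncn _.
have /andP[_ h] : k%:R <= `|x|^-1 < k.+1%:R by apply: truncn_itv; rewrite invr_ge0.
apply: (@le_trans _ _ 1); first lra.
rewrite -ler_pdivrMr // div1r; apply: (le_trans (ltW h)).
by rewrite -natrX ler_nat ltnW // ltn_expl.
Qed.

(** [|1 - e x| = 2 |sin (pi x)|], with [|sin y| <= y] from the mean value theorem and [pi <= 4]. *)
Lemma cabs_1Be_le x : cabs (1 - e x) <= 8 * `|x|.
Proof.
have sin_le y : 0 <= y -> `|sin y| <= y.
  rewrite le_eqVlt => /predU1P[<-|y0]; first by rewrite sin0 normr0.
  have cont : {within `[0, y], continuous (@sin R)}%classic.
    by apply: continuous_subspaceT => t; exact: continuous_sin.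
  have [c _] := @MVT R sin cos 0 y y0 (fun t _ => is_derive_sin t) cont.
  rewrite sin0 !subr0 => ->; rewrite normrM (gtr0_norm y0) ler_piMl ?(ltW y0) //.
  exact: cos_max.
have pi4 : pi <= 4 :> R by have [/andP[_ h] _] := pihalf_02_cos_pihalf R; lra.
have pi0 : 0 < pi :> R by exact: pi_gt0.
wlog x0 : x / 0 <= x.
  move=> H; have [x0|x0] := leP 0 x; first exact: H.
  by rewrite -cabs_1BeN -normrN; apply: H; rewrite oppr_ge0 ltW.
rewrite ger0_norm // -(@ler_pXn2r _ 2) ?nnegrE ?cabs_ge0 //; last by rewrite mulr_ge0.
rewrite cabs_1Be_sqr (_ : 2 * pi * x = (pi * x) *+ 2); last by rewrite mulr2n; ring.
rewrite cos_mulr2n.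
have h := sin_le (pi * x) (mulr_ge0 (ltW pi0) x0).
have h2 : `|sin (pi * x)| <= 4 * x by apply: le_trans h _; apply: ler_wpM2r.
have : `|sin (pi * x)| ^+ 2 <= (4 * x) ^+ 2 by rewrite ler_pXn2r ?nnegrE // mulr_ge0.
rewrite real_normK ?num_real // sin2cos2 exprMn [(8 * x) ^+ 2]exprMn.
lra.
Qed.

(** * Geometric sums, summation by parts, differencing and duality *)

Definition geomsum (M : nat) th : R[i] := \sum_(1 <= m < M.+1) e (m%:R * th).

Lemma eBint x (z : int) : e (x - z%:~R) = e x.
Proof. by rewrite eD -intrN e_int mulr1. Qed.

Lemma geomsum_int (M : nat) th (z : int) : geomsum M (th - z%:~R) = geomsum M th.
Proof.
apply: eq_bigr => m _; rewrite mulrBr (_ : m%:R * z%:~R = (m%:Z * z)%:~R :> R) ?eBint //.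
by rewrite intrM.
Qed.

Lemma cabs_geomsum_le (M : nat) th : cabs (geomsum M th) <= M%:R.
Proof.
apply: le_trans (cabs_sum _ _ _) _.
under eq_bigr do rewrite cabs_e.
by rewrite sumr_const_nat subSS subn0.
Qed.

(** The sum telescopes against [1 - e th], and [cabs_1Be_ge] bounds that factor from below. The
    product form also covers integral [th]. *)
Lemma cabs_geomsum_dist (M : nat) th (z : int) :
  `|th - z%:~R| <= 3 / 4 -> cabs (geomsum M th) * `|th - z%:~R| <= 2.
Proof.
move=> h; apply: (@le_trans _ _ (cabs (geomsum M th) * cabs (1 - e (th - z%:~R)))).
  by apply: ler_wpM2l; rewrite ?cabs_ge0 // cabs_1Be_ge.
have tel : geomsum M th * (1 - e th) = e th - e (M.+1%:R * th).
  elim: M => [|M IH]; first by rewrite /geomsum big_geq // mul0r mul1r subrr.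
  rewrite /geomsum big_nat_recr //= -/(geomsum M th) mulrDl IH mulrBr mulr1 -eD.
  rewrite -[in X in e (_ + X)](mul1r th) -mulrDl natr1; ring.
by rewrite eBint -cabsM tel; apply: le_trans (cabsD _ _) _; rewrite cabsN !cabs_e.
Qed.

(** Summation by parts, used to compare geometric sums at neighbouring frequencies and to sum slowly
    varying blocks against a linear phase. *)
Lemma abel_summation (u w : nat -> R[i]) (B : R) (J : nat) :
  (forall j, (j <= J)%N -> cabs (\sum_(1 <= k < j.+1) u k) <= B) ->
  cabs (\sum_(1 <= k < J.+1) u k * w k) <=
    B * (cabs (w J) + \sum_(1 <= k < J) cabs (w k.+1 - w k)).
Proof.
move=> hB; pose P j := \sum_(1 <= k < j.+1) u k.
have -> : \sum_(1 <= k < J.+1) u k * w k =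
    P J * w J - \sum_(1 <= k < J) P k * (w k.+1 - w k).
  elim: J {hB} => [|J IH]; first by rewrite /P !big_geq // mul0r subrr.
  have PS : P J.+1 = P J + u J.+1 by rewrite /P big_nat_recr.
  rewrite big_nat_recr //= IH PS; case: J {IH PS} => [|J].
    have -> : P 0%N = 0 by rewrite /P big_geq.
    by rewrite !big_geq //; ring.
  by rewrite [in RHS]big_nat_recr //=; ring.
apply: le_trans (cabsD _ _) _; rewrite cabsN mulrDr; apply: lerD.
  by rewrite cabsM; apply: ler_wpM2r; [exact: cabs_ge0|exact: hB].
apply: le_trans (cabs_sum _ _ _) _; rewrite mulr_sumr big_nat_cond [leRHS]big_nat_cond.
apply: ler_sum => k /andP[/andP[_ kJ] _]; rewrite cabsM.
by apply: ler_wpM2r; [exact: cabs_ge0|apply: hB; exact: ltnW].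
Qed.

Lemma sum_lt_diagonals (F : nat -> nat -> R[i]) (N : nat) :
  \sum_(1 <= n < N.+1) \sum_(1 <= m < n) F n m =
  \sum_(1 <= h < N) \sum_(1 <= m < (N - h).+1) F (m + h)%N m.
Proof.
elim: N => [|N IH]; first by rewrite !big_geq.
rewrite big_nat_recr //= IH.
have -> : \sum_(1 <= h < N) \sum_(1 <= m < (N - h).+1) F (m + h)%N m =
    \sum_(1 <= h < N.+1) \sum_(1 <= m < (N - h).+1) F (m + h)%N m.
  case: N {IH} => [|N]; first by rewrite !big_geq.
  by rewrite [RHS]big_nat_recr //= subnn [X in _ = _ + X]big_geq // addr0.
have -> : \sum_(1 <= m < N.+1) F N.+1 m = \sum_(1 <= h < N.+1) F N.+1 (N.+1 - h)%N.
  by rewrite big_nat_rev /=; apply: eq_big_nat => h _; rewrite add1n subSS.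
rewrite -big_split /=; apply: eq_big_nat => h /andP[_ hN].
by rewrite subSn // [RHS]big_nat_recr //= addSn subnK.
Qed.

Lemma cabs_sqrD z w :
  cabs (z + w) ^+ 2 = cabs z ^+ 2 + cabs w ^+ 2 + 2 * complex.Re (w * z^*).
Proof. by rewrite !cabs_sqr; case: z w => [a b] [c d] /=; ring. Qed.

Lemma Re_le_cabs z : complex.Re z <= cabs z.
Proof.
apply: le_trans (ler_norm _) _.
rewrite -(@ler_pXn2r _ 2) ?nnegrE ?cabs_ge0 // cabs_sqr real_normK ?num_real //.
by rewrite lerDl sqr_ge0.
Qed.

(** Weyl differencing: the off-diagonal part of the square is twice the real part of the sum over
    [m < n], regrouped by [h = n - m]. *)
Lemma cabs_sum_sqr_le (z : nat -> R[i]) (N : nat) :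
  cabs (\sum_(1 <= n < N.+1) z n) ^+ 2 <= \sum_(1 <= n < N.+1) cabs (z n) ^+ 2 +
    2 * cabs (\sum_(1 <= h < N) \sum_(1 <= m < (N - h).+1) z (m + h)%N * (z m)^*).
Proof.
rewrite -(sum_lt_diagonals (fun n m => z n * (z m)^*)).
apply: (@le_trans _ _ (\sum_(1 <= n < N.+1) cabs (z n) ^+ 2 +
    2 * complex.Re (\sum_(1 <= n < N.+1) \sum_(1 <= m < n) z n * (z m)^*))); last first.
  by rewrite lerD2l ler_wpM2l // Re_le_cabs.
rewrite le_eqVlt; apply/orP; left; apply/eqP.
elim: N => [|N IH]; first by rewrite !big_geq // cabs0 expr0n /= mulr0 addr0.
have ReD (a b : R[i]) : complex.Re (a + b) = complex.Re a + complex.Re b by case: a b => [? ?] [? ?].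
rewrite !(@big_nat_recr _ _ _ N.+1 1) // cabs_sqrD IH ReD rmorph_sum mulr_sumr.
set re := @complex.Re R; rewrite /=; ring.
Qed.

Lemma cabsV z : cabs z^-1 = (cabs z)^-1.
Proof. exact: ComplexField.Normc.normcV. Qed.

Lemma cabs_real (r : R) : 0 <= r -> cabs (r%:C%C) = r.
Proof. by move=> r0; rewrite /cabs /= expr0n /= addr0 sqrtr_sqr ger0_norm. Qed.

Lemma mul_conj z : z * z^* = (cabs z ^+ 2)%:C%C.
Proof.
rewrite cabs_sqr; case: z => a b /=; apply/eqP; rewrite eq_complex /=.
by apply/andP; split; apply/eqP; ring.
Qed.

(** Halasz-Montgomery duality: weights [u j] of modulus at most 1 turn the sum of absolute values
    into one linear form in the coefficients [c], and Cauchy-Schwarz in [n] removes the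
    coefficients. *)
Lemma sqr_sum_le (J : finType) (A : {set J}) (f : J -> R[i]) (N : nat) (c : nat -> R[i])
    (g : J -> nat -> R[i]) :
  \sum_(1 <= n < N.+1) cabs (c n) ^+ 2 = 1 ->
  (forall j, j \in A -> f j = \sum_(1 <= n < N.+1) c n * g j n) ->
  (\sum_(j in A) cabs (f j)) ^+ 2 <=
    \sum_(i in A) \sum_(j in A) cabs (\sum_(1 <= n < N.+1) g i n * (g j n)^*).
Proof.
move=> c1 hf.
have /choice[u hu] : forall j, exists u : R[i], cabs u <= 1 /\ f j * u = (cabs (f j))%:C%C.
  move=> j; have [f0|f0] := eqVneq (f j) 0.
    by exists 0; rewrite f0 mul0r !cabs0.
  exists ((f j)^-1 * (cabs (f j))%:C%C); rewrite mulrA divff // mul1r; split => //.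
  rewrite cabsM cabsV cabs_real ?cabs_ge0 //.
  rewrite mulVf //; apply: contra f0 => /eqP f0.
  by apply/eqP; exact: ComplexField.Normc.eq0_normc f0.
pose G n := \sum_(j in A) g j n * u j; set s := \sum_(j in A) cabs (f j).
have s0 : 0 <= s by apply: sumr_ge0 => j _; exact: cabs_ge0.
have sE : s%:C%C = \sum_(1 <= n < N.+1) c n * G n.
  rewrite /s rmorph_sum /=.
  under eq_bigr => j jA do rewrite -(hu j).2 (hf j jA) mulr_suml.
  rewrite exchange_big /=; apply: eq_bigr => n _; rewrite /G mulr_sumr.
  by apply: eq_bigr => j _; rewrite mulrA.
have s1 : s <= \sum_(1 <= n < N.+1) cabs (c n) * cabs (G n).
  rewrite -[leLHS](cabs_real s0) sE; apply: le_trans (cabs_sum _ _ _) _.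
  by apply: ler_sum => n _; rewrite cabsM.
clearbody s.
have s2 : s ^+ 2 <= \sum_(1 <= n < N.+1) cabs (G n) ^+ 2.
  (* Cauchy-Schwarz without square roots: the expansion is [s^2 - 2 s p + r] with [s <= p] by [s1],
     so [s^2 <= r]. *)
  have : 0 <= \sum_(1 <= n < N.+1) (s * cabs (c n) - cabs (G n)) ^+ 2.
    by apply: sumr_ge0 => n _; exact: sqr_ge0.
  have -> : \sum_(1 <= n < N.+1) (s * cabs (c n) - cabs (G n)) ^+ 2 =
      s ^+ 2 * (\sum_(1 <= n < N.+1) cabs (c n) ^+ 2) -
      2 * s * (\sum_(1 <= n < N.+1) cabs (c n) * cabs (G n)) + \sum_(1 <= n < N.+1) cabs (G n) ^+ 2.
    rewrite !mulr_sumr -sumrB -big_split /=; apply: eq_bigr => n _; ring.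
  rewrite c1 mulr1; nra.
apply: (le_trans s2).
have r0 : 0 <= \sum_(1 <= n < N.+1) cabs (G n) ^+ 2 by apply: sumr_ge0 => n _; exact: sqr_ge0.
rewrite -(cabs_real r0) rmorph_sum /=.
have -> : \sum_(1 <= n < N.+1) (cabs (G n) ^+ 2)%:C%C =
    \sum_(i in A) \sum_(j in A) (u i * (u j)^*) * \sum_(1 <= n < N.+1) g i n * (g j n)^*.
  under eq_bigr => n _.
    rewrite -mul_conj /G rmorph_sum big_distrlr /=.
    over.
  rewrite exchange_big /=; apply: eq_bigr => i _; rewrite exchange_big /=; apply: eq_bigr => j _.
  by rewrite mulr_sumr; apply: eq_bigr => n _; rewrite rmorphM /=; ring.
apply: le_trans (cabs_sum _ _ _) _; apply: ler_sum => i _.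
apply: le_trans (cabs_sum _ _ _) _; apply: ler_sum => j _; rewrite cabsM.
have cJ z : cabs z^* = cabs z.
  by apply/eqP; rewrite -(@eqrXn2 _ 2) ?cabs_ge0 // !cabs_sqr; case: z => a b /=; rewrite sqrrN.
rewrite ler_piMl ?cabs_ge0 // cabsM cJ; have [h1 _] := hu i; have [h2 _] := hu j.
by rewrite -[1]mulr1; apply: ler_pM; rewrite ?cabs_ge0.
Qed.

(** * The differenced sum over multiples and nonmultiples of [q] *)

Definition harmsum (n : nat) : R := \sum_(1 <= k < n.+1) k%:R^-1.

Lemma harmsum_le (m n : nat) : (m <= n)%N -> harmsum m <= harmsum n.
Proof.
move=> mn; rewrite /harmsum [leRHS](@big_cat_nat _ _ _ m.+1) //=.
by rewrite lerDl; apply: sumr_ge0 => k _; rewrite invr_ge0.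
Qed.

Lemma harmsum_ge1 (n : nat) : (0 < n)%N -> 1 <= harmsum n.
Proof.
move=> n0; rewrite /harmsum big_ltn // invr1 lerDl; apply: sumr_ge0 => k _.
by rewrite invr_ge0.
Qed.

(** Modulo 1, [h T] is [(r + eta) / q] with [|eta| <= 1/4], so its distance to the integers is at
    least half of [min(r, q - r) / q]. The sum of both reciprocals replaces the minimum. *)
Lemma cabs_geomsum_mul_le (M h q r : nat) (T : R) (b : int) :
  (0 < q)%N -> (0 < r < q)%N -> h%:R * `|q%:R * T - b%:~R| <= 1 / 4 ->
  (h%:Z * b = r %[mod q])%Z ->
  cabs (geomsum M (h%:R * T)) <= 4 * q%:R * (r%:R^-1 + (q - r)%:R^-1).
Proof.
move=> q0 /andP[r0 rq] hq hb.
have /dvdzP[z hz] : (q%:Z %| h%:Z * b - r%:Z)%Z by rewrite -eqz_mod_dvd; apply/eqP.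
have qR : 0 < q%:R :> R by rewrite ltr0n.
have rR : 1 <= r%:R :> R by rewrite ler1n.
have qrR : 1 <= (q - r)%:R :> R by rewrite ler1n subn_gt0.
have qrE : (q - r)%:R = q%:R - r%:R :> R by rewrite natrB // ltnW.
pose eta := h%:R * (q%:R * T - b%:~R).
have etaB : `|eta| <= 1 / 4 by rewrite /eta normrM ger0_norm.
have zE : z%:~R * q%:R = h%:R * b%:~R - r%:R :> R.
  by have := congr1 (fun n : int => n%:~R : R) hz; rewrite intrB !intrM.
have key : h%:R * T - z%:~R = (r%:R + eta) / q%:R.
  rewrite -[z%:~R](mulfK (_ : q%:R != 0)) ?gt_eqF // zE /eta; field.
  by rewrite gt_eqF.
have key2 : h%:R * T - (z + 1)%:~R = - ((q - r)%:R - eta) / q%:R.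
  by rewrite intrD opprD addrA key qrE; field; rewrite gt_eqF.
have fin (w : int) (d s : R) : 1 <= d -> d <= q%:R / 2 -> `|s| <= 1 / 4 -> `|h%:R * T - w%:~R| = (d + s) / q%:R ->
    cabs (geomsum M (h%:R * T)) <= 4 * q%:R * d^-1.
  move=> d1 dq; rewrite ler_norml => /andP[s1 s2] E.
  have h34 : `|h%:R * T - w%:~R| <= 3 / 4.
    have q1 : 1 <= q%:R :> R by rewrite ler1n.
    by rewrite E ler_pdivrMr //; lra.
  have := cabs_geomsum_dist M h34; rewrite E => hg.
  have : cabs (geomsum M (h%:R * T)) * (d / 2 / q%:R) <= 2.
    apply: le_trans hg; apply: ler_wpM2l; first exact: cabs_ge0.
    by apply: ler_wpM2r; [rewrite invr_ge0|lra].
  have d0 : 0 < d by lra.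
  rewrite mulrA ler_pdivrMr // mulrA ler_pdivrMr // => hh.
  by rewrite ler_pdivlMr //; lra.
have r0R : 0 < r%:R :> R by lra.
have qr0R : 0 < (q - r)%:R :> R by lra.
have [h1|h1] := leP r%:R (q%:R / 2 : R).
  apply: (@le_trans _ _ (4 * q%:R * r%:R^-1)).
    apply: (fin z _ eta) => //; rewrite key normrM normfV (gtr0_norm qR) ger0_norm //.
    by move: etaB; rewrite ler_norml => /andP[? ?]; lra.
  by apply: ler_wpM2l; [nonneg|rewrite lerDl invr_ge0 ltW].
apply: (@le_trans _ _ (4 * q%:R * (q - r)%:R^-1)).
  apply: (fin (z + 1) _ (- eta)) => //; [lra|by rewrite normrN|].
  rewrite key2 normrM normfV (gtr0_norm qR) normrN ger0_norm //.
  by move: etaB; rewrite ler_norml => /andP[? ?]; lra.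
by apply: ler_wpM2l; [nonneg|rewrite lerDr invr_ge0 ltW].
Qed.

(** As [b] is invertible modulo [q], each nonzero residue of [h b] occurs for at most [2 N / q + 1]
    values of [h], and the reciprocals add up to harmonic sums. The constant is
    [(2 N / q + 1) 8 q <= 48 N], from [q <= 4 N]. *)
Lemma sum_nonmultiples (N q : nat) (T : R) (b : int) (M : nat -> nat) :
  (0 < q)%N -> (q <= 4 * N)%N -> coprime `|b|%N q ->
  N%:R * `|q%:R * T - b%:~R| <= 1 / 4 ->
  \sum_(1 <= h < N | ~~ (q %| h)%N) cabs (geomsum (M h) (h%:R * T)) <=
    48 * N%:R * harmsum q.
Proof.
case: q => // p _; set q := p.+1 => qN cb hT.
have qR : 0 < q%:R :> R by rewrite ltr0n.
have N0 : (0 < N)%N by case: N qN hT.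
pose rho (h : 'I_N) : 'I_q := inord `|((h : nat)%:Z * b %% q%:Z)%Z|%N.
have rhoE h : (rho h : int) = ((h : nat)%:Z * b %% q%:Z)%Z.
  have h0 : 0 <= ((h : nat)%:Z * b %% q%:Z)%Z by rewrite modz_ge0.
  have h1 : ((h : nat)%:Z * b %% q%:Z)%Z < q%:Z by rewrite ltz_pmod.
  have e1 : (`|((h : nat)%:Z * b %% q%:Z)%Z|%N : int) = ((h : nat)%:Z * b %% q%:Z)%Z.
    by rewrite abszE ger0_norm.
  by rewrite /rho inordK // -ltz_nat e1.
have rho0 (h : 'I_N) : ~~ (q %| h)%N -> (0 < rho h)%N.
  move=> qh; rewrite lt0n; apply: contra qh => /eqP r0.
  have := rhoE h; rewrite r0 => /esym/dvdz_mod0P.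
  by rewrite Gauss_dvdzl // coprimezE coprime_sym.
pose phi (r : 'I_q) := 4 * q%:R * ((r : nat)%:R^-1 + (q - r)%:R^-1) : R.
have phi0 r : 0 <= phi r by rewrite /phi; nonneg.
have -> : \sum_(1 <= h < N | ~~ (q %| h)%N) cabs (geomsum (M h) (h%:R * T)) =
   \sum_(h < N | ~~ (q %| h)%N) cabs (geomsum (M h) (h%:R * T)).
  by rewrite -(big_mkord (fun h => ~~ (q %| h)%N) (fun h => cabs (geomsum (M h) (h%:R * T)))) big_ltn_cond.
apply: (@le_trans _ _ (\sum_(h < N | ~~ (q %| h)%N) phi (rho h))).
  apply: ler_sum => h qh; apply: (@cabs_geomsum_mul_le _ _ q _ _ b) => //.
  - by rewrite rho0 ?ltn_ord.
  - apply: le_trans hT; apply: ler_wpM2r => //; rewrite ler_nat; exact: ltnW.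
  - by rewrite rhoE modz_mod.
rewrite (partition_big rho (fun r : 'I_q => (r : nat) != 0%N)) /=; last first.
  by move=> h /rho0; rewrite lt0n.
have cnt (r : 'I_q) : #|[set h : 'I_N | rho h == r]|%:R <= 2 * N%:R / q%:R + 1 :> R.
  set A := [set h | _].
  apply: (@le_trans _ _ (size [seq (h : nat)%:Z | h : 'I_N in A])%:R).
    by rewrite size_map -cardE.
  apply: residue_size => //.
  - by rewrite map_inj_uniq ?enum_uniq // => h h' [] /val_inj.
  - move=> x y /mapP[h + ->] /mapP[h' + ->]; rewrite !mem_enum !inE => /eqP hh /eqP hh'.
    have : (q%:Z %| ((h : nat)%:Z - (h' : nat)%:Z) * b)%Z.
      by rewrite mulrBl -eqz_mod_dvd -!rhoE hh hh'.
    by rewrite Gauss_dvdzl // coprimezE coprime_sym.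
  - by move=> x /mapP[h _ ->]; rewrite -pmulrn ger0_norm // ler_nat ltnW.
apply: (@le_trans _ _ (\sum_(r < q | (r : nat) != 0%N) (2 * N%:R / q%:R + 1) * phi r)).
  apply: ler_sum => r _.
  apply: (@le_trans _ _ (\sum_(h in [set h : 'I_N | rho h == r]) phi r)).
    rewrite big_mkcond [leRHS]big_mkcond /=; apply: ler_sum => h _; rewrite inE.
    by case: (~~ _) => //=; case: eqP => // ->.
  by rewrite sumr_const -[leLHS]mulr_natl; apply: ler_wpM2r.
rewrite -mulr_sumr.
have -> : \sum_(r < q | (r : nat) != 0%N) phi r = 4 * q%:R * (harmsum p + harmsum p).
  rewrite /phi -mulr_sumr; congr (_ * _); rewrite big_split /=.
  have E (F : nat -> R) : \sum_(r < q | (r : nat) != 0%N) F r = \sum_(1 <= r < q) F r.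
    rewrite -(big_mkord (fun r => r != 0%N) F) big_ltn_cond //= big_nat_cond [RHS]big_nat_cond.
    by apply: eq_bigl => r; case: r => //=; rewrite andbF.
  rewrite (E (fun r => r%:R^-1)) (E (fun r => (q - r)%:R^-1)); congr (_ + _).
  by rewrite big_nat_rev /=; apply: eq_big_nat => r /andP[r1 r2]; rewrite add1n subSS subKn // ltnW.
have h1 : harmsum p <= harmsum q by exact: harmsum_le.
have h2 : 0 <= harmsum p by apply: sumr_ge0 => k _; rewrite invr_ge0.
rewrite [leLHS](_ : _ = (16 * N%:R + 8 * q%:R) * harmsum p); last by field; rewrite gt_eqF.
have qN' : q%:R <= 4 * N%:R :> R by rewrite -natrM ler_nat.
by apply: ler_pM => //; lra.
Qed.

Lemma sum_multiples (F : nat -> R[i]) (N q : nat) : (0 < q)%N ->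
  \sum_(1 <= h < N.+1 | (q %| h)%N) F h = \sum_(1 <= k < (N %/ q).+1) F (q * k)%N.
Proof.
move=> q0; elim: N => [|N IH]; first by rewrite div0n !big_geq.
rewrite big_mkcond big_nat_recr //= -big_mkcond /= IH divnS //.
case: (boolP (q %| N.+1)%N) => h; last by rewrite add0n addr0.
rewrite add1n [RHS]big_nat_recr //=; congr (_ + F _).
by have := divnS N q0; rewrite h add1n => <-; rewrite mulnC divnK.
Qed.

Lemma cabs_eB x y : cabs (e x - e y) = cabs (1 - e (x - y)).
Proof.
have -> : e x - e y = - (e y * (1 - e (x - y))).
  by rewrite mulrBr -eD (addrC y) subrK mulr1 opprB.
by rewrite cabsN cabsM cabs_e mul1r.
Qed.

(** The weights [e (m th) - 1] have size and total variation of order [M |th|], while the partial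
    sums at frequency [k th] are at most [2 / (k |th|)]; the factor [|th|] cancels. *)
Lemma geomsum_variation (M k : nat) th : (0 < k)%N -> k%:R * `|th| <= 3 / 4 ->
  cabs (geomsum M (k.+1%:R * th) - geomsum M (k%:R * th)) <= 32 * M%:R / k%:R.
Proof.
move=> k0 hk; have kR : 0 < k%:R :> R by rewrite ltr0n.
have [->|th0] := eqVneq th 0; first by rewrite !mulr0 subrr cabs0; nonneg.
have t0 : 0 < `|th| by rewrite normr_gt0.
pose u (m : nat) := e (m%:R * (k%:R * th)); pose w (m : nat) := e (m%:R * th) - 1.
have -> : geomsum M (k.+1%:R * th) - geomsum M (k%:R * th) = \sum_(1 <= m < M.+1) u m * w m.
  rewrite -sumrB; apply: eq_bigr => m _; rewrite /u /w mulrBr mulr1 -eD.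
  by rewrite -[k.+1%:R]natr1; congr (e _ - _); ring.
have hB j : cabs (\sum_(1 <= m < j.+1) u m) <= 2 / (k%:R * `|th|).
  rewrite ler_pdivlMr; last by positive.
  have := @cabs_geomsum_dist j (k%:R * th) 0; rewrite subr0 normrM ger0_norm //.
  exact.
apply: le_trans (@abel_summation u w _ M (fun j _ => hB j)) _.
have w1 (m : nat) : cabs (w m) <= 8 * (m%:R * `|th|).
  by rewrite /w cabsBC; apply: le_trans (cabs_1Be_le _) _; rewrite normrM ger0_norm.
have w2 (m : nat) : cabs (w m.+1 - w m) <= 8 * `|th|.
  rewrite /w opprB addrA subrK cabs_eB; apply: le_trans (cabs_1Be_le _) _.
  by rewrite -mulrBl -[m.+1%:R]natr1 addrAC subrr add0r mul1r.
apply: (@le_trans _ _ (2 / (k%:R * `|th|) * (8 * (M%:R * `|th|) + M%:R * (8 * `|th|)))).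
  apply: ler_wpM2l; first by nonneg.
  apply: lerD => //; apply: (@le_trans _ _ (\sum_(1 <= m < M) 8 * `|th|)).
    by apply: ler_sum => m _; exact: w2.
  rewrite sumr_const_nat -[leLHS]mulr_natl; apply: ler_wpM2r; first by nonneg.
  by rewrite ler_nat leq_subr.
by rewrite le_eqVlt; apply/orP; left; apply/eqP; field; rewrite !gt_eqF.
Qed.

(** The term [h = q k] of the differenced sum, for [beta = q (2 t) - b], stripped of its linear
    phase in [k]. *)
Definition block (N q : nat) (beta : R) (k : nat) : R[i] :=
  e (k%:R ^+ 2 * (q%:R * beta / 2)) * geomsum (N - q * k) (k%:R * beta).

Lemma block_le (N q k : nat) (beta : R) : cabs (block N q beta k) <= N%:R.
Proof.
rewrite cabsM cabs_e mul1r; apply: le_trans (cabs_geomsum_le _ _) _.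
by rewrite ler_nat leq_subr.
Qed.

Lemma block_le_inv (N q k : nat) (beta : R) : k%:R * `|beta| <= 3 / 4 ->
  cabs (block N q beta k) * (k%:R * `|beta|) <= 2.
Proof.
move=> h; rewrite cabsM cabs_e mul1r.
have := @cabs_geomsum_dist (N - q * k) (k%:R * beta) 0; rewrite subr0 normrM ger0_norm //.
exact.
Qed.

(** Three things change from [k] to [k.+1]: the quadratic phase, where [block_le_inv] cancels
    [k |beta|] and leaves [24 q]; the frequency, for [32 N / k]; and the length, for [q]. *)
Lemma block_variation (N q k : nat) (beta : R) : (0 < k)%N -> (q * k.+1 <= N)%N ->
  k%:R * `|beta| <= 3 / 4 ->
  cabs (block N q beta k.+1 - block N q beta k) <= 25 * q%:R + 32 * N%:R / k%:R.
Proof.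
move=> k0 qkN hk; have kR : 1 <= k%:R :> R by rewrite ler1n.
set c := q%:R * beta / 2; set M := (N - q * k.+1)%N.
set V := geomsum (N - q * k) (k%:R * beta).
have -> : block N q beta k.+1 - block N q beta k =
    e (k.+1%:R ^+ 2 * c) * (geomsum M (k.+1%:R * beta) - V) + (e (k.+1%:R ^+ 2 * c) - e (k%:R ^+ 2 * c)) * V.
  by rewrite /block -/c -/M -/V; ring.
have h1 : cabs ((e (k.+1%:R ^+ 2 * c) - e (k%:R ^+ 2 * c)) * V) <= 24 * q%:R.
  rewrite cabsM cabs_eB; set d : R := k.+1%:R ^+ 2 * c - k%:R ^+ 2 * c.
  have dE : `|d| <= 3 / 2 * q%:R * (k%:R * `|beta|).
    have -> : d = (2 * k%:R + 1) / 2 * q%:R * beta.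
      by rewrite /d /c -[k.+1%:R]natr1; field.
    have p0 : 0 <= (2 * k%:R + 1) / 2 * q%:R :> R by nonneg.
    rewrite normrM (ger0_norm p0) [leRHS]mulrA; apply: ler_wpM2r => //.
    by rewrite [leRHS]mulrAC; apply: ler_wpM2r => //; lra.
  have hV := block_le_inv N q hk; rewrite /block cabsM cabs_e mul1r -/V in hV.
  apply: (@le_trans _ _ (8 * (3 / 2 * q%:R * (k%:R * `|beta|)) * cabs V)).
    apply: ler_wpM2r; first exact: cabs_ge0.
    by apply: le_trans (cabs_1Be_le _) _; apply: ler_wpM2l.
  rewrite (_ : _ * cabs V = 12 * q%:R * (cabs V * (k%:R * `|beta|))); last by field.
  rewrite (_ : 24 * q%:R = 12 * q%:R * 2); last by ring.
  by apply: ler_wpM2l => //; nonneg.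
have h2 : cabs (geomsum M (k.+1%:R * beta) - V) <= 32 * N%:R / k%:R + q%:R.
  have VE : V = geomsum M (k%:R * beta) + \sum_(M.+1 <= m < (N - q * k).+1) e (m%:R * (k%:R * beta)).
    rewrite /V /geomsum (@big_cat_nat _ _ _ M.+1) //=.
    by rewrite ltnS /M leq_sub2l // leq_mul2l leqnSn orbT.
  rewrite VE opprD addrA; apply: le_trans (cabsD _ _) _; apply: lerD.
    apply: le_trans (geomsum_variation _ k0 hk) _.
    by apply: ler_wpM2r; [rewrite invr_ge0|apply: ler_wpM2l => //; rewrite ler_nat leq_subr].
  rewrite cabsN; apply: le_trans (cabs_sum _ _ _) _.
  under eq_bigr do rewrite cabs_e.
  by rewrite sumr_const_nat subSS ler_nat /M mulnS; lia.
apply: le_trans (cabsD _ _) _; rewrite cabsM cabs_e mul1r.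
by apply: le_trans (lerD h2 h1) _; lra.
Qed.

(** The three bounds come from at most [N / q] blocks of size [N]; from blocks of size
    [2 / (k |beta|)]; and from summation by parts against [e (k phi)], where
    [116 = 2 (1 + 25 + 32)]. They control [q], the t-error and the x-error respectively. *)
Lemma sum_multiples_bounds (N q : nat) (beta phi : R) : (0 < q)%N -> (0 < N)%N ->
  4 * N%:R * `|beta| <= 1 ->
  let s := cabs (\sum_(1 <= k < (N.-1 %/ q).+1) e (k%:R * phi) * block N q beta k) in
  [/\ s * q%:R <= N%:R ^+ 2, s * `|beta| <= 2 * harmsum N &
      forall z : int, `|phi - z%:~R| <= 3 / 4 -> s * `|phi - z%:~R| <= 116 * N%:R * harmsum N].
Proof.
move=> q0 N0 hb; set J := (N.-1 %/ q)%N; cbv zeta.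
set s := cabs _.
have JN : (q * J < N)%N.
  by rewrite mulnC; apply: leq_ltn_trans (leq_trunc_div _ _) _; rewrite ltn_predL.
have JN' : (J <= N)%N by apply: ltnW; apply: leq_ltn_trans JN; rewrite leq_pmull.
have NR : 1 <= N%:R :> R by rewrite ler1n.
have H1 : 1 <= harmsum N by exact: harmsum_ge1.
have b0 : 0 <= `|beta| by [].
have H0 : 0 <= harmsum N by lra.
have kb k : (k <= J)%N -> k%:R * `|beta| <= 3 / 4.
  move=> kJ; have : k%:R * `|beta| <= N%:R * `|beta|.
    by apply: ler_wpM2r => //; rewrite ler_nat (leq_trans kJ).
  lra.
split.
- apply: (@le_trans _ _ ((\sum_(1 <= k < J.+1) N%:R) * q%:R)).
    apply: ler_wpM2r => //; apply: le_trans (cabs_sum _ _ _) _; apply: ler_sum => k _.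
    by rewrite cabsM cabs_e mul1r; exact: block_le.
  rewrite sumr_const_nat subSS subn0 -[X in X * _]mulr_natl -!natrM -natrX ler_nat.
  by rewrite mulnAC expnS expn1 leq_mul2r mulnC ltnW ?orbT.
- apply: (@le_trans _ _ ((\sum_(1 <= k < J.+1) 2 * k%:R^-1))).
    apply: (@le_trans _ _ ((\sum_(1 <= k < J.+1) cabs (block N q beta k)) * `|beta|)).
      apply: ler_wpM2r => //; apply: le_trans (cabs_sum _ _ _) _; apply: ler_sum => k _.
      by rewrite cabsM cabs_e mul1r.
    rewrite mulr_suml big_nat_cond [leRHS]big_nat_cond; apply: ler_sum => k /andP[/andP[k1 kJ] _].
    have kR : 0 < k%:R :> R by rewrite ltr0n.
    by rewrite ler_pdivlMr // mulrAC -mulrA; apply: block_le_inv; apply: kb.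
  rewrite -mulr_sumr; apply: ler_wpM2l => //; exact: harmsum_le.
move=> z hz; have [->|p0] := eqVneq `|phi - z%:~R| 0; first by rewrite mulr0; nonneg.
have {}p0 : 0 < `|phi - z%:~R| by rewrite lt_neqAle eq_sym p0 normr_ge0.
have hB j : cabs (\sum_(1 <= k < j.+1) e (k%:R * phi)) <= 2 / `|phi - z%:~R|.
  by rewrite ler_pdivlMr //; exact: cabs_geomsum_dist.
rewrite -ler_pdivlMr //.
apply: le_trans (@abel_summation (fun k => e (k%:R * phi)) (block N q beta) _ J (fun j _ => hB j)) _.
have hv : \sum_(1 <= k < J) cabs (block N q beta k.+1 - block N q beta k) <=
    25 * N%:R + 32 * N%:R * harmsum N.
  apply: (@le_trans _ _ (\sum_(1 <= k < J) (25 * q%:R + 32 * N%:R * k%:R^-1))).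
    rewrite big_nat_cond [leRHS]big_nat_cond; apply: ler_sum => k /andP[/andP[k1 kJ] _].
    apply: block_variation => //; last by apply: kb; exact: ltnW.
    by apply: ltnW; apply: leq_ltn_trans JN; rewrite leq_mul2l kJ orbT.
  rewrite big_split /=; apply: lerD.
    rewrite sumr_const_nat -[leLHS]mulr_natl mulrCA; apply: ler_wpM2l => //.
    rewrite -natrM ler_nat mulnC; apply: ltnW; apply: leq_ltn_trans JN.
    by rewrite leq_mul2l leq_subr orbT.
  rewrite -mulr_sumr; apply: ler_wpM2l; first by nonneg.
  apply: (@le_trans _ _ (harmsum J.-1)).
    by case: (J) => [|J']; rewrite /harmsum // !big_geq.
  by apply: harmsum_le; apply: leq_trans (leq_pred _) _.
have hN := block_le N q J beta.
apply: (@le_trans _ _ (2 / `|phi - z%:~R| * (N%:R + (25 * N%:R + 32 * N%:R * harmsum N)))).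
  by apply: ler_wpM2l; [nonneg|exact: lerD].
rewrite mulrAC; apply: ler_wpM2r; first by nonneg.
have : N%:R <= N%:R * harmsum N by rewrite ler_peMr.
lra.
Qed.

(** * Rational approximation where the kernel is large *)

(** Pigeonhole for the fractional parts of [j T], [0 <= j <= M], in [M] boxes; dividing by the gcd
    afterwards reduces the fraction and does not increase the error. *)
Lemma dirichlet (T : R) (M : nat) : (0 < M)%N ->
  exists (q : nat) (b : int), [/\ (0 < q)%N, (q <= M)%N, coprime `|b|%N q &
    M%:R * `|q%:R * T - b%:~R| <= 1].
Proof.
move=> M0; have MR : 0 < M%:R :> R by rewrite ltr0n.
suff [q [b [q0 qM h]]] : exists (q : nat) (b : int), [/\ (0 < q)%N, (q <= M)%N &
    M%:R * `|q%:R * T - b%:~R| <= 1].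
  pose g := gcdn `|b| q; have g0 : (0 < g)%N by rewrite gcdn_gt0 q0 orbT.
  have qE : (q = (q %/ g) * g)%N by rewrite divnK // dvdn_gcdr.
  have bE : b = (b %/ g%:Z)%Z * g%:Z by rewrite divzK // dvdzE; exact: dvdn_gcdl.
  have gR : 1 <= g%:R :> R by rewrite ler1n.
  exists (q %/ g)%N, (b %/ g%:Z)%Z; split.
  - by rewrite divn_gt0 // dvdn_leq // dvdn_gcdr.
  - exact: leq_trans (leq_div _ _) qM.
  - by rewrite absz_divz_dvd ?dvdn_gcdl //; exact: coprime_quotients.
  - apply: le_trans h; apply: ler_wpM2l; first exact: ltW.
    rewrite [in leRHS]qE [in leRHS]bE natrM intrM -pmulrn mulrAC -mulrBl normrM.
    by rewrite [X in _ <= _ * X]ger0_norm // ler_peMr.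
pose fr (j : nat) : R := j%:R * T - (Num.floor (j%:R * T))%:~R.
have fr0 j : 0 <= fr j < 1.
  have /andP[h1 h2] := floor_itv (j%:R * T).
  by rewrite /fr; apply/andP; split; [lra|move: h2; rewrite intrD; lra].
have lt j : (Num.truncn (M%:R * fr j) < M)%N.
  have /andP[h1 h2] := fr0 j.
  rewrite -(ltr_nat R); apply: (@le_lt_trans _ _ (M%:R * fr j)).
    by have /andP[] : (Num.truncn (M%:R * fr j))%:R <= M%:R * fr j < (Num.truncn (M%:R * fr j)).+1%:R
      by apply: truncn_itv; rewrite mulr_ge0.
  by rewrite -[ltRHS]mulr1 ltr_pM2l.
pose F (j : 'I_M.+1) : 'I_M := Ordinal (lt j).
have /injectivePn[j [j' jj' FE]] : ~~ injectiveb F.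
  apply/negP => /injectiveP /leq_card; rewrite !card_ord ltnn //.
wlog jlt : j j' jj' FE / (j < j')%N.
  move=> H; case: (ltngtP j j') => [h|h|/val_inj h]; first exact: (H j j').
    by apply: (H j' j) => //; rewrite eq_sym.
  by rewrite h eqxx in jj'.
exists (j' - j)%N, (Num.floor ((j' : nat)%:R * T) - Num.floor ((j : nat)%:R * T)); split.
- by rewrite subn_gt0.
- by apply: leq_trans (leq_subr _ _) _; rewrite -ltnS.
rewrite (_ : _ - _ = fr j' - fr j); last first.
  by rewrite /fr natrB ?(ltnW jlt) // intrB; ring.
rewrite -{1}(gtr0_norm MR) -normrM mulrBr.
have tr (i : 'I_M.+1) : (Num.truncn (M%:R * fr i))%:R <= M%:R * fr i < (Num.truncn (M%:R * fr i)).+1%:R.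
  by apply: truncn_itv; rewrite mulr_ge0 //; have /andP[] := fr0 i.
have := tr j; have := tr j'; have -> : Num.truncn (M%:R * fr j') = Num.truncn (M%:R * fr j).
  by have := congr1 val FE.
move=> /andP[h1 h2] /andP[h3 h4]; move: h2 h4; rewrite -natr1 => h2 h4.
by rewrite ler_norml; apply/andP; split; lra.
Qed.

Lemma differenced_sum (N h : nat) x t :
  \sum_(1 <= m < (N - h).+1) e ((m + h)%:R * x + (m + h)%:R ^+ 2 * t) * (e (m%:R * x + m%:R ^+ 2 * t))^* =
  e (h%:R * x + h%:R ^+ 2 * t) * geomsum (N - h) (h%:R * (2 * t)).
Proof.
rewrite mulr_sumr; apply: eq_bigr => m _; rewrite e_conj -!eD; congr e.
by rewrite natrD; ring.
Qed.

(** [2 q t = beta + b] splits [(q k)^2 t] into [k^2 q beta / 2] and [q b k^2 / 2]; since [k^2] is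
    [k] plus an even number, the latter is linear in [k] modulo 1 and joins the phase. *)
Lemma differenced_sum_multiple (N q k : nat) x t (b : int) :
  e ((q * k)%:R * x + (q * k)%:R ^+ 2 * t) * geomsum (N - q * k) ((q * k)%:R * (2 * t)) =
  e (k%:R * ((q%:R * (2 * x) + q%:R * b%:~R) / 2)) * block N q (q%:R * (2 * t) - b%:~R) k.
Proof.
rewrite /block [RHS]mulrA -eD.
rewrite -(@geomsum_int _ _ (k%:Z * b)).
have -> : (q * k)%:R * (2 * t) - (k%:Z * b)%:~R = k%:R * (q%:R * (2 * t) - b%:~R) :> R.
  by rewrite natrM intrM -pmulrn; ring.
congr (_ * _); rewrite -[RHS](@eBint _ (- (q%:Z * b * ('C(k, 2))%:Z))); congr e.
have kk : k%:R ^+ 2 = k%:R + 2 * ('C(k, 2))%:R :> R.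
  rewrite -natrX -natrM -natrD; congr (_%:R).
  by elim: (k) => // k' IH; rewrite binS bin1; move: IH; rewrite -!mulnn; nia.
by rewrite mulrNz !intrM -!pmulrn natrM [(_ * _) ^+ 2]exprMn kk; field.
Qed.

(** Dirichlet's theorem is used with bound [4 N], so that [N |beta| <= 1/4]. The diagonal and the
    nonmultiples of [q] contribute at most [97 N H], at most half of [k^2], so [k^2] is at most four
    times the sum over multiples of [q], to which the three bounds apply. *)
Lemma weyl_structure (N : nat) (x t S : R) : (0 < N)%N -> 2 ^+ 10 * harmsum (4 * N) <= S ->
  let k := cabs (\sum_(1 <= n < N.+1) e (n%:R * x + n%:R ^+ 2 * t)) in
  S * N%:R <= k ^+ 2 ->
  exists (q : nat) (b a : int), [/\ (0 < q)%N /\ coprime `|b|%N q,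
    q%:R * k ^+ 2 <= S * N%:R ^+ 2, `|q%:R * (2 * t) - b%:~R| * k ^+ 2 <= S &
    `|q%:R * (2 * x) - a%:~R| * k ^+ 2 <= S * N%:R].
Proof.
move=> N0 HS k hk; set H := harmsum (4 * N) in HS.
have NR : 1 <= N%:R :> R by rewrite ler1n.
have N4 : (0 < 4 * N)%N by rewrite muln_gt0.
have H1 : 1 <= H by exact: harmsum_ge1.
have [q [b [q0 qN cb hq]]] := dirichlet (2 * t) N4.
set beta := q%:R * (2 * t) - b%:~R in hq.
pose phi := (q%:R * (2 * x) + q%:R * b%:~R) / 2.
have hb : 4 * N%:R * `|beta| <= 1 by rewrite -natrM.
have := sum_multiples_bounds phi q0 N0 hb; set s := cabs _ => -[s1 s2 s3].
pose Y h := e (h%:R * x + h%:R ^+ 2 * t) * geomsum (N - h) (h%:R * (2 * t)).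
have kle : k ^+ 2 <= N%:R + 2 * (48 * N%:R * H + s).
  have := cabs_sum_sqr_le (fun n => e (n%:R * x + n%:R ^+ 2 * t)) N; rewrite -/k.
  under eq_bigr do rewrite cabs_e expr1n.
  rewrite sumr_const_nat subSS subn0.
  under [X in 2 * cabs X]eq_bigr do rewrite differenced_sum -/(Y _).
  move/le_trans; apply; rewrite lerD2l; apply: ler_wpM2l => //.
  rewrite (bigID (fun h => ~~ (q %| h)%N)) /=; apply: le_trans (cabsD _ _) _; apply: lerD.
    apply: le_trans (cabs_sum _ _ _) _.
    under eq_bigr do rewrite /Y cabsM cabs_e mul1r.
    apply: le_trans (sum_nonmultiples (fun h => (N - h)%N) q0 qN cb _) _.
      by rewrite -/beta; lra.
    by apply: ler_wpM2l; [nonneg|exact: harmsum_le].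
  under eq_bigl do rewrite negbK.
  rewrite -[X in \sum_(1 <= i < X | _) _](prednK N0) sum_multiples //.
  under eq_bigr do rewrite /Y (differenced_sum_multiple _ _ _ _ _ b) -/beta -/phi.
  by rewrite -/s.
have HN : harmsum N <= H by apply: harmsum_le; rewrite leq_pmull.
have NH0 : 0 <= N%:R * H by rewrite mulr_ge0 //; lra.
have NHS : 194 * (N%:R * H) <= S * N%:R.
  apply: (@le_trans _ _ (2 ^+ 10 * H * N%:R)); last by apply: ler_wpM2r.
  rewrite (_ : 2 ^+ 10 * H * N%:R = 2 ^+ 10 * (N%:R * H)); last by ring.
  by apply: ler_wpM2r => //; rewrite -natrX ler_nat.
have ks : k ^+ 2 <= 4 * s.
  have : N%:R <= N%:R * H by rewrite ler_peMr.
  lra.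
have S8 : 8 * H <= S.
  by apply: le_trans HS; apply: ler_wpM2r; [lra|rewrite -natrX ler_nat].
have S928 : 928 * H <= S.
  by apply: le_trans HS; apply: ler_wpM2r; [lra|rewrite -natrX ler_nat].
(* An integer nearest to [phi]. *)
pose z := Num.floor (phi + 1 / 2).
have hz : `|phi - z%:~R| <= 1 / 2.
  have /andP[z1 z2] := floor_itv (phi + 1 / 2); rewrite -/z in z1 z2.
  by move: z2; rewrite intrD ler_norml => z2; apply/andP; split; lra.
have s3z : s * `|phi - z%:~R| <= 116 * N%:R * harmsum N by apply: s3; lra.
(* [2 phi = q (2 x) + q b]. Approximating [2 x] in place of [x] keeps the numerator integral
   whatever the parity of [q b]. *)
exists q, b, (2 * z - q%:Z * b); split => //.
- apply: (@le_trans _ _ (q%:R * (4 * s))); first by apply: ler_wpM2l.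
  apply: (@le_trans _ _ (4 * N%:R ^+ 2)); first by rewrite mulrCA [q%:R * s]mulrC; apply: ler_wpM2l.
  by apply: ler_wpM2r; [nonneg|lra].
- apply: (@le_trans _ _ (`|beta| * (4 * s))); first by apply: ler_wpM2l.
  apply: le_trans S8; lra.
have -> : q%:R * (2 * x) - (2 * z - q%:Z * b)%:~R = 2 * (phi - z%:~R).
  by rewrite /phi intrB !intrM -!pmulrn; field.
rewrite normrM (ger0_norm (ler0n R 2)).
apply: (@le_trans _ _ (2 * `|phi - z%:~R| * (4 * s))); first by apply: ler_wpM2l => //; nonneg.
apply: (@le_trans _ _ (928 * H * N%:R)); last by apply: ler_wpM2r.
have : N%:R * harmsum N <= N%:R * H by apply: ler_wpM2l.
lra.
Qed.

End Exponentials.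

(** * Divisor and logarithm bounds *)

Lemma bernoulli_ineq (R : realType) (x : R) (n : nat) : 0 <= x -> 1 + n%:R * x <= (1 + x) ^+ n.
Proof.
move=> x0; elim: n => [|n IH]; first by rewrite mul0r addr0 expr0.
rewrite exprS; apply: (@le_trans _ _ ((1 + x) * (1 + n%:R * x))); last first.
  by apply: ler_wpM2l => //; lra.
have h : 0 <= n%:R * x ^+ 2 by rewrite mulr_ge0 // sqr_ge0.
rewrite -natr1 (_ : (1 + x) * _ = 1 + (n%:R + 1) * x + n%:R * x ^+ 2); last by ring.
by rewrite lerDl.
Qed.

Lemma powR2_gt1 (R : realType) (eps : R) : 0 < eps -> 1 < 2 `^ eps.
Proof.
move=> e0; rewrite ltNge; apply/negP => h.
have h0 : 0 < 2 `^ eps :> R by exact: powR_gt0.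
have := le_ln_pos h0 h; rewrite ln_powR ln1 => h1.
have : 0 < eps * ln 2 by rewrite mulr_gt0 // ln_gt0 // ltr1n.
by rewrite ltNge h1.
Qed.

Lemma powR_natX (R : realType) (p a : nat) (eps : R) : (p ^ a)%:R `^ eps = (p%:R `^ eps) ^+ a.
Proof.
elim: a => [|a IH]; first by rewrite expn0 expr0 powR1.
by rewrite expnS natrM powRM // IH exprS.
Qed.

Lemma size_divisors_le (p m : nat) : prime p -> (0 < m)%N ->
  exists m' : nat, [/\ (0 < m')%N, m = (m' * p ^ logn p m)%N, coprime p m' &
    (size (divisors m) <= (logn p m).+1 * size (divisors m'))%N].
Proof.
move=> pp m0; have [m' cpm' mE] := pfactor_coprime pp m0.
set a := logn p m in mE.
have m'0 : (0 < m')%N by move: m0; rewrite mE muln_gt0 => /andP[].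
exists m'; split => //.
rewrite -[X in (X * _)%N](size_iota 0) -(size_allpairs (fun i d => p ^ i * d)%N).
apply: uniq_leq_size => [|d]; first exact: divisors_uniq.
rewrite -dvdn_divisors // => dm.
have d0 : (0 < d)%N := dvdn_gt0 m0 dm.
have [d' cpd' dE] := pfactor_coprime pp d0.
apply/allpairsP; exists (logn p d, d'); split => /=.
- by rewrite -[_ :: _]/(iota 0 (logn p m).+1) mem_iota add0n ltnS; exact: dvdn_leq_log.
- rewrite -dvdn_divisors // -(@Gauss_dvdl d' m' (p ^ a)).
    by rewrite -mE; apply: dvdn_trans dm; rewrite dE dvdn_mulr.
  by rewrite coprime_sym coprimeXl.
- by rewrite mulnC.
Qed.

(** Primes are removed in increasing order. From [P] on, [p^eps >= 2] and
    [a + 1 <= 2^a <= p^(a eps)]; a smaller prime costs the factor [c], because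
    [a + 1 <= c (1 + a x) <= c 2^(a eps)] with [x = 2^eps - 1]. *)
Lemma divisor_bound (R : realType) (eps : R) : 0 < eps ->
  exists C : R, 0 < C /\ forall m : nat, (0 < m)%N -> (size (divisors m))%:R <= C * m%:R `^ eps.
Proof.
move=> eps0; pose x := 2 `^ eps - 1 : R.
have x0 : 0 < x by rewrite subr_gt0 powR2_gt1.
pose c := 1 + x^-1.
have c1 : 1 <= c by rewrite lerDl invr_ge0 ltW.
have [P hP] : exists P : nat, forall p : nat, (P <= p)%N -> 2 <= p%:R `^ eps :> R.
  exists (Num.truncn (2 `^ eps^-1 : R)).+1 => p hp.
  have h0 : 0 <= 2 `^ eps^-1 :> R by exact: powR_ge0.
  have /andP[_ h1] := truncn_itv h0.
  have h2 : 2 `^ eps^-1 <= p%:R :> R by apply: (le_trans (ltW h1)); rewrite ler_nat.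
  have := ge0_ler_powR (ltW eps0); move=> /(_ (2 `^ eps^-1) p%:R).
  rewrite !nnegrE h0 ler0n => /(_ isT isT h2).
  by rewrite -powRrM mulVf ?gt_eqF // powRr1.
(* [n] bounds the remaining prime factors from below, so at most [P - n] small primes are still to
   come. *)
have main (n m : nat) : (0 < m)%N -> (forall p, prime p -> (p %| m)%N -> (n <= p)%N) ->
    (size (divisors m))%:R <= c ^+ (P - n) * m%:R `^ eps.
  have [k mk] := ubnP m; elim: k m n mk => // k IH m n; rewrite ltnS => mk m0 hn.
  have [m1|m1] := leqP m 1.
    have -> : m = 1%N by lia.
    by rewrite powR1 mulr1 exprn_ege1.
  have pp := pdiv_prime m1; set p := pdiv m in pp.
  have [m' [m'0 mE cpm' sz]] := size_divisors_le pp m0.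
  set a := logn p m in mE sz.
  have a0 : (0 < a)%N by rewrite logn_gt0 mem_primes pp m0 pdiv_dvd.
  have p2 := prime_gt1 pp.
  have m'm : (m' < m)%N.
    rewrite mE -[X in (X < _)%N]muln1 ltn_pmul2l //.
    by rewrite -(expn0 p) ltn_exp2l.
  have hn' : forall p', prime p' -> (p' %| m')%N -> (p.+1 <= p')%N.
    move=> p' pp' dp'; rewrite ltn_neqAle; apply/andP; split.
      apply: contraTneq dp' => <-; move: cpm'; rewrite prime_coprime //.
    by apply: pdiv_min_dvd; [exact: prime_gt1|rewrite mE dvdn_mulr].
  have := IH m' p.+1 (leq_trans m'm mk) m'0 hn' => h.
  have np : (n <= p)%N by apply: hn => //; exact: pdiv_dvd.
  have u0 : 0 <= p%:R `^ eps :> R by exact: powR_ge0.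
  have u1 : 2 `^ eps <= p%:R `^ eps :> R.
    by apply: (ge0_ler_powR (ltW eps0)); rewrite ?nnegrE // ler_nat.
  apply: (@le_trans _ _ (a.+1%:R * (c ^+ (P - p.+1) * m'%:R `^ eps))).
    by apply: (@le_trans _ _ (a.+1 * size (divisors m'))%:R); [rewrite ler_nat|rewrite natrM; apply: ler_wpM2l].
  rewrite mE natrM powRM // powR_natX.
  have m'e : 0 <= m'%:R `^ eps :> R by exact: powR_ge0.
  rewrite mulrCA [leRHS]mulrCA [leRHS](_ : _ = m'%:R `^ eps * (c ^+ (P - n) * (p%:R `^ eps) ^+ a)) // [leLHS](_ : _ = m'%:R `^ eps * (c ^+ (P - p.+1) * a.+1%:R)); last by ring.
  apply: ler_wpM2l => //.
  have [Pp|Pp] := leqP P p.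
    have -> : (P - p.+1 = 0)%N by lia.
    rewrite expr0 mul1r; apply: (@le_trans _ _ ((p%:R `^ eps) ^+ a)); last first.
      by rewrite ler_peMl ?exprn_ge0 // exprn_ege1.
    apply: (@le_trans _ _ (2 ^+ a)).
      by have := @bernoulli_ineq R 1 a ler01; rewrite mulr1 -natr1 addrC.
    by rewrite lerXn2r // ?nnegrE // hP.
  apply: (@le_trans _ _ (c ^+ (P - p) * (p%:R `^ eps) ^+ a)); last first.
    by apply: ler_wpM2r; [exact: exprn_ge0|rewrite ler_weXn2l // leq_sub2l].
  have -> : (P - p = (P - p.+1).+1)%N by lia.
  rewrite exprSr -mulrA; apply: ler_wpM2l; first by rewrite exprn_ge0 //; lra.
  apply: (@le_trans _ _ (c * (1 + a%:R * x))).
    have -> : c * (1 + a%:R * x) = c + a%:R * (x + 1) by rewrite /c; field; rewrite gt_eqF.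
    have : 0 <= a%:R * x :> R by rewrite mulr_ge0 // ltW.
    rewrite -natr1; lra.
  apply: ler_wpM2l; first by lra.
  apply: le_trans (bernoulli_ineq a (ltW x0)) _.
  have -> : 1 + x = 2 `^ eps by rewrite /x addrC subrK.
  by rewrite lerXn2r ?nnegrE ?powR_ge0.
exists (c ^+ P); split; first by rewrite exprn_gt0 //; lra.
by move=> m m0; have := main 0%N m m0 (fun _ _ _ => leq0n _); rewrite subn0.
Qed.

Lemma harmsum_dyadic (R : realType) (j : nat) : harmsum R (2 ^ j) <= j.+1%:R.
Proof.
elim: j => [|j IH].
  by rewrite /harmsum expn0 big_nat1 invr1.
rewrite /harmsum (@big_cat_nat _ _ _ (2 ^ j).+1) //=; last by rewrite ltnS leq_exp2l.
rewrite -natr1; apply: lerD => //.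
apply: (@le_trans _ _ (\sum_((2 ^ j).+1 <= k < (2 ^ j.+1).+1) ((2 ^ j)%:R^-1 : R))).
  rewrite big_nat_cond [leRHS]big_nat_cond; apply: ler_sum => k /andP[/andP[k1 _] _].
  by rewrite lef_pV2 ?posrE ?ltr0n ?expn_gt0 ?ler_nat ?(ltnW k1) // (leq_ltn_trans _ k1).
by rewrite sumr_const_nat subSS expnS mul2n -addnn addnK -[leLHS]mulr_natl divff.
Qed.

Lemma powR_nat_ge1 (R : realType) (N : nat) (eps : R) : (0 < N)%N -> 0 < eps -> 1 <= N%:R `^ eps.
Proof.
move=> N0 e0; apply: (@le_trans _ _ (1 `^ eps)); first by rewrite powR1.
by apply: (ge0_ler_powR (ltW e0)); rewrite ?nnegrE // ler1n.
Qed.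

(** If [2^t <= N^2] and [x = 2^(eps/2) - 1], Bernoulli's inequality gives
    [1 + t x <= 2^(t eps / 2) <= N^eps]. *)
Lemma log_bound (R : realType) (eps : R) : 0 < eps -> exists C : R, 0 < C /\
  forall N : nat, (0 < N)%N -> exists L : nat, [/\ (N ^ 2 < 2 ^ L)%N, (4 * N <= 2 ^ L)%N &
    L.+1%:R <= C * N%:R `^ eps].
Proof.
move=> e0; pose x := 2 `^ (eps / 2) - 1 : R.
have x0 : 0 < x by rewrite subr_gt0 powR2_gt1 // divr_gt0.
exists (x^-1 + 4); split => [|N N0]; first by rewrite addr_gt0 ?invr_gt0.
have N20 : (0 < N ^ 2)%N by rewrite expn_gt0 N0.
set t := trunc_log 2 (N ^ 2).
have t1 : (2 ^ t <= N ^ 2)%N by exact: trunc_logP.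
have t2 : (N ^ 2 < 2 ^ t.+1)%N by exact: trunc_log_ltn.
have NN : (N <= N ^ 2)%N by rewrite expnS expn1 leq_pmulr.
have u1 : 1 <= N%:R `^ eps :> R by exact: powR_nat_ge1.
exists t.+3; split.
- by apply: leq_trans t2 _; rewrite leq_exp2l //; lia.
- apply: (@leq_trans (4 * 2 ^ t.+1)); first by rewrite leq_mul2l (leq_trans NN (ltnW t2)) orbT.
  by rewrite -[4%N]/(2 ^ 2)%N -expnD leq_exp2l //; lia.
have h : 1 + t%:R * x <= N%:R `^ eps.
  apply: le_trans (bernoulli_ineq t (ltW x0)) _; have -> : 1 + x = 2 `^ (eps / 2) by rewrite /x addrC subrK.
  rewrite -powR_natX; apply: (@le_trans _ _ ((N ^ 2)%:R `^ (eps / 2))).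
    apply: ge0_ler_powR; rewrite ?nnegrE //; last by rewrite ler_nat.
    by rewrite divr_ge0 // ltW.
  rewrite natrX -powR_mulrn // -powRrM mulrC divfK //.
have tx : t%:R <= N%:R `^ eps / x :> R by rewrite ler_pdivlMr //; lra.
rewrite -[t.+4]addn4 natrD mulrDl; apply: lerD; first by rewrite mulrC.
by rewrite ler_peMr.
Qed.

(** * Measure of the level set *)

(** Monotonicity is taken from the outer measure underlying [lebesgue_measure], so that it applies
    to the level set without a proof of measurability. *)
Lemma lebesgue_measure_le (R : realType) (A B : set R) : (A `<=` B)%classic ->
  (lebesgue_measure A <= lebesgue_measure B)%E.
Proof.
move=> AB; rewrite /lebesgue_measure /lebesgue_stieltjes_measure /measure_extension.
exact: (@le_mu_ext _ _ _ (wlength idfun) A B AB).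
Qed.

(** There are [N.+1] cells because the point 1 falls in the cell of index [N]. *)
Lemma lebesgue_measure_cells (R : realType) (A : set R) (N : nat) (P : pred 'I_N.+1) :
  (0 < N)%N -> (forall x, A x -> 0 <= x <= 1) ->
  (forall (j : 'I_N.+1) x, A x -> (j : nat)%:R <= N%:R * x < j.+1%:R -> P j) ->
  (lebesgue_measure A <= (#|P|%:R / N%:R)%:E)%E.
Proof.
move=> N0 A01 hP; have NR : 0 < N%:R :> R by rewrite ltr0n.
pose cell (j : nat) : set R := (`[(j%:R / N%:R), (j.+1%:R / N%:R)])%classic.
pose F (j : nat) : set R := if [pick i : 'I_N.+1 | (i == j :> nat) && P i] is Some _ then cell j else set0.
apply: (@le_trans _ _ (lebesgue_measure (\big[setU/set0]_(j < N.+1) F j))%classic).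
  apply: lebesgue_measure_le => x Ax; have /andP[x0 x1] := A01 x Ax.
  have Nx0 : 0 <= N%:R * x by rewrite mulr_ge0 // ltW.
  have /andP[t1 t2] := truncn_itv Nx0.
  have jN : (Num.truncn (N%:R * x) < N.+1)%N.
    rewrite ltnS -(ler_nat R); apply: le_trans t1 _; rewrite ler_piMr // ltW //.
  have Pj : P (Ordinal jN) by apply: (hP _ x Ax); rewrite /= t1 t2.
  rewrite -bigcup_mkord; exists (Num.truncn (N%:R * x)) => //=.
  rewrite /F; case: pickP => [i _|/(_ (Ordinal jN))]; last by rewrite /= eqxx Pj.
  set k := Num.truncn _ in t1 t2 *.
  suff H : x \in `[(k%:R / N%:R), (k.+1%:R / N%:R)]. by exact: H.
  rewrite in_itv /= ler_pdivrMr // ler_pdivlMr //.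
  by rewrite [x * _]mulrC t1 ltW.
apply: (@le_trans _ _ (\sum_(j < N.+1) lebesgue_measure (F j))%E).
  exact: (outer_measure_subadditive (mu_ext _)).
apply: (@le_trans _ _ (\sum_(j < N.+1) ((P j)%:R / N%:R)%:E)%E).
  apply: lee_sum => j _; rewrite /F; case: pickP => [i /andP[/eqP /val_inj -> ->]|_].
    rewrite /cell lebesgue_measure_itv /= lte_fin ltr_pM2r ?invr_gt0 // ltr_nat ltnSn.
    by rewrite -EFinB lee_fin -mulrBl -natrB // subSnn.
  by rewrite measure0 lee_fin divr_ge0.
rewrite sumEFin lee_fin -mulr_suml; apply: ler_wpM2r; first by rewrite invr_ge0 ltW.
by rewrite -natr_sum ler_nat -sum1_card [leqRHS]big_mkcond /=; apply: leq_sum => j _; rewrite unfold_in; case: (P j).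
Qed.

(** Halving [lam] avoids the question whether the supremum is attained. *)
Lemma levelset_point (R : realType) (N : nat) (a : nat -> R[i]) (lam x : R) :
  0 < lam -> levelset N a lam x -> exists t, lam / 2 <= cabs (expsum N a x t).
Proof.
move=> lam0 [_ h]; have h2 : ((lam / 2)%:E < maxexpsum N a x)%E.
  by apply: lt_le_trans h; rewrite lte_fin; lra.
have [_ [t _ <-]] := ereal_sup_gt h2; rewrite lte_fin => ht.
by exists t; exact: ltW.
Qed.

Lemma levelset_measure_large (R : realType) (N L : nat) (a : nat -> R[i]) (lam S : R) :
  (0 < N)%N -> \sum_(1 <= n < N.+1) cabs (a n) ^+ 2 = 1 -> 0 < lam ->
  2 ^+ 32 <= S -> S ^+ 20 <= N%:R -> N%:R ^+ 7 <= lam ^+ 20 * S ^+ 20 ->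
  (forall m : nat, (0 < m)%N -> (m <= N ^ 2)%N -> (size (divisors m))%:R <= S) ->
  (N ^ 2 < 2 ^ L)%N -> (4 * N <= 2 ^ L)%N -> 2 ^+ 10 * L.+1%:R <= S ->
  (lebesgue_measure (levelset N a lam) <= (S ^+ 41 * (N%:R / lam ^+ 4))%:E)%E.
Proof.
move=> N0 a1 lam0 S32 SN N7 hdiv N2L N4L LS.
have NR : 0 < N%:R :> R by rewrite ltr0n.
have two0 : 0 < 2 :> R by [].
have S0 : 0 < S by apply: lt_le_trans S32; positive.
(* [2 mu = (lam / 2)^2] is what duality gives per pair of points. The constants [2^30] in [mu^10]
   and [2^6] in [mu^2] are each absorbed by one extra factor [S]. *)
pose mu := lam ^+ 2 / 2 ^+ 3.
have mu0 : 0 < mu by rewrite /mu; positive.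
have N7' : N%:R ^+ 7 <= mu ^+ 10 * S ^+ 21.
  have -> : mu ^+ 10 * S ^+ 21 = lam ^+ 20 * S ^+ 20 * (S / 2 ^+ 30) by rewrite /mu; field.
  apply: (le_trans N7); rewrite ler_peMr //; first by nonneg.
  rewrite ler_pdivlMr ?mul1r; last by positive.
  by apply: le_trans S32; rewrite ler_weXn2l // ler1n.
pose P (j : 'I_N.+1) := `[< exists x, levelset N a lam x /\ (j : nat)%:R <= N%:R * x < j.+1%:R >].
have mes : (lebesgue_measure (levelset N a lam) <= (#|P|%:R / N%:R)%:E)%E.
  apply: lebesgue_measure_cells => // [x [] //|j x hx hj].
  by apply/asboolP; exists x.
have /choice[xt hxt] : forall j : {j | P j}, exists xt : R * R,
    [/\ 0 <= xt.1 <= 1, (val j : nat)%:R <= N%:R * xt.1 < (val j).+1%:R &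
        lam / 2 <= cabs (expsum N a xt.1 xt.2)].
  move=> [j /= /asboolP[x [hx hj]]]; have [t ht] := levelset_point lam0 hx.
  by exists (x, t); split => //; case: hx.
pose x j := (xt j).1; pose t j := (xt j).2.
pose g j n := e (n%:R * x j + n%:R ^+ 2 * t j).
pose kk i j := cabs (\sum_(1 <= n < N.+1) e (n%:R * (x i - x j) + n%:R ^+ 2 * (t i - t j))).
have dual (A : {set {j | P j}}) : 2 * mu * #|A|%:R ^+ 2 <= \sum_(i in A) \sum_(j in A) kk i j.
  have := @sqr_sum_le R _ A (fun j => expsum N a (x j) (t j)) N a g a1 (fun _ _ => erefl).
  have -> : \sum_(i in A) \sum_(j in A) cabs (\sum_(1 <= n < N.+1) g i n * (g j n)^*) =
      \sum_(i in A) \sum_(j in A) kk i j.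
    apply: eq_bigr => i _; apply: eq_bigr => j _; congr cabs; apply: eq_bigr => n _.
    by rewrite /g e_conj -eD; congr e; ring.
  apply: le_trans.
  have h : #|A|%:R * (lam / 2) <= \sum_(j in A) cabs (expsum N a (x j) (t j)).
    rewrite mulr_natl -sumr_const; apply: ler_sum => j _.
    by have [] := hxt j.
  rewrite (_ : 2 * mu * #|A|%:R ^+ 2 = (#|A|%:R * (lam / 2)) ^+ 2); last by rewrite /mu; field.
  rewrite lerXn2r // nnegrE; first by nonneg.
  by apply: le_trans h; nonneg.
have HS : 2 ^+ 10 * harmsum R (4 * N) <= S.
  apply: le_trans LS; apply: ler_wpM2l; first by nonneg.
  by apply: le_trans (harmsum_dyadic R L); exact: harmsum_le.
have SNmu := large_threshold_sqr S32 SN N7' mu0.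
have /choice[d hd] : forall ij : {j | P j} * {j | P j}, exists d : nat * int * int,
    mu <= kk ij.1 ij.2 ->
    [/\ (0 < d.1.1)%N /\ coprime `|d.1.2|%N d.1.1, d.1.1%:R * kk ij.1 ij.2 ^+ 2 <= S * N%:R ^+ 2,
      `|d.1.1%:R * (2 * t ij.1 - 2 * t ij.2) - d.1.2%:~R| * kk ij.1 ij.2 ^+ 2 <= S &
      `|d.1.1%:R * (2 * x ij.1 - 2 * x ij.2) - d.2%:~R| * kk ij.1 ij.2 ^+ 2 <= S * N%:R].
  move=> [i j] /=; have [h|h] := boolP (mu <= kk i j); last by exists (0%N, 0, 0).
  have k2 : S * N%:R <= kk i j ^+ 2.
    apply: le_trans (le_sqr_pos mu0 h); apply: le_trans SNmu.
    by rewrite ler_peMl ?ler1n //; nonneg.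
  have [q [b [c [h1 h2 h3 h4]]]] := weyl_structure N0 HS k2.
  by exists (q, b, c) => _; rewrite -!mulrBr; split.
have hX (i j : {j | P j}) : `|2 * x i - 2 * x j| <= 2.
  have [/andP[? ?] _ _] := hxt i; have [/andP[? ?] _ _] := hxt j.
  by rewrite ler_norml /x; apply/andP; split; lra.
have hsep (c l : R) : 0 <= l -> #|[set j | `|2 * x j - c| <= l]|%:R <= N%:R * l + 2.
  move=> l0; set A := [set j | _].
  apply: (@le_trans _ _ (size [seq val j | j in A])%:R); first by rewrite size_map -cardE.
  (* [N x j] lies in [[j, j + 1)], so the index [j] is within [N l / 2 + 1/2] of [N c / 2 - 1/2]. *)
  apply: (@le_trans _ _ (2 * (N%:R * l / 2 + 1 / 2) / 1 + 1)); last by lra.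
  apply: (@spaced_size R _ _ (fun j : 'I_N.+1 => (j : nat)%:R) (N%:R * c / 2 - 1 / 2)) => //.
  - have ? : 0 <= N%:R * l by nonneg.
    lra.
  - by rewrite map_inj_uniq ?enum_uniq //; exact: val_inj.
  - move=> i j _ _ ij; have := @ge1_intr_norm R ((i : nat)%:Z - (j : nat)%:Z).
    by rewrite intrB -!pmulrn; apply; rewrite subr_eq0 eqz_nat.
  - move=> k /mapP[j]; rewrite mem_enum inE => hj ->; have [_ /andP[h1 h2] _] := hxt j.
    move: h1 h2; rewrite -/(x j) -natr1 => h1 h2.
    have hN : N%:R * `|2 * x j - c| <= N%:R * l by apply: ler_wpM2l => //; exact: ltW.
    move: hN; rewrite -[X in X * `|_|](gtr0_norm NR) -normrM !ler_norml => /andP[? ?].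
    by apply/andP; split; lra.
have kkN i j : kk i j <= N%:R.
  apply: le_trans (cabs_sum _ _ _) _.
  under eq_bigr do rewrite cabs_e.
  by rewrite sumr_const_nat subSS subn0.
have hdiv' m : (0 < m)%N -> m%:R <= N%:R ^+ 2 :> R -> (size (divisors m))%:R <= S.
  by rewrite -natrX ler_nat; exact: hdiv.
have N2L' : N%:R ^+ 2 < 2 ^+ L :> R by rewrite -!natrX ltr_nat.
have LS2 : (2 * L.+1)%:R <= S.
  apply: le_trans LS; rewrite natrM; apply: ler_wpM2r => //.
  by rewrite -natrX ler_nat.
have := @large_values_count R _ (fun j => 2 * x j) (fun j => 2 * t j)
  (fun i j => (d (i, j)).1.1) (fun i j => (d (i, j)).2) (fun i j => (d (i, j)).1.2)
  kk N%:R S mu L S32 SN N7' mu0 hdiv' hX hsep (fun i j => hd (i, j)) kkN N2L' LS2 dual.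
rewrite card_sig => hc; apply: (le_trans mes); rewrite lee_fin.
rewrite ler_pdivrMr //; apply: (le_trans hc).
rewrite (_ : S ^+ 40 * N%:R ^+ 2 / mu ^+ 2 = S ^+ 40 * (N%:R ^+ 2 / lam ^+ 4) * 2 ^+ 6); last first.
  by rewrite /mu; field; rewrite gt_eqF.
rewrite (_ : S ^+ 41 * (N%:R / lam ^+ 4) * N%:R = S ^+ 40 * (N%:R ^+ 2 / lam ^+ 4) * S); last first.
  by field; rewrite gt_eqF.
apply: ler_wpM2l; first by nonneg.
by apply: le_trans S32; rewrite ler_weXn2l // ler1n.
Qed.

Lemma levelset_measure_le1 (R : realType) (N : nat) (a : nat -> R[i]) (lam : R) :
  (lebesgue_measure (levelset N a lam) <= 1)%E.
Proof.
apply: (@le_trans _ _ (lebesgue_measure (`[0%R, 1%R]%classic : set R))).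
  by apply: lebesgue_measure_le => x [x01 _]; rewrite /= in_itv.
by rewrite lebesgue_measure_itv /= lte_fin ltr01 oppr0 adde0.
Qed.

(** * Choice of the constants *)

Local Open Scope classical_set_scope.

Theorem theorem1p1 (R : realType) (C : R -> R) :
  exists K : R -> R,
    forall (a : nat -> nat -> R[i]) (lam : nat -> R),
      (forall N : nat, (0 < N)%N ->
         \sum_(1 <= n < N.+1) cabs (a N n) ^+ 2 = 1) ->
      lessapprox C (fun N => (N%:R `^ (1 / 4 + 1 / 10))%:E)
                   (fun N => (lam N)%:E) ->
      (forall N : nat, (0 < N)%N -> lam N <= N%:R `^ (1 / 2)) ->
      lessapprox K (fun N => lebesgue_measure (levelset N (a N) (lam N)))
                   (fun N => (N%:R / lam N ^+ 4)%:E).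
Proof.
(* [K] has to be fixed before [a] and [lam]: a constant depending on [eps] and [C] alone is found
   for each [eps], and then chosen. *)
suff /choice[K hK] : forall eps : R, exists k : R, 0 < eps -> 0 < k /\
    forall (a : nat -> nat -> R[i]) (lam : nat -> R),
      (forall N : nat, (0 < N)%N -> \sum_(1 <= n < N.+1) cabs (a N n) ^+ 2 = 1) ->
      lessapprox C (fun N => (N%:R `^ (1 / 4 + 1 / 10))%:E) (fun N => (lam N)%:E) ->
      (forall N : nat, (0 < N)%N -> lam N <= N%:R `^ (1 / 2)) ->
      forall N : nat, (0 < N)%N ->
        (lebesgue_measure (levelset N (a N) (lam N)) <=
           (k * N%:R `^ eps)%:E * (N%:R / lam N ^+ 4)%:E)%E.
  exists K => a lam h1 h2 h3 eps e0; have [k0 hk] := hK eps e0.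
  by split => // N N0; exact: hk.
move=> eps; have [e0|e0] := ltP 0 eps; last by exists 0.
(* [S = A N^d] enters the final bound as [S^41]. The divisor bound is applied to [m <= N^2], hence
   the exponent [d / 2]. *)
pose d := eps / 41; have d0 : 0 < d by rewrite divr_gt0.
have d20 : 0 < d / 2 by rewrite divr_gt0.
have [Cd [Cd0 hCd]] := divisor_bound d20.
have [Cl [Cl0 hCl]] := log_bound d0.
pose A := 2 ^+ 32 + Cd + 2 ^+ 10 * Cl + `|C d|.
have t10 : 0 < 2 ^+ 10 :> R by rewrite exprn_gt0.
have t32 : 0 < 2 ^+ 32 :> R by rewrite exprn_gt0.
have t10Cl : 0 < 2 ^+ 10 * Cl by rewrite mulr_gt0.
have Cd_ge0 : 0 <= `|C d| by [].
have A32 : 2 ^+ 32 <= A.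
  by rewrite /A -!addrA lerDl !addr_ge0 // ltW.
have ACd : Cd <= A by rewrite /A addrAC -addrA [_ + Cd]addrC -addrA lerDl !addr_ge0 // ltW.
have ACl : 2 ^+ 10 * Cl <= A.
  by rewrite /A [_ + 2 ^+ 10 * Cl]addrC -addrA lerDl !addr_ge0 // ltW.
have AC : `|C d| <= A by rewrite /A lerDr !addr_ge0 // ltW.
have A0 : 0 < A by apply: lt_le_trans A32.
exists (A ^+ 41) => _; split; first by rewrite exprn_gt0.
move=> a lam h1 h2 h3 N N0.
have NR : 0 < N%:R :> R by rewrite ltr0n.
pose u : R := N%:R `^ d; have u1 : 1 <= u by exact: powR_nat_ge1.
pose S := A * u.
have AS : A <= S by rewrite /S ler_peMr // ltW.
have S32 : 2 ^+ 32 <= S by apply: le_trans AS.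
have S1 : 1 <= S by apply: le_trans S32; rewrite exprn_ege1 // ler1n.
have S0 : 0 < S by lra.
have Su : S ^+ 41 = A ^+ 41 * N%:R `^ eps.
  by rewrite /S exprMn -[u ^+ 41]powR_mulrn ?powR_ge0 // /u -powRrM /d divfK.
have [C0 hC] := h2 d d0; have {}hC := hC N N0.
rewrite -EFinM lee_fin -/u in hC.
have p0 : 0 < N%:R `^ (1 / 4 + 1 / 10) :> R by exact: powR_gt0.
have u0 : 0 < u by lra.
have lam0 : 0 < lam N.
  by move: (lt_le_trans p0 hC); rewrite pmulr_rgt0 // mulr_gt0.
have hS : N%:R `^ (1 / 4 + 1 / 10) <= S * lam N.
  apply: (le_trans hC); apply: ler_wpM2r; first exact: ltW.
  by apply: ler_wpM2r; [exact: ltW|apply: le_trans AC; exact: ler_norm].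
rewrite -EFinM.
(* If [N < S^20], the trivial bound 1 suffices: [lam <= N^(1/2)] gives [N / lam^4 >= 1 / N], and
   [S^41 >= N]. *)
have [SN|SN] := leP (S ^+ 20) N%:R; last first.
  apply: (@le_trans _ _ 1%E); first exact: levelset_measure_le1.
  rewrite lee_fin -Su mulrA ler_pdivlMr ?exprn_gt0 // mul1r.
  have l4 : lam N ^+ 4 <= N%:R * N%:R.
    apply: (@le_trans _ _ ((N%:R `^ (1 / 2)) ^+ 4)).
      by rewrite lerXn2r ?nnegrE ?powR_ge0 ?(ltW lam0) //; exact: h3.
    rewrite -powR_mulrn ?powR_ge0 // -powRrM (_ : 1 / 2 * 4 = 2%:R); last by field.
    by rewrite powR_mulrn // expr2.
  apply: (le_trans l4); apply: ler_wpM2r; first exact: ltW.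
  by apply: (le_trans (ltW SN)); rewrite ler_weXn2l.
have [L [hL1 hL2 hL3]] := hCl N N0.
rewrite mulrC -mulrC -Su.
apply: (@levelset_measure_large R N L) => //; first exact: h1.
(* As [20 (1/4 + 1/10) = 7], the hypothesis on [lam] raised to the power 20 is
   [N^7 <= lam^20 S^20]. *)
- rewrite -exprMn [lam N * S]mulrC.
  rewrite (_ : N%:R ^+ 7 = (N%:R `^ (1 / 4 + 1 / 10)) ^+ 20); last first.
    rewrite -[RHS]powR_mulrn ?powR_ge0 // -powRrM -[LHS]powR_mulrn ?ler0n //.
    by congr (_ `^ _); field.
  by rewrite lerXn2r ?nnegrE ?powR_ge0 // mulr_ge0 // ltW.
- move=> m m0 mN; apply: (le_trans (hCd m m0)).
  apply: ler_pM; [exact: ltW|exact: powR_ge0|exact: ACd|].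
  rewrite /u (_ : N%:R `^ d = (N ^ 2)%:R `^ (d / 2)).
    by apply: ge0_ler_powR; rewrite ?nnegrE ?ler0n ?ler_nat // divr_ge0 // ltW.
  by rewrite natrX -powR_mulrn // -powRrM mulrC divfK.
- apply: (@le_trans _ _ (2 ^+ 10 * Cl * u)).
    by rewrite -mulrA; apply: ler_wpM2l => //; exact: ltW.
  by apply: ler_wpM2r => //; exact: ltW.
Qed.
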